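(* Let $p\in(2,6)$, $\mu>0$, $\ell>0$, and let $\mathcal G$ be the real line with a pendant of length $\ell$, i.e. the metric graph consisting of two halflines and one bounded edge of length $\ell$, all attached at a single common vertex. Then $$\inf_{u\in H^1_\mu(\mathcal G)}E(u,\mathcal G)<E(\phi_\mu,\mathbb R),$$ so that $\mathcal G$ admits a ground state of mass $\mu$.
   Context: $H^1_\mu(\mathcal G)$: continuous functions on $\mathcal G$, $H^1$ on each edge, with $\int_{\mathcal G}|u|^2=\mu$. $E(u,\mathcal G)=\frac12\int_{\mathcal G}|u'|^2-\frac1p\int_{\mathcal G}|u|^p$. A ground state of mass $\mu$ is a minimizer of $E(\cdot,\mathcal G)$ on $H^1_\mu(\mathcal G)$. $\phi_\mu$ is the soliton of mass $\mu$ on $\mathbb R$, the minimizer of $E(\cdot,\mathbb R)$ on $H^1_\mu(\mathbb R)$. *)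

(* Defs.v *)
From HB Require Import structures.
From mathcomp Require Import all_boot all_order all_algebra.
From mathcomp Require Import all_classical all_reals all_analysis.
Set Implicit Arguments. Unset Strict Implicit. Unset Printing Implicit Defensive.
Import Order.TTheory GRing.Theory Num.Theory.
Local Open Scope classical_set_scope.
Local Open Scope ring_scope.

Section Defs.
Variable R : realType.
Local Notation mu := (@lebesgue_measure R).

Definition L2 (I : set R) (f : R -> R) : Prop :=
  mu.-integrable I (fun x => (f x ^+ 2)%:E).

(* (u, g) : u is in H^1(I) (continuous representative) with weak derivative g:
   u, g in L^2(I), g measurable and locally integrable, and
   u y - u x = \int_x^y g  for all x <= y in I. *)
Definition H1pair (I : set R) (u g : R -> R) : Prop :=
  [/\ measurable_fun I g, L2 I u, L2 I g &
     forall x y, I x -> I y -> x <= y ->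
       mu.-integrable `[x, y] (EFin \o g) /\
       u y - u x = Rintegral mu `[x, y] g].

Definition mass (I : set R) (u : R -> R) : R :=
  Rintegral mu I (fun x => u x ^+ 2).

Definition energy (p : R) (I : set R) (u g : R -> R) : R :=
  2^-1 * Rintegral mu I (fun x => g x ^+ 2)
  - p^-1 * Rintegral mu I (fun x => `|u x| `^ p).

(* The real line with a pendant of length l: two halflines [0,+oo) (edges 1,2)
   and a bounded edge [0,l] (edge 3), glued at the common vertex 0. A function
   on the graph is a triple (u1,u2,u3), with weak derivatives (g1,g2,g3). *)
Definition halfline : set R := `[0, +oo[.
Definition pendant (l : R) : set R := `[0, l].

Definition H1mu_pendant (l m : R) (u1 g1 u2 g2 u3 g3 : R -> R) : Prop :=
  [/\ H1pair halfline u1 g1, H1pair halfline u2 g2, H1pair (pendant l) u3 g3,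
      (* continuity at the vertex *) u1 0 = u3 0 /\ u2 0 = u3 0 &
      mass halfline u1 + mass halfline u2 + mass (pendant l) u3 = m].

Definition energy_pendant (p l : R) (u1 g1 u2 g2 u3 g3 : R -> R) : R :=
  energy p halfline u1 g1 + energy p halfline u2 g2 + energy p (pendant l) u3 g3.

Definition inf_energy_pendant (p l m : R) : \bar R :=
  ereal_inf [set e : \bar R | exists u1 g1 u2 g2 u3 g3,
     H1mu_pendant l m u1 g1 u2 g2 u3 g3 /\
     e = (energy_pendant p l u1 g1 u2 g2 u3 g3)%:E].

Definition H1mu_line (m : R) (u g : R -> R) : Prop :=
  H1pair [set: R] u g /\ mass [set: R] u = m.
End Defs.

(* Main.v *)
Require Import Defs.
From HB Require Import structures.
From mathcomp Require Import all_boot all_order all_algebra.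
From mathcomp Require Import all_classical all_reals all_analysis.
From mathcomp Require Import measurable_realfun ring lra.
Set Implicit Arguments. Unset Strict Implicit. Unset Printing Implicit Defensive.
Import Order.TTheory GRing.Theory Num.Theory.
Import numFieldNormedType.Exports.
Local Open Scope classical_set_scope.
Local Open Scope ring_scope.

(** Cut a function on the line at the median of its mass and reflect the better
    half: the result is even, has the same mass and no more energy.  Moving the
    part over [(-l/2, l/2)] of an even function to the pendant, folded at the
    vertex, keeps mass and potential energy and divides the kinetic energy of
    that part by 4.  The gain is strict unless the function is constant on that
    interval; a constant value 0 is excluded by strict subadditivity, and a
    nonzero plateau can be improved by hand.  This gives the strict inequality.

    For existence, [E(t u) <= t^2 E(u)] for [t >= 1] makes splitting a near
    minimizer into two pieces cost a fixed amount of energy.  If the potential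
    energy in the pendant vanished along a minimizing sequence, reflecting and
    folding its halfline part would yield another minimizing sequence that does not
    vanish at the tip of the pendant.  So a nonvanishing minimizing sequence
    exists; it is tight, hence precompact in [L2], and the parallelogram law
    makes its derivatives Cauchy in [L2] as well. *)

(** On the line the proof works with a bare $H^1$ function, which may have plateaus and zeros; hence
    the case distinction behind the strict inequality.

    One quantitative estimate serves both halves. If [e < 0] bounds the energy at mass [m] from
    below, rescaling shows that a function of mass [N <= M <= m] has energy at least [(N / m) e]
    plus [((m / M)^(p/2-1) - 1) / p] times its potential term, a positive surplus as soon as [M < m]
    and the function is not zero. For the strict inequality [e] is the energy of a line function
    supposed unbeaten on the graph; for existence it is the infimum on the graph. A halfline
    function is completed to the graph by a constant on the pendant and a linear ramp on the other
    halfline, at a cost proportional to the square of its value at the vertex.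

    Minimizing sequences could spread out or escape along a halfline; a fixed amount of potential
    energy in the pendant anchors them. Compactness is then read off along an ultrafilter, where
    values at all points converge at once. The condition [p < 6] enters twice: in coercivity and in
    the negativity of the infimum. *)

Section powers.
Context {R : realType}.
Implicit Types x y r : R.

(** Young's inequality for [y * 1] with the exponents [r] and [r / (r - 1)], multiplied by [r]. *)
Lemma bernoulli_powR y r : 0 <= y -> 1 < r -> 1 + r * (y - 1) <= y `^ r.
Proof.
move=> y0 r1; have r0 : 0 < r by lra.
have q0 : 0 < r / (r - 1) by rewrite divr_gt0//; lra.
have := @conjugate_powR R y 1 r (r / (r - 1)) y0 ler01 r0 q0.
rewrite powR1 mulr1 invf_div mul1r.
have -> : r^-1 + (r - 1) / r = 1 by field; lra.
move=> /(_ erefl); rewrite -(ler_pM2l r0) => h.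
have : r * (y `^ r / r + (r - 1) / r) = y `^ r + (r - 1) by field; lra.
by lra.
Qed.

(** Convexity: the graph of the power lies above its tangent at [y]. It is Bernoulli's inequality at
    [x / y], multiplied by the [r]-th power of [y]. *)
Lemma powR_sub_le x y r : 0 <= x -> x <= y -> 1 < r ->
  y `^ r - x `^ r <= r * y `^ (r - 1) * (y - x).
Proof.
move=> x0 xy r1; have [y0|y0] := eqVneq y 0.
  have -> : x = y by lra.
  by rewrite !subrr mulr0.
have yp : 0 < y by rewrite lt_neqAle eq_sym y0 (le_trans x0).
have xy0 : 0 <= x / y by rewrite divr_ge0// ltW.
have := bernoulli_powR xy0 r1.
have yr0 : 0 < y `^ r by rewrite powR_gt0.
rewrite -(ler_pM2l yr0) -powRM ?(ltW yp)// mulrCA divff// mulr1.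
have r0 : 0 < r by lra.
have <- := mulr_powRB1 (ltW yp) r0.
have -> : y * y `^ (r - 1) * (1 + r * (x / y - 1)) =
  y * y `^ (r - 1) + r * y `^ (r - 1) * (x - y) by field.
by lra.
Qed.

Lemma powR_sqr_norm x r : `|x| `^ (2 * r) = (x ^+ 2) `^ r.
Proof. by rewrite powRrM powR_mulrn// real_normK ?num_real. Qed.

(** The first factor will be bounded by a supremum; the second integrates to the mass. *)
Lemma powR_norm_split x r : 2 < r -> `|x| `^ r = (x ^+ 2) `^ (r / 2 - 1) * x ^+ 2.
Proof.
move=> r2; have r0 : 0 < r / 2 by lra.
rewrite mulrC mulr_powRB1 ?sqr_ge0// -powR_sqr_norm.
by congr (_ `^ _); field.
Qed.

End powers.

(** * Affine changes of variable for Lebesgue integrals *)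

Section affine.
Context {R : realType}.
Notation mu := (@lebesgue_measure R).
Implicit Types (a b : R).

Definition affine a b : R -> R := fun x => a * x + b.

Lemma measurable_affine a b (D : set R) : measurable_fun D (affine a b).
Proof.
apply: measurable_funTS; apply: continuous_measurable_fun => x.
by rewrite /affine; apply: cvgD; [apply: cvgMr; exact: cvg_id|exact: cvg_cst].
Qed.

Lemma measurable_affine_preimage a b (D : set R) :
  measurable D -> measurable (affine a b @^-1` D).
Proof. by move=> mD; rewrite -[X in measurable X]setTI; exact: measurable_affine. Qed.

(** [|a|] times the pushforward of [mu] agrees with [mu] on the intervals []c, d]], so uniqueness of
    Lebesgue measure applies. *)
Lemma lebesgue_measure_affine a b (D : set R) : a != 0 -> measurable D ->
  mu (affine a b @^-1` D) = (`|a|^-1%:E * mu D)%E.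
Proof.
move=> a0 mD; have na0 : 0 < `|a| by rewrite normr_gt0.
pose nu : {measure set (measurableTypeR R) -> \bar R} :=
  @mscale _ _ R (NngNum (ltW na0))
    (pushforward mu (affine a b : measurableTypeR R -> measurableTypeR R)).
have := @lebesgue_measure_unique R (nu (@measurable_affine a b setT)) _ D mD.
rewrite /nu /= /mscale/= => ->; last first.
  move=> _ [[c d] _ <-] /=.
  rewrite /mscale/= /pushforward.
  have [cd|dc] := ltP c d; last first.
    rewrite set_itv_ge ?bnd_simp -?leNgt// preimage_set0.
    by rewrite !measure0 mule0.
  have [ap|an] := ltP 0 a.
    have -> : affine a b @^-1` `]c, d] = `](c - b) / a, (d - b) / a]%classic.
      apply/seteqP; split => x /=; rewrite !in_itv/= /affine => /andP[h1 h2];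
      apply/andP; move: h1 h2; rewrite ltr_pdivrMr// ler_pdivlMr//; split; lra.
    rewrite !lebesgue_measure_itv/= !lte_fin ltr_pM2r ?invr_gt0//.
    rewrite ltrD2r cd -!EFinD -EFinM gtr0_norm//; congr EFin.
    by field.
  have {}an : a < 0 by rewrite lt_neqAle a0.
  have -> : affine a b @^-1` `]c, d] = `[(d - b) / a, (c - b) / a[%classic.
    apply/seteqP; split => x /=; rewrite !in_itv/= /affine => /andP[h1 h2];
    apply/andP; move: h1 h2; rewrite ltr_ndivlMr// ler_ndivrMr//; split; lra.
  rewrite !lebesgue_measure_itv/= !lte_fin ltr_nM2r ?invr_lt0//.
  rewrite ltrD2r cd -!EFinD -EFinM ltr0_norm//; congr EFin.
  by field.
by rewrite muleA -EFinM mulVf ?gt_eqF// mul1e.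
Qed.

Lemma ge0_integral_affine a b (D : set R) (f : R -> \bar R) : a != 0 ->
  measurable D -> measurable_fun D f -> (forall x, D x -> 0 <= f x)%E ->
  (\int[mu]_(x in affine a b @^-1` D) f (affine a b x) =
   `|a|^-1%:E * \int[mu]_(x in D) f x)%E.
Proof.
move=> a0 mD mf f0; have na0 : 0 <= `|a|^-1 by [].
pose phi : measurableTypeR R -> measurableTypeR R := affine a b.
have mphi : measurable_fun [set: measurableTypeR R] phi by exact: measurable_affine.
have f0' : {in D, forall y, (0 <= f y)%E} by move=> y /[!inE]; exact: f0.
transitivity (\int[pushforward mu phi]_(y in D) f y)%E.
  by rewrite (ge0_integral_pushforward mphi mu mD mf f0').
rewrite -[RHS](ge0_integral_mscale mu mD (NngNum na0) mf f0).
apply: eq_measure_integral => A mA _.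
exact: lebesgue_measure_affine.
Qed.

Lemma measurable_fun_affine a b (D : set R) (f : R -> R) : measurable D ->
  measurable_fun D f -> measurable_fun (affine a b @^-1` D) (f \o affine a b).
Proof.
move=> mD mf; apply: (measurable_comp mD) => //.
  by move=> _ [x /= Dx <-].
exact: measurable_affine.
Qed.

Lemma integrable_affine a b (D : set R) (f : R -> R) : a != 0 ->
  measurable D -> mu.-integrable D (EFin \o f) ->
  mu.-integrable (affine a b @^-1` D) (EFin \o (f \o affine a b)).
Proof.
move=> a0 mD /integrableP[/measurable_EFinP mf fi]; apply/integrableP; split.
  by apply/measurable_EFinP; exact: (@measurable_fun_affine a b D f).
rewrite (@ge0_integral_affine a b D (fun x => `|(f x)%:E|%E))//.
  by rewrite lte_mul_pinfty.
by do 2 apply: measurableT_comp => //.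
Qed.

Lemma Rintegral_affine a b (D : set R) (f : R -> R) : a != 0 ->
  measurable D -> mu.-integrable D (EFin \o f) ->
  Rintegral mu (affine a b @^-1` D) (f \o affine a b) =
  `|a|^-1 * Rintegral mu D f.
Proof.
move=> a0 mD fi; have mf := measurable_int _ fi.
have ip := @integrable_pos_fin_num _ _ _ mu D mD _ fi.
have iN := @integrable_neg_fin_num _ _ _ mu D mD _ fi.
rewrite /Rintegral [in RHS]integralE integralE.
transitivity (fine ((`|a|^-1)%:E * \int[mu]_(x in D) ((EFin \o f)^\+ x) -
    (`|a|^-1)%:E * \int[mu]_(x in D) ((EFin \o f)^\- x))%E); last first.
  rewrite fineB; [|exact: fin_numM|exact: fin_numM].
  by rewrite fineM// fineM// -mulrBr -fineB.
congr (fine (_ - _)).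
- rewrite -(@ge0_integral_affine a b D (EFin \o f)^\+%E)//; last exact: measurable_funepos.
  by apply: eq_integral => x _; rewrite !funeposE.
- rewrite -(@ge0_integral_affine a b D (EFin \o f)^\-%E)//; last exact: measurable_funeneg.
  by apply: eq_integral => x _; rewrite !funenegE.
Qed.

End affine.

(** * Real integrals, quadratic expansions and the Cauchy-Schwarz inequality *)

Section Rintegral_facts.
Context {R : realType}.
Notation mu := (@lebesgue_measure R).
Implicit Types (A B D I : set R) (f g : R -> R) (a b c : R).

Lemma ge0_Rintegral_subset A B f : measurable A -> measurable B -> A `<=` B ->
  mu.-integrable B (EFin \o f) -> (forall x, B x -> 0 <= f x) ->
  Rintegral mu A f <= Rintegral mu B f.
Proof.
move=> mA mB AB fi f0; have fiA : mu.-integrable A (EFin \o f) by exact: integrableS fi.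
rewrite /Rintegral fine_le//; [exact: integrable_fin_num|exact: integrable_fin_num|].
apply: ge0_subset_integral => //; first exact: measurable_int fi.
Qed.

Lemma integrable_setU A B f : measurable A -> measurable B ->
  mu.-integrable A (EFin \o f) -> mu.-integrable B (EFin \o f) ->
  [disjoint A & B] -> mu.-integrable (A `|` B) (EFin \o f).
Proof.
move=> mA mB /integrableP[mfA fA] /integrableP[mfB fB] AB.
have mfU : measurable_fun (A `|` B) (EFin \o f) by apply/measurable_funU.
apply/integrableP; split => //.
rewrite ge0_integral_setU//; last exact: measurableT_comp.
exact: lte_add_pinfty.
Qed.

Lemma Rintegral_split (a b : itv_bound R) c f :
  mu.-integrable [set` Interval a b] (EFin \o f) ->
  (a <= BLeft c)%O -> (BRight c <= b)%O ->
  Rintegral mu [set` Interval a b] f =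
  Rintegral mu [set` Interval a (BRight c)] f +
  Rintegral mu [set` Interval (BLeft c) b] f.
Proof.
move=> fi ac cb.
have ac' : (a <= BRight c)%O by rewrite (le_trans ac)// bnd_simp.
have := Rintegral_itvB fi ac' cb.
rewrite Rintegral_itv_obnd_cbnd; first by lra.
by apply: integrableS fi => //; apply: subset_itvr.
Qed.

Lemma integrable_lincomb D a b f g : measurable D ->
  mu.-integrable D (EFin \o f) -> mu.-integrable D (EFin \o g) ->
  mu.-integrable D (EFin \o (fun x => a * f x + b * g x)).
Proof.
move=> mD fi gi.
apply: (@eq_integrable _ _ _ mu D mD (fun x => a%:E * (f x)%:E + b%:E * (g x)%:E)%E).
  by move=> x _; rewrite /= EFinD !EFinM.
by apply: integrableD => //; apply: integrableZl.
Qed.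

Lemma Rintegral_lincomb D a b f g : measurable D ->
  mu.-integrable D (EFin \o f) -> mu.-integrable D (EFin \o g) ->
  Rintegral mu D (fun x => a * f x + b * g x) =
  a * Rintegral mu D f + b * Rintegral mu D g.
Proof.
move=> mD fi gi.
rewrite RintegralD//; last 2 first.
- by apply: (@eq_integrable _ _ _ mu D mD (fun x => a%:E * (f x)%:E)%E); [move=> x _; rewrite /= EFinM|exact: integrableZl].
- by apply: (@eq_integrable _ _ _ mu D mD (fun x => b%:E * (g x)%:E)%E); [move=> x _; rewrite /= EFinM|exact: integrableZl].
by rewrite !RintegralZl.
Qed.

Lemma integrable_cst_itv a b c : mu.-integrable `[a, b] (EFin \o (fun=> c)).
Proof.
apply: measurable_bounded_integrable => //.
  by rewrite /= lebesgue_measure_itv/=; case: ifP => _; rewrite ?ltry.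
by exists `|c|; split; [exact: num_real|move=> x xc y _; exact: ltW].
Qed.

Lemma Rintegral_cst_itv a b c : a <= b -> Rintegral mu `[a, b] (fun=> c) = c * (b - a).
Proof.
move=> ab; rewrite Rintegral_cst//= lebesgue_measure_itv/= lte_fin.
have [_|ba] := ltP a b; first by [].
have -> : b - a = 0 by lra.
by rewrite mulr0.
Qed.

Lemma integrable_sqr_mul D f g : measurable D -> measurable_fun D f ->
  measurable_fun D g -> L2 D f -> L2 D g ->
  mu.-integrable D (EFin \o (fun x => f x * g x)).
Proof.
move=> mD mf mg fi gi.
have /= := @integrable_lincomb D 1 1 _ _ mD fi gi.
apply: le_integrable => //.
  by apply/measurable_EFinP; exact: measurable_funM.
move=> x _; rewrite /= lee_fin !mul1r normrM.
rewrite [leRHS]ger0_norm ?addr_ge0 ?sqr_ge0//.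
have := sqr_ge0 (`|f x| - `|g x|).
rewrite -[f x ^+ 2]real_normK ?num_real// -[g x ^+ 2]real_normK ?num_real//.
have := sqr_ge0 (`|f x|); have := sqr_ge0 (`|g x|).
by rewrite sqrrB -mulr_natr; lra.
Qed.

Lemma L2_lincomb D a b f g : measurable D -> measurable_fun D f ->
  measurable_fun D g -> L2 D f -> L2 D g -> L2 D (fun x => a * f x + b * g x).
Proof.
move=> mD mf mg fi gi; have fgi := integrable_sqr_mul mD mf mg fi gi.
have h := integrable_lincomb (a ^+ 2) (b ^+ 2) mD fi gi.
have := integrable_lincomb 1 (2 * a * b) mD h fgi.
by apply: eq_integrable => // x _ /=; congr EFin; ring.
Qed.

Lemma Rintegral_sqr_lincomb D a b f g : measurable D -> measurable_fun D f ->
  measurable_fun D g -> L2 D f -> L2 D g ->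
  Rintegral mu D (fun x => (a * f x + b * g x) ^+ 2) =
  a ^+ 2 * Rintegral mu D (fun x => f x ^+ 2) +
  2 * a * b * Rintegral mu D (fun x => f x * g x) +
  b ^+ 2 * Rintegral mu D (fun x => g x ^+ 2).
Proof.
move=> mD mf mg fi gi; have fgi := integrable_sqr_mul mD mf mg fi gi.
have h := integrable_lincomb (a ^+ 2) (b ^+ 2) mD fi gi.
transitivity (Rintegral mu D (fun x => 1 * (a ^+ 2 * f x ^+ 2 + b ^+ 2 * g x ^+ 2) + (2 * a * b) * (f x * g x))).
  by apply: eq_Rintegral => x _; ring.
by rewrite Rintegral_lincomb// Rintegral_lincomb//; ring.
Qed.

Lemma Rintegral_sqr_ge0 D f : 0 <= Rintegral mu D (fun x => f x ^+ 2).
Proof. by apply: Rintegral_ge0 => x _; exact: sqr_ge0. Qed.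

(** Expand the nonnegative integral of [(g - c) ^+ 2], where [c] is the mean of [g]. *)
Lemma Rintegral_cauchy_itv a b g : a <= b -> measurable_fun `[a, b] g ->
  mu.-integrable `[a, b] (EFin \o g) -> L2 `[a, b] g ->
  (Rintegral mu `[a, b] g) ^+ 2 <= (b - a) * Rintegral mu `[a, b] (fun x => g x ^+ 2).
Proof.
move=> ab mg gi g2; have [->|nab] := eqVneq a b.
  by rewrite set_itv1 !Rintegral_set1 expr0n/= mulr0.
have ba : 0 < b - a by rewrite subr_gt0 lt_neqAle nab.
set G := Rintegral mu _ g; pose c := G / (b - a).
have := Rintegral_sqr_ge0 `[a, b] (fun x => 1 * g x + (- c) * 1).
rewrite (Rintegral_sqr_lincomb 1 (- c) _ mg (measurable_cst _) g2); last 2 first.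
- by [].
- exact: (integrable_cst_itv a b (1 ^+ 2)).
under [X in 2 * 1 * _ * X]eq_Rintegral do rewrite mulr1.
rewrite -/G expr1n mul1r Rintegral_cst_itv//.
set Q := Rintegral _ _ _.
rewrite (_ : _ + _ + _ = Q - G ^+ 2 / (b - a)); last by rewrite /c; field; lra.
by rewrite subr_ge0 ler_pdivrMr// mulrC.
Qed.

End Rintegral_facts.

(** * Gluing a function on [[0, T]] to a shifted halfline function *)

Section gluing.
Context {R : realType}.
Notation mu := (@lebesgue_measure R).
Implicit Types (f g : R -> R) (T : R).

Definition hglue T f g : R -> R := fun x => if x <= T then f x else g (x - T).

Lemma hglue_comp T f g (h : R -> R) : h \o hglue T f g = hglue T (h \o f) (h \o g).
Proof. by apply/funext => x /=; rewrite /hglue; case: ifP. Qed.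

Lemma halfline_split T : 0 <= T ->
  @halfline R = `[0, T]%classic `|` `]T, +oo[%classic.
Proof.
move=> T0; apply/seteqP; split => x /=; rewrite /halfline/= !in_itv/= ?andbT.
  by move=> x0; have [xT|Tx] := leP x T; [left; rewrite x0|right].
by case=> [/andP[]|]//; lra.
Qed.

Lemma halfline_split_disjoint T : [disjoint `[0, T]%classic & `]T, +oo[%classic : set R].
Proof. by apply/disj_setPS => y [/=]; rewrite 2!in_itv/= andbT => /andP[_]; rewrite leNgt => /negP. Qed.

Lemma shift_preimage T : affine 1 (- T) @^-1` `]0, +oo[%classic = `]T, +oo[%classic :> set R.
Proof. by apply/seteqP; split => x /=; rewrite !in_itv/= !andbT /affine; lra. Qed.

Lemma measurable_hglue T f g : 0 <= T -> measurable_fun `[0, T] f ->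
  measurable_fun (@halfline R) g -> measurable_fun (@halfline R) (hglue T f g).
Proof.
move=> T0 mf mg; rewrite (halfline_split T0).
apply/measurable_funU => //; split.
  by apply: eq_measurable_fun mf => x; rewrite inE/= in_itv/= /hglue => /andP[_ ->].
have mg' : measurable_fun (`]0, +oo[%classic : set R) g.
  rewrite /halfline in mg; apply: measurable_funS mg => // x /=.
  by rewrite !in_itv/= !andbT => /ltW.
have : measurable_fun (`]T, +oo[%classic : set R) (g \o affine 1 (- T)).
  by rewrite -shift_preimage; exact: measurable_fun_affine.
apply: eq_measurable_fun => x; rewrite inE/= in_itv/= /hglue /affine andbT ltNge.
by move=> /negPf ->; rewrite mul1r.
Qed.

Lemma integral_hglue T f g : 0 <= T -> mu.-integrable `[0, T] (EFin \o f) ->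
  mu.-integrable (@halfline R) (EFin \o g) ->
  mu.-integrable (@halfline R) (EFin \o hglue T f g) /\
  Rintegral mu (@halfline R) (hglue T f g) =
  Rintegral mu `[0, T] f + Rintegral mu (@halfline R) g.
Proof.
move=> T0 fi gi.
have gi' : mu.-integrable `]0, +oo[%classic (EFin \o g).
  rewrite /halfline in gi; apply: integrableS gi => // x /=.
  by rewrite !in_itv/= !andbT => /ltW.
have e1 : {in `[0, T]%classic, f =1 hglue T f g}.
  by move=> x; rewrite inE/= in_itv/= /hglue => /andP[_ ->].
have e2 : {in `]T, +oo[%classic, g \o affine 1 (- T) =1 hglue T f g}.
  move=> x; rewrite inE/= in_itv/= /hglue /affine andbT ltNge.
  by move=> /negPf ->; rewrite mul1r.
have i1 : mu.-integrable `[0, T] (EFin \o hglue T f g).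
  by apply: eq_integrable fi => // x xI /=; rewrite e1.
have i2' : mu.-integrable `]T, +oo[%classic (EFin \o (g \o affine 1 (- T))).
  by rewrite -shift_preimage; apply: integrable_affine.
have i2 : mu.-integrable `]T, +oo[%classic (EFin \o hglue T f g).
  by apply: eq_integrable i2' => // x xI /=; rewrite -e2.
have iU := integrable_setU (measurable_itv _) (measurable_itv _) i1 i2 (halfline_split_disjoint T).
split; first by rewrite (halfline_split T0).
rewrite (halfline_split T0) Rintegral_setU//; last exact: halfline_split_disjoint.
rewrite -(eq_Rintegral mu e1) -(eq_Rintegral mu e2) -(halfline_split T0); congr (_ + _).
rewrite -shift_preimage Rintegral_affine//.
by rewrite normr1 invr1 mul1r Rintegral_itv_obnd_cbnd.
Qed.

End gluing.

#[local] Hint Extern 0 (measurable (@halfline _)) =>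
  (rewrite /halfline; exact: measurable_itv) : core.

(** * Sobolev functions on one edge: sup bound, scaling, affine maps, gluing *)

Section H1.
Context {R : realType}.
Notation mu := (@lebesgue_measure R).
Implicit Types (I J : set R) (u g v h : R -> R) (a b c r x y z p : R).

(** Common frame for halfline, pendant and line: an interval in which every point has room [r] on at
    least one side, which is what the sup bound needs. *)
Definition is_edge r I :=
  [/\ measurable I, forall x y z, I x -> I z -> x <= y <= z -> I y, 0 < r &
   forall x, I x -> (forall y, x <= y <= x + r -> I y) \/
                    (forall y, x - r <= y <= x -> I y)].

Definition grad I g := Rintegral mu I (fun x => g x ^+ 2).
Definition pow p I u := Rintegral mu I (fun x => `|u x| `^ p).

Lemma energyE p I u g : energy p I u g = 2^-1 * grad I g - p^-1 * pow p I u.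
Proof. by []. Qed.

Lemma halfline_edge r : 0 < r -> is_edge r (@halfline R).
Proof.
move=> r0; split => //.
- by move=> x y z; rewrite /halfline/= !in_itv/= !andbT; lra.
- by move=> x; rewrite /halfline/= !in_itv/= !andbT => x0; left => y; rewrite in_itv/= andbT; lra.
Qed.

Lemma pendant_edge r l : 0 < r -> r <= l / 2 -> is_edge r (@pendant R l).
Proof.
move=> r0 rl; split => //.
- by rewrite /pendant; exact: measurable_itv.
- by move=> x y z; rewrite /pendant/= !in_itv/=; lra.
- move=> x; rewrite /pendant/= !in_itv/= => xl.
  have [xh|xh] := leP x (l / 2); [left|right] => y; rewrite in_itv/=; lra.
Qed.

Lemma setT_edge r : 0 < r -> is_edge r [set: R].
Proof. by move=> r0; split => // x _; left. Qed.

Lemma edge_itv_sub r I x y : is_edge r I -> I x -> I y -> `[x, y] `<=` I.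
Proof. by case=> _ cI _ _ Ix Iy z /=; rewrite in_itv/= => xzy; exact: cI xzy. Qed.

Lemma H1_holder r I u g x y : is_edge r I -> H1pair I u g -> I x -> I y -> x <= y ->
  (u y - u x) ^+ 2 <= (y - x) * grad I g.
Proof.
move=> eI [mg u2 g2 ug] Ix Iy xy; have [gi ->] := ug x y Ix Iy xy.
have sub := edge_itv_sub eI Ix Iy; have [mI _ _ _] := eI.
have g2' : L2 `[x, y] g by apply: integrableS g2.
apply: (le_trans (Rintegral_cauchy_itv xy _ gi g2')).
  exact: measurable_funS mg.
rewrite ler_wpM2l ?subr_ge0// /grad; apply: ge0_Rintegral_subset => //.
by move=> z _; exact: sqr_ge0.
Qed.

Lemma H1_holder_abs r I u g x y : is_edge r I -> H1pair I u g -> I x -> I y ->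
  (u y - u x) ^+ 2 <= `|y - x| * grad I g.
Proof.
move=> eI ug Ix Iy; have [xy|/ltW yx] := leP x y.
  by rewrite ger0_norm ?subr_ge0//; exact: H1_holder eI ug Ix Iy xy.
rewrite -sqrrN opprB distrC ger0_norm ?subr_ge0//; exact: H1_holder eI ug Iy Ix yx.
Qed.

Lemma H1_continuous r I u g : is_edge r I -> H1pair I u g -> {within I, continuous u}.
Proof.
move=> eI ug; apply/subspace_continuousP => x Ix.
have K0 : 0 <= grad I g by exact: Rintegral_sqr_ge0.
set K := grad I g in K0 *.
apply/cvgrPdist_lt => e e0.
have d0 : 0 < e ^+ 2 / (K + 1) by rewrite divr_gt0 ?exprn_gt0//; lra.
rewrite near_withinE; near=> y; move=> Iy.
have xy : `|x - y| < e ^+ 2 / (K + 1).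
  by near: y; exists (e ^+ 2 / (K + 1)).
have := H1_holder_abs eI ug Iy Ix; rewrite -/K => h.
have K1 : 0 < K + 1 by lra.
rewrite -(@ltr_pXn2r _ 2) ?nnegrE// ?ltW// real_normK ?num_real//.
apply: (le_lt_trans h).
move: xy; rewrite ltr_pdivlMr//; apply: le_lt_trans.
by rewrite mulrDr mulr1 lerDl.
Unshelve. all: by end_near. Qed.

Lemma H1_measurable r I u g : is_edge r I -> H1pair I u g -> measurable_fun I u.
Proof.
move=> eI ug; have [mI _ _ _] := eI.
by apply: subspace_continuous_measurable_fun => //; exact: H1_continuous eI ug.
Qed.

(** Average [u x ^+ 2 <= 2 * u y ^+ 2 + 2 * (u x - u y) ^+ 2] over an interval of length [s] on a
    side of [x] with room, and use the Hölder bound. The length [s] stays free so that coercivity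
    can optimize it. *)
Lemma H1_sup r s I u g x : is_edge r I -> H1pair I u g -> I x -> 0 < s -> s <= r ->
  u x ^+ 2 <= 2 / s * mass I u + 2 * s * grad I g.
Proof.
move=> eI ug Ix s0 sr; have [mI cI r0 near_x] := eI.
have mu_ := H1_measurable eI ug; have [mg u2 g2 _] := ug.
suff [z [Iz Izs H]] : exists z, [/\ I z, I (z + s) &
    forall y, z <= y <= z + s -> `|x - y| <= s].
  have sub := edge_itv_sub eI Iz Izs.
  have u2' : L2 `[z, z + s] u by apply: integrableS u2.
  have : Rintegral mu `[z, z + s] (fun=> u x ^+ 2) <=
      Rintegral mu `[z, z + s] (fun y => 2 * u y ^+ 2 + (2 * s * grad I g) * 1).
    apply: le_Rintegral => //.
    - exact: integrable_cst_itv.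
    - by apply: integrable_lincomb => //; exact: integrable_cst_itv.
    move=> y /= yI; have Iy := sub _ yI; rewrite in_itv/= in yI.
    have := H1_holder_abs eI ug Iy Ix.
    have : `|x - y| * grad I g <= s * grad I g.
      by rewrite ler_wpM2r ?H ?Rintegral_sqr_ge0.
    move: (u x) (u y) (grad I g) (`|x - y|) => ux uy K d h1 h2.
    have := sqr_ge0 (2 * uy - ux).
    have -> : (2 * uy - ux) ^+ 2 = 2 * (ux - uy) ^+ 2 - (ux ^+ 2 - 2 * uy ^+ 2) by ring.
    lra.
  rewrite Rintegral_lincomb//; last exact: integrable_cst_itv.
  have zs : z <= z + s by rewrite lerDl ltW.
  rewrite !Rintegral_cst_itv//.
  rewrite [z + s - z]addrAC subrr add0r mul1r.
  have : Rintegral mu `[z, z + s] (fun y => u y ^+ 2) <= mass I u.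
    by apply: ge0_Rintegral_subset => // y _; exact: sqr_ge0.
  move: (Rintegral _ _ _) (mass I u) (grad I g) (u x) => A M K ux Am h.
  rewrite -(ler_pM2r s0) (le_trans h)// -subr_ge0.
  rewrite (_ : _ - _ = 2 * (M - A)); last by field; lra.
  lra.
have [H|H] := near_x x Ix.
  exists x; split=> //; first by apply: H; lra.
  by move=> y xy; rewrite distrC ger0_norm; lra.
exists (x - s); split=> [||y xy]; [by apply: H; lra|by rewrite subrK|].
by rewrite ger0_norm; lra.
Qed.

Lemma pow_integrable r p I u g : 2 < p -> is_edge r I -> H1pair I u g ->
  mu.-integrable I (EFin \o (fun x => `|u x| `^ p)).
Proof.
move=> p2 eI ug; have mu_ := H1_measurable eI ug; have [mI _ r0 _] := eI.
have [_ u2 _ _] := ug.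
set S := 2 / r * mass I u + 2 * r * grad I g.
have := @integrable_lincomb R I (S `^ (p / 2 - 1)) 0 _ _ mI u2 u2.
apply: le_integrable => //.
  apply/measurable_EFinP; apply: (measurableT_comp (measurable_powR p)).
  exact: measurableT_comp.
move=> x Ix /=; rewrite lee_fin ger0_norm ?powR_ge0// powR_norm_split// mul0r addr0.
have := H1_sup eI ug Ix r0 (lexx r); rewrite -/S => uS.
have S0 : 0 <= S by exact: le_trans (sqr_ge0 _) uS.
rewrite ger0_norm; last exact: mulr_ge0 (powR_ge0 _ _) (sqr_ge0 _).
rewrite ler_wpM2r ?sqr_ge0//; apply: ge0_ler_powR; rewrite ?nnegrE ?sqr_ge0//; lra.
Qed.

Lemma pow_ge0 p I u : 0 <= pow p I u.
Proof. by apply: Rintegral_ge0 => x _; exact: powR_ge0. Qed.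

Lemma pow_le_mass r p I u g S : 2 < p -> is_edge r I -> H1pair I u g ->
  (forall x, I x -> u x ^+ 2 <= S) -> pow p I u <= S `^ (p / 2 - 1) * mass I u.
Proof.
move=> p2 eI ug uS; have [mI _ _ _] := eI; have [_ u2 _ _] := ug.
rewrite /mass -RintegralZl//; apply: le_Rintegral => //.
- exact: pow_integrable eI ug.
- have := @integrable_lincomb R I (S `^ (p / 2 - 1)) 0 _ _ mI u2 u2.
  by apply: eq_integrable => // x _ /=; rewrite mul0r addr0.
move=> x Ix; rewrite powR_norm_split// ler_wpM2r ?sqr_ge0//.
have S0 : 0 <= S by exact: le_trans (sqr_ge0 _) (uS _ Ix).
by apply: ge0_ler_powR; rewrite ?nnegrE ?sqr_ge0// ?uS//; lra.
Qed.

Lemma H1_lincomb r I a b u g v h : is_edge r I -> H1pair I u g -> H1pair I v h ->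
  H1pair I (fun x => a * u x + b * v x) (fun x => a * g x + b * h x).
Proof.
move=> eI ug vh; have mu_ := H1_measurable eI ug; have mv := H1_measurable eI vh.
have [mI _ _ _] := eI; case: ug => mg u2 g2 ug; case: vh => mh v2 h2 vh; split.
- by apply: measurable_funD; apply: measurable_funM => //; exact: measurable_cst.
- exact: L2_lincomb.
- exact: L2_lincomb.
- move=> x y Ix Iy xy; have [gi ge] := ug x y Ix Iy xy; have [hi he] := vh x y Ix Iy xy.
  split; first exact: integrable_lincomb.
  by rewrite Rintegral_lincomb// -ge -he; ring.
Qed.

Lemma H1_scale r I a u g : is_edge r I -> H1pair I u g ->
  H1pair I (fun x => a * u x) (fun x => a * g x).
Proof.
move=> eI ug; have := H1_lincomb a 0 eI ug ug.
by congr (H1pair I _ _); apply/funext => x; rewrite mul0r addr0.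
Qed.

Lemma grad_scale I a g : measurable I -> L2 I g ->
  grad I (fun x => a * g x) = a ^+ 2 * grad I g.
Proof.
move=> mI g2; rewrite /grad -RintegralZl//.
by apply: eq_Rintegral => x _; rewrite exprMn.
Qed.

Lemma mass_scale I a u : measurable I -> L2 I u ->
  mass I (fun x => a * u x) = a ^+ 2 * mass I u.
Proof. exact: grad_scale. Qed.

Lemma pow_scale r p I a u g : 2 < p -> 0 <= a -> is_edge r I -> H1pair I u g ->
  pow p I (fun x => a * u x) = a `^ p * pow p I u.
Proof.
move=> p2 a0 eI ug; have [mI _ _ _] := eI.
rewrite /pow -RintegralZl//; last exact: pow_integrable eI ug.
by apply: eq_Rintegral => x _; rewrite normrM ger0_norm// powRM.
Qed.

Lemma H1_affine I u g a b : a != 0 -> measurable I -> H1pair I u g ->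
  H1pair (affine a b @^-1` I) (u \o affine a b) (fun x => a * g (affine a b x)).
Proof.
move=> a0 mI [mg u2 g2 ug]; split.
- apply: measurable_funM; first exact: measurable_cst.
  exact: (measurable_fun_affine mI mg).
- exact: (@integrable_affine R a b I (fun x => u x ^+ 2)).
- have := @integrable_affine R a b I (fun x => a ^+ 2 * g x ^+ 2 + 0 * g x ^+ 2) a0 mI.
  move/(_ (integrable_lincomb _ _ mI g2 g2)).
  apply: eq_integrable; first exact: measurable_affine_preimage.
  by move=> x _ /=; rewrite mul0r addr0 exprMn.
- move=> x y /= Ix Iy xy.
  (* For [a < 0] the ends of the interval are exchanged; the sign [a / |a|] combines with the factor
     [1 / |a|] of the change of variables. *)
  suff [c [d [Ic Id cd [E1 E2]]]] : exists c d, [/\ I c, I d, c <= d &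
      affine a b @^-1` `[c, d] = `[x, y]%classic /\
      u (affine a b y) - u (affine a b x) = a / `|a| * (u d - u c)].
    have [gi ge] := ug c d Ic Id cd.
    have gi' := integrable_affine b a0 (measurable_itv _) gi.
    rewrite E1 in gi'.
    split.
      have := integrable_lincomb a 0 (measurable_itv _) gi' gi'.
      by apply: eq_integrable => // z _ /=; rewrite mul0r addr0.
    rewrite E2 ge RintegralZl// -E1 (Rintegral_affine b a0 (measurable_itv _) gi).
    by rewrite mulrA.
  have [ap|an] := ltP 0 a.
    exists (affine a b x), (affine a b y); split => //.
      by rewrite /affine lerD2r ler_pM2l.
    split; last by rewrite gtr0_norm// divff// mul1r.
    by apply/seteqP; split => z /=; rewrite !in_itv/= /affine !lerD2r !ler_pM2l.
  have {}an : a < 0 by rewrite lt_neqAle a0.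
  exists (affine a b y), (affine a b x); split => //.
    by rewrite /affine lerD2r ler_nM2l.
  split; last by rewrite ltr0_norm// invrN mulrN divff// mulN1r opprB.
  by apply/seteqP; split => z /=; rewrite !in_itv/= /affine !lerD2r !ler_nM2l// andbC.
Qed.

Lemma H1_subset I J u g : measurable I -> measurable J -> J `<=` I ->
  H1pair I u g -> H1pair J u g.
Proof.
move=> mI mJ JI [mg u2 g2 ug]; split.
- exact: measurable_funS mg.
- exact: integrableS u2.
- exact: integrableS g2.
- by move=> x y Jx Jy xy; apply: ug => //; exact: JI.
Qed.

Lemma H1_hglue T u1 g1 u2 g2 : 0 <= T -> H1pair `[0, T] u1 g1 ->
  H1pair (@halfline R) u2 g2 -> u1 T = u2 0 ->
  H1pair (@halfline R) (hglue T u1 u2) (hglue T g1 g2).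
Proof.
move=> T0 [mg1 s1 t1 ug1] [mg2 s2 t2 ug2] E; split.
- exact: measurable_hglue.
- have [h _] := integral_hglue T0 s1 s2.
  by apply: eq_integrable h => // x _ /=; rewrite /hglue; case: ifP.
- have [h _] := integral_hglue T0 t1 t2.
  by apply: eq_integrable h => // x _ /=; rewrite /hglue; case: ifP.
have cut1 x y : 0 <= x -> x <= y -> y <= T ->
    mu.-integrable `[x, y] (EFin \o hglue T g1 g2) /\
    hglue T u1 u2 y - hglue T u1 u2 x = Rintegral mu `[x, y] (hglue T g1 g2).
  move=> x0 xy yT.
  have [||//|gi ge] := ug1 x y; rewrite /= ?in_itv/=; [lra|lra|].
  have e : {in `[x, y]%classic, g1 =1 hglue T g1 g2}.
    by move=> z; rewrite inE/= in_itv/= /hglue => xzy; rewrite ifT//; lra.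
  rewrite -(eq_Rintegral mu e) {2 3}/hglue yT (le_trans xy yT).
  by split => //; apply: eq_integrable gi => // z zI /=; rewrite e.
have cut2 x y : T <= x -> x <= y ->
    mu.-integrable `[x, y] (EFin \o hglue T g1 g2) /\
    hglue T u1 u2 y - hglue T u1 u2 x = Rintegral mu `[x, y] (hglue T g1 g2).
  move=> Tx xy.
  have uE z : T <= z -> hglue T u1 u2 z = u2 (z - T).
    rewrite le_eqVlt => /predU1P[<-|Tz]; first by rewrite /hglue lexx subrr E.
    by rewrite /hglue leNgt Tz.
  have [||//|gi ge] := ug2 (x - T) (y - T); rewrite /halfline /= ?in_itv/= ?andbT; [lra|lra|lra|].
  have pre : affine 1 (- T) @^-1` `[x - T, y - T] = `[x, y]%classic.
    by apply/seteqP; split => z /=; rewrite !in_itv/= /affine; lra.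
  have gi' := integrable_affine (- T) (oner_neq0 R) (measurable_itv _) gi.
  have re := Rintegral_affine (- T) (oner_neq0 R) (measurable_itv _) gi.
  rewrite pre in gi' re.
  (* At the joint [T] the glued derivative takes its value from [g1], so it agrees with the shifted
     [g2] only on the half-open interval; the single point [x] is added back afterwards. *)
  have gio : mu.-integrable `]x, y] (EFin \o (g2 \o affine 1 (- T))).
    by apply: integrableS gi' => //; exact: subset_itv_oc_cc.
  have e : {in `]x, y]%classic, g2 \o affine 1 (- T) =1 hglue T g1 g2}.
    by move=> z; rewrite inE/= in_itv/= /hglue /affine => xzy; rewrite ifF ?mul1r//; lra.
  have gio2 : mu.-integrable `]x, y] (EFin \o hglue T g1 g2).
    by apply: eq_integrable gio => // z zI /=; rewrite -e.
  have gic : mu.-integrable `[x, y] (EFin \o hglue T g1 g2).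
    have -> : `[x, y]%classic = [set x] `|` `]x, y]%classic.
      apply/seteqP; split => z /=; rewrite !in_itv/=.
        by case/andP; rewrite le_eqVlt => /predU1P[->|-> ->]; [left|right].
      by case=> [->|/andP[/ltW -> ->]//]; rewrite lexx.
    apply: integrable_setU => //.
    - apply/integrableP; split; first exact: measurable_fun_set1.
      by rewrite integral_set1.
    - by apply/disj_setPS => z [/= -> ]; rewrite in_itv/= ltxx.
  split=> //; rewrite !uE ?(le_trans Tx)// ge.
  rewrite -[RHS]Rintegral_itv_obnd_cbnd// -[RHS](eq_Rintegral mu e) [RHS]Rintegral_itv_obnd_cbnd//.
  by rewrite re normr1 invr1 mul1r.
move=> x y; rewrite /halfline/= !in_itv/= !andbT => x0 y0 xy.
have [yT|Ty] := leP y T; first exact: cut1.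
have [Tx|xT] := leP T x; first exact: cut2.
have [i1 e1] := cut1 x T x0 (ltW xT) (lexx T).
have [i2 e2] := cut2 T y (lexx T) (ltW Ty).
have i2o : mu.-integrable `]T, y] (EFin \o hglue T g1 g2).
  by apply: integrableS i2 => //; exact: subset_itv_oc_cc.
have iU : mu.-integrable `[x, y] (EFin \o hglue T g1 g2).
  rewrite (@itv_bndbnd_setU _ _ _ (BRight T)) ?bnd_simp ?ltW//.
  apply: integrable_setU => //.
  by apply/disj_setPS => z [/=]; rewrite !in_itv/=; lra.
split => //.
rewrite (Rintegral_split (c := T) iU) ?bnd_simp ?ltW// -e1 -e2; ring.
Qed.

End H1.

(** * Cutting, reversing, reflecting and folding halfline functions *)

Section halfline_surgery.
Context {R : realType}.
Notation mu := (@lebesgue_measure R).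
Notation H := (@halfline R).
Implicit Types (f g u v F : R -> R) (a b c r s x y z p T l : R).

Definition hshift T f : R -> R := fun x => f (x + T).
Definition rev T f : R -> R := fun x => f (T - x).

Lemma hshiftE T f : hshift T f = f \o affine 1 T.
Proof. by apply/funext => x; rewrite /hshift /affine /= mul1r. Qed.

Lemma revE T f : rev T f = f \o affine (-1) T.
Proof. by apply/funext => x; rewrite /rev /affine /= mulN1r addrC. Qed.

Lemma shift_ray_preimage T : affine 1 T @^-1` `[T, +oo[%classic = H.
Proof. by apply/seteqP; split => x; rewrite /halfline/= !in_itv/= !andbT /affine; lra. Qed.

Lemma rev_itv_preimage T : affine (-1) T @^-1` `[0, T]%classic = `[0, T]%classic.
Proof. by apply/seteqP; split => x /=; rewrite !in_itv/= /affine; lra. Qed.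

Lemma ray_sub_halfline T : 0 <= T -> `[T, +oo[ `<=` H.
Proof. by move=> T0 x; rewrite /halfline/= !in_itv/= !andbT; lra. Qed.

Lemma itv_sub_halfline T : `[0, T] `<=` H.
Proof. by move=> x; rewrite /halfline/= !in_itv/= !andbT => /andP[]. Qed.

Lemma Rintegral_shift T F : 0 <= T -> mu.-integrable H (EFin \o F) ->
  mu.-integrable H (EFin \o hshift T F) /\
  Rintegral mu H F = Rintegral mu `[0, T] F + Rintegral mu H (hshift T F).
Proof.
move=> T0 Fi.
have FT : mu.-integrable `[T, +oo[ (EFin \o F).
  by apply: integrableS Fi => //; exact: ray_sub_halfline.
have h1 := integrable_affine T (oner_neq0 R) (measurable_itv _) FT.
have h2 := Rintegral_affine T (oner_neq0 R) (measurable_itv _) FT.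
rewrite shift_ray_preimage -hshiftE in h1 h2.
split=> //; rewrite h2 normr1 invr1 mul1r.
by rewrite /halfline in Fi *; rewrite (Rintegral_split (c := T) Fi).
Qed.

Lemma H1_shift T f g : 0 <= T -> H1pair H f g -> H1pair H (hshift T f) (hshift T g).
Proof.
move=> T0 fg.
have : H1pair `[T, +oo[ f g.
  by apply: H1_subset fg => //; exact: ray_sub_halfline.
move=> /(H1_affine T (oner_neq0 R) (measurable_itv _)).
rewrite shift_ray_preimage -hshiftE.
by congr (H1pair H _ _); apply/funext => x; rewrite /hshift /affine !mul1r.
Qed.

Lemma Rintegral_rev T F : mu.-integrable `[0, T] (EFin \o F) ->
  mu.-integrable `[0, T] (EFin \o rev T F) /\
  Rintegral mu `[0, T] (rev T F) = Rintegral mu `[0, T] F.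
Proof.
move=> Fi; have n1 : -1 != 0 :> R by rewrite oppr_eq0 oner_neq0.
have h1 := integrable_affine T n1 (measurable_itv _) Fi.
have h2 := Rintegral_affine T n1 (measurable_itv _) Fi.
rewrite rev_itv_preimage -revE in h1 h2.
by split=> //; rewrite h2 normrN normr1 invr1 mul1r.
Qed.

Lemma H1_rev T f g : H1pair `[0, T] f g -> H1pair `[0, T] (rev T f) (fun x => - rev T g x).
Proof.
move=> fg; have n1 : -1 != 0 :> R by rewrite oppr_eq0 oner_neq0.
have := H1_affine T n1 (measurable_itv _) fg.
rewrite rev_itv_preimage -revE.
by congr (H1pair _ _ _); apply/funext => x; rewrite /rev /affine !mulN1r addrC.
Qed.

Lemma Rintegral_hglue T (h : R -> R) u v : 0 <= T ->
  mu.-integrable `[0, T] (EFin \o (h \o u)) -> mu.-integrable H (EFin \o (h \o v)) ->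
  Rintegral mu H (h \o hglue T u v) =
  Rintegral mu `[0, T] (h \o u) + Rintegral mu H (h \o v).
Proof.
by move=> T0 hu hv; have [_ <-] := integral_hglue T0 hu hv; rewrite hglue_comp.
Qed.

(** The value [c] lies strictly below the total, so by monotone convergence some bounded interval
    already exceeds it; the intermediate value theorem does the rest. *)
Lemma exists_integral_eq F c : mu.-integrable H (EFin \o F) ->
  (forall x, H x -> 0 <= F x) -> 0 <= c -> c < Rintegral mu H F ->
  exists T, 0 <= T /\ Rintegral mu `[0, T] F = c.
Proof.
move=> Fi F0 c0 cF.
have Fin T : mu.-integrable `[0, T] (EFin \o F).
  by apply: integrableS Fi => //; exact: itv_sub_halfline.
have [n cn] : exists n : nat, c < Rintegral mu `[0, n%:R] F.
  apply/not_existsP => nc; move: cF; rewrite ltNge => /negP; apply.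
  have bH : \bigcup_i `[0%R, i%:R]%classic = H.
    apply/seteqP; split=> x; rewrite /halfline/= ?in_itv/= ?andbT.
      by case=> n _ /=; rewrite in_itv/= => /andP[].
    move=> x0; exists (Num.truncn x).+1 => //=.
    by rewrite in_itv/= x0/= ltW// truncnS_gt.
  have cv : (\int[mu]_(x in `[0%R, i%:R]) (F x)%:E)%E @[i --> \oo] --> (\int[mu]_(x in H) (F x)%:E)%E.
    rewrite -bH; apply: ge0_nondecreasing_set_cvg_integral => //.
    - move=> i j ij; apply/subsetPset => x /=; rewrite !in_itv/= => /andP[-> /=].
      by move/le_trans; apply; rewrite ler_nat.
    - by move=> i; exact: measurable_int (Fin _).
    - move=> i x /=; rewrite in_itv/= => /andP[x0 _]; rewrite lee_fin F0//.
      by rewrite /halfline/= in_itv/= x0.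
  rewrite /Rintegral -lee_fin fineK; last exact: integrable_fin_num Fi.
  rewrite -(cvg_lim _ cv)//; apply: lime_le; first exact: cvgP cv.
  apply: nearW => i; have /negP := nc i; rewrite -leNgt -lee_fin /Rintegral fineK//.
  exact: integrable_fin_num (Fin _).
have := @IVT R (fun T => Rintegral mu `[0, T] F) 0 n%:R c (ler0n _ _)
  (parameterized_integral_continuous (ler0n _ _) (Fin _)).
rewrite set_itv1 Rintegral_set1.
case.
  apply/andP; split; first by rewrite ge_min c0.
  by rewrite le_max (ltW cn) orbT.
by move=> T; rewrite in_itv/= => /andP[T0 _] <-; exists T.
Qed.

Lemma Rintegral_zero (D : set R) : Rintegral mu D (fun=> 0) = 0.
Proof. by rewrite /Rintegral integral0. Qed.

(** Stated for two halfline functions that meet at 0, so that it serves both the line cut at 0 and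
    the two halflines of the graph. The two sides of the median have equal mass and their energies
    add up to the total, so one of them has at most half of it. *)
Lemma median_reflection p f1 g1 f2 g2 : 2 < p -> H1pair H f1 g1 -> H1pair H f2 g2 ->
  f1 0 = f2 0 -> 0 < mass H f1 + mass H f2 ->
  exists f g, [/\ H1pair H f g, mass H f = (mass H f1 + mass H f2) / 2 &
    2 * energy p H f g <= energy p H f1 g1 + energy p H f2 g2].
Proof.
move=> p2; wlog : f1 g1 f2 g2 / mass H f2 <= mass H f1.
  move=> hw h1 h2 e12 m0; have [le|/ltW le] := leP (mass H f2) (mass H f1).
    exact: hw.
  have m0' : 0 < mass H f2 + mass H f1 by rewrite addrC.
  have [f [g [fg fm fe]]] := hw _ _ _ _ le h2 h1 (esym e12) m0'.
  exists f, g; split; [exact: fg|by rewrite fm addrC|].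
  by rewrite [leRHS]addrC; exact: fe.
move=> m21 h1 h2 e12 m0.
have aux (A B C : R) : A = (A - B) / 2 + C -> C = (A + B) / 2 by lra.
have eH := @halfline_edge R 1 ltr01.
have [_ u1 d1 _] := h1; have [_ u2 d2 _] := h2.
have w1 := pow_integrable p2 eH h1; have w2 := pow_integrable p2 eH h2.
have M2 : 0 <= mass H f2 by exact: Rintegral_sqr_ge0.
(* The median lies on the heavier side, at distance [T] from 0: beyond it [f1] keeps
   [(mass H f1 + mass H f2) / 2]. *)
have [T [T0 TE]] : exists T, 0 <= T /\
    Rintegral mu `[0, T] (fun x => f1 x ^+ 2) = (mass H f1 - mass H f2) / 2.
  apply: exists_integral_eq => //.
  - by move=> x _; exact: sqr_ge0.
  - by move: (mass H f1) (mass H f2) m21 m0 M2 => *; lra.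
  - rewrite -/(mass H f1).
    by move: (mass H f1) (mass H f2) m21 m0 M2 => *; lra.
have sub F : mu.-integrable H (EFin \o F) -> mu.-integrable `[0, T] (EFin \o F).
  by move=> Fi; apply: integrableS Fi => //; exact: itv_sub_halfline.
have r1 : H1pair `[0, T] f1 g1.
  by apply: H1_subset h1 => //; exact: itv_sub_halfline.
have [_ sm] := Rintegral_shift T0 u1.
have [_ sg] := Rintegral_shift T0 d1.
have [_ sp] := Rintegral_shift T0 w1.
have [im rm] := Rintegral_rev (sub _ u1).
have [ig rg] := Rintegral_rev (sub _ d1).
have [ip rp] := Rintegral_rev (sub _ w1).
have hA := H1_shift T0 h1.
(* The other side of the median, read outward from it: back along [f1] to 0, then out along [f2]. *)
have hB : H1pair H (hglue T (rev T f1) f2) (hglue T (fun x => - rev T g1 x) g2).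
  apply: H1_hglue; [exact: T0|exact: H1_rev r1|exact: h2|].
  by rewrite /rev subrr; exact: e12.
have gm : mass H (hglue T (rev T f1) f2) = (mass H f1 - mass H f2) / 2 + mass H f2.
  by rewrite -TE -rm /mass -(@Rintegral_hglue T (fun x => x ^+ 2)).
have ig' : mu.-integrable `[0, T] (EFin \o ((fun x => x ^+ 2) \o (fun x => - rev T g1 x))).
  by apply: eq_integrable ig => // x _ /=; rewrite sqrrN.
have gg : grad H (hglue T (fun x => - rev T g1 x) g2) =
    Rintegral mu `[0, T] (fun x => g1 x ^+ 2) + grad H g2.
  rewrite -rg /grad [LHS](@Rintegral_hglue T (fun x => x ^+ 2))//.
  by congr (_ + _); apply: eq_Rintegral => x _ /=; rewrite sqrrN.
have gp : pow p H (hglue T (rev T f1) f2) =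
    Rintegral mu `[0, T] (fun x => `|f1 x| `^ p) + pow p H f2.
  by rewrite -rp /pow [LHS](@Rintegral_hglue T (fun x => `|x| `^ p)).
have mA : mass H (hshift T f1) = (mass H f1 + mass H f2) / 2.
  move: sm; rewrite TE -/(mass H f1).
  rewrite -[Rintegral mu H (hshift T _)]/(mass H (hshift T f1)).
  exact: aux.
have EE : energy p H (hshift T f1) (hshift T g1) +
    energy p H (hglue T (rev T f1) f2) (hglue T (fun x => - rev T g1 x) g2) =
    energy p H f1 g1 + energy p H f2 g2.
  rewrite !energyE gg gp.
  have -> : grad H g1 = Rintegral mu `[0, T] (fun x => g1 x ^+ 2) + grad H (hshift T g1) by [].
  have -> : pow p H f1 = Rintegral mu `[0, T] (fun x => `|f1 x| `^ p) + pow p H (hshift T f1) by [].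
  set a1 := Rintegral _ _ _; set a2 := grad _ _; set a3 := Rintegral _ _ _.
  set a4 := pow _ _ _; set a5 := grad _ _; set a6 := pow _ _ _.
  by clearbody a1 a2 a3 a4 a5 a6; clear; ring.
have [le|/ltW le] := leP (energy p H (hshift T f1) (hshift T g1))
  (energy p H (hglue T (rev T f1) f2) (hglue T (fun x => - rev T g1 x) g2)).
  exists (hshift T f1), (hshift T g1); split; [exact: hA|exact: mA|].
  by rewrite -EE mulr_natl mulr2n lerD2l.
exists (hglue T (rev T f1) f2), (hglue T (fun x => - rev T g1 x) g2); split; [exact: hB| |].
  by rewrite gm; clear; field.
by rewrite -EE mulr_natl mulr2n lerD2r.
Qed.

Lemma H1_line a b T : 0 <= T -> H1pair `[0, T] (fun x => a * x + b) (fun=> a).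
Proof.
move=> T0; split.
- exact: measurable_cst.
- apply: measurable_bounded_integrable => //.
  + by rewrite /= lebesgue_measure_itv/=; case: ifP => _; rewrite ?ltry.
  + apply: measurable_funX; exact: (measurable_affine a b).
  + exists ((`|a| * T + `|b|) ^+ 2); split; first exact: num_real.
    move=> M hM x /=; rewrite in_itv/= => /andP[x0 xT].
    apply/ltW/(le_lt_trans _ hM); rewrite normrX lerXn2r ?nnegrE//.
      by rewrite addr_ge0// mulr_ge0.
    apply: (le_trans (ler_normD _ _)); rewrite lerD2r normrM (ger0_norm x0).
    by rewrite ler_wpM2l.
- exact: (integrable_cst_itv 0 T (a ^+ 2)).
- move=> x y; rewrite /= !in_itv/= => _ _ xy; split; first exact: integrable_cst_itv.
  by rewrite Rintegral_cst_itv//; ring.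
Qed.

Lemma H1_zero : H1pair H (fun=> 0) (fun=> 0).
Proof.
have i0 (D : set R) : mu.-integrable D (EFin \o (fun=> 0 : R)) by exact: integrable0.
have i2 (D : set R) : L2 D (fun=> 0 : R).
  rewrite /L2 (_ : (fun=> _) = EFin \o (fun=> 0 : R))//.
  by apply/funext => x /=; rewrite expr0n.
split => //.
move=> x y _ _ xy; split; first exact: i0.
by rewrite Rintegral_cst_itv// mul0r subrr.
Qed.

(** The cut-off used throughout: it brings a boundary value [a] down to 0 over length [T], with mass
    at most [a ^+ 2 * T] and squared derivative integrating to [a ^+ 2 / T]. *)
Definition ramp a T := hglue T (fun x => (- (a / T)) * x + a) (fun=> 0).
Definition dramp a T := hglue T (fun=> - (a / T)) (fun=> 0).

Lemma ramp0 a T : 0 < T -> ramp a T 0 = a.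
Proof. by move=> T0; rewrite /ramp /hglue (ltW T0) mulr0 add0r. Qed.

Lemma ramp_norm_le a T x : 0 < T -> H x -> `|ramp a T x| <= `|a|.
Proof.
move=> T0; rewrite /halfline/= in_itv/= andbT => x0.
rewrite /ramp /hglue; case: ifP => xT; last by rewrite normr0.
have -> : - (a / T) * x + a = a * (1 - x / T) by field; lra.
rewrite normrM ler_piMr// ger0_norm.
  by rewrite gerBl divr_ge0// ltW.
by rewrite subr_ge0 ler_pdivrMr// mul1r.
Qed.

Lemma H1_ramp a T : 0 < T -> H1pair H (ramp a T) (dramp a T).
Proof.
move=> T0; apply: H1_hglue; [exact: ltW|exact/H1_line/ltW|exact: H1_zero|].
by field; lra.
Qed.

Lemma mass_ramp a T : 0 < T -> mass H (ramp a T) <= a ^+ 2 * T.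
Proof.
move=> T0; have [_ h _ _] := @H1_line (- (a / T)) a T (ltW T0).
have [_ z _ _] := H1_zero.
rewrite /mass [leLHS](@Rintegral_hglue T (fun x => x ^+ 2) _ _ (ltW T0) h z).
rewrite (_ : (fun x => x ^+ 2) \o (fun=> 0) = (fun=> 0 : R)); last first.
  by apply/funext => x /=; rewrite expr0n.
rewrite Rintegral_zero addr0.
have -> : a ^+ 2 * T = Rintegral mu `[0, T] (fun=> a ^+ 2).
  by rewrite Rintegral_cst_itv ?subr0// ltW.
apply: le_Rintegral => //; first exact: integrable_cst_itv.
move=> x /=; rewrite in_itv/= => /andP[x0 xT].
have Hx : H x by rewrite /halfline/= in_itv/= x0.
have := ramp_norm_le a T0 Hx; rewrite /ramp /hglue xT => h1.
by rewrite -[leLHS]real_normK ?num_real// -[leRHS]real_normK ?num_real// lerXn2r ?nnegrE.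
Qed.

Lemma grad_ramp a T : 0 < T -> grad H (dramp a T) = a ^+ 2 / T.
Proof.
move=> T0; have [_ z _ _] := H1_zero.
rewrite /grad [LHS](@Rintegral_hglue T (fun x => x ^+ 2) _ _ (ltW T0) _ z); last first.
  exact: (integrable_cst_itv 0 T ((- (a / T)) ^+ 2)).
rewrite (_ : (fun x => x ^+ 2) \o (fun=> 0) = (fun=> 0 : R)); last first.
  by apply/funext => x /=; rewrite expr0n.
rewrite Rintegral_zero addr0.
rewrite (@Rintegral_cst_itv _ 0 T ((- (a / T)) ^+ 2) (ltW T0)).
by field; lra.
Qed.

(** On the first half of its descent the ramp stays above [a / 2]. *)
Lemma pow_ramp p a T : 2 < p -> 0 <= a -> 0 < T ->
  (a / 2) `^ p * (T / 2) <= pow p H (ramp a T).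
Proof.
move=> p2 a0 T0; have eH := @halfline_edge R 1 ltr01.
have hi := pow_integrable p2 eH (H1_ramp a T0).
have T2 : 0 <= T / 2 by lra.
apply: (@le_trans _ _ (Rintegral mu `[0, T / 2] (fun x => `|ramp a T x| `^ p))); last first.
  apply: ge0_Rintegral_subset => //; exact: itv_sub_halfline.
have -> : (a / 2) `^ p * (T / 2) = Rintegral mu `[0, T / 2] (fun=> (a / 2) `^ p).
  by rewrite Rintegral_cst_itv ?subr0.
apply: le_Rintegral => //; first exact: integrable_cst_itv.
  by apply: integrableS hi => //; exact: itv_sub_halfline.
move=> x /=; rewrite in_itv/= => /andP[x0 xT].
rewrite /ramp /hglue ifT; last by lra.
have -> : - (a / T) * x + a = a * (1 - x / T) by field; lra.
have h : 2^-1 <= 1 - x / T.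
  have : x / T <= 2^-1 by rewrite ler_pdivrMr//; lra.
  lra.
rewrite ger0_norm; last by rewrite mulr_ge0//; lra.
apply: ge0_ler_powR; rewrite ?nnegrE; [lra|lra|by rewrite mulr_ge0//; lra|].
by rewrite ler_wpM2l.
Qed.

(** The stretch by 2 makes [[0, l / 2]] count twice, so the pendant carries the integral of the even
    extension over [[-l/2, l/2]]. *)
Lemma Rintegral_fold l F : 0 < l -> mu.-integrable `[0, l / 2] (EFin \o F) ->
  Rintegral mu (pendant l) (F \o affine (- 2^-1) (l / 2)) = 2 * Rintegral mu `[0, l / 2] F.
Proof.
move=> l0 Fi; have n0 : - 2^-1 != 0 :> R by lra.
have := Rintegral_affine (l / 2) n0 (measurable_itv _) Fi.
rewrite (_ : affine _ _ @^-1` _ = pendant l); last first.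
  by apply/seteqP; split => x; rewrite /pendant/= !in_itv/= /affine; lra.
by move=> ->; rewrite normrN ger0_norm ?invrK.
Qed.

Lemma H1_fold l f g : 0 < l -> H1pair `[0, l / 2] f g ->
  H1pair (pendant l) (f \o affine (- 2^-1) (l / 2))
    (fun x => - 2^-1 * g (affine (- 2^-1) (l / 2) x)).
Proof.
move=> l0 fg; have n0 : - 2^-1 != 0 :> R by lra.
have := H1_affine (l / 2) n0 (measurable_itv _) fg.
rewrite (_ : affine _ _ @^-1` _ = pendant l)//.
by apply/seteqP; split => x; rewrite /pendant/= !in_itv/= /affine; lra.
Qed.

End halfline_surgery.

(** * Functions on the graph, coercivity and negative energies *)

Section star.
Context {R : realType}.
Notation mu := (@lebesgue_measure R).
Notation H := (@halfline R).
Implicit Types (u g v h : 'I_3 -> R -> R) (f : R -> R) (a b c r s x y p l t : R).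

(** Indexing the edges by ['I_3] turns estimates on the graph into sums of estimates on one edge;
    index 2 is the pendant. *)
Definition edge l (i : 'I_3) : set R := if (i < 2)%N then H else pendant l.

Definition tri {A : Type} (a b c : A) (i : 'I_3) : A :=
  if i == 0 :> nat then a else if i == 1%N :> nat then b else c.

Definition star l u g :=
  (forall i, H1pair (edge l i) (u i) (g i)) /\ (forall i, u i 0 = u ord0 0).

Definition smass l u := \sum_(i < 3) mass (edge l i) (u i).
Definition sgrad l g := \sum_(i < 3) grad (edge l i) (g i).
Definition spow p l u := \sum_(i < 3) pow p (edge l i) (u i).
Definition senergy p l u g := 2^-1 * sgrad l g - p^-1 * spow p l u.

Lemma sum3 (F : 'I_3 -> R) :
  \sum_(i < 3) F i = F ord0 + F (lift ord0 ord0) + F ord_max.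
Proof.
rewrite !big_ord_recr big_ord0 /= add0r; congr (F _ + F _ + F _);
  exact: val_inj.
Qed.

Lemma ord3P (P : 'I_3 -> Prop) : P ord0 -> P (lift ord0 ord0) -> P ord_max ->
  forall i, P i.
Proof.
move=> P0 P1 P2 [[|[|[|//]]] i3].
- by rewrite (_ : Ordinal i3 = ord0)//; exact: val_inj.
- by rewrite (_ : Ordinal i3 = lift ord0 ord0)//; exact: val_inj.
- by rewrite (_ : Ordinal i3 = ord_max)//; exact: val_inj.
Qed.

Lemma edge_is_edge r l i : 0 < r -> r <= l / 2 -> is_edge r (edge l i).
Proof.
move=> r0 rl; rewrite /edge; case: ifP => _; first exact: halfline_edge.
exact: pendant_edge.
Qed.

Lemma edge_half l i : 0 < l -> is_edge (l / 2) (edge l i).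
Proof. by move=> l0; apply: edge_is_edge => //; lra. Qed.

Lemma measurable_edge l i : 0 < l -> measurable (edge l i).
Proof. by move=> /(@edge_half l i)[]. Qed.

Lemma star_triP l (u1 g1 u2 g2 u3 g3 : R -> R) : H1pair H u1 g1 -> H1pair H u2 g2 ->
  H1pair (pendant l) u3 g3 -> u1 0 = u3 0 -> u2 0 = u3 0 ->
  star l (tri u1 u2 u3) (tri g1 g2 g3).
Proof.
move=> h1 h2 h3 e1 e2; split; first exact: ord3P.
by apply: ord3P => //=; rewrite /tri/= ?e1 ?e2.
Qed.

Lemma smass_tri l (u1 u2 u3 : R -> R) :
  smass l (tri u1 u2 u3) = mass H u1 + mass H u2 + mass (pendant l) u3.
Proof. by rewrite /smass sum3. Qed.

Lemma sgrad_tri l (u1 u2 u3 : R -> R) :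
  sgrad l (tri u1 u2 u3) = grad H u1 + grad H u2 + grad (pendant l) u3.
Proof. by rewrite /sgrad sum3. Qed.

Lemma spow_tri p l (u1 u2 u3 : R -> R) :
  spow p l (tri u1 u2 u3) = pow p H u1 + pow p H u2 + pow p (pendant l) u3.
Proof. by rewrite /spow sum3. Qed.

Lemma H1mu_pendant_star l m (u1 g1 u2 g2 u3 g3 : R -> R) : H1mu_pendant l m u1 g1 u2 g2 u3 g3 ->
  star l (tri u1 u2 u3) (tri g1 g2 g3) /\ smass l (tri u1 u2 u3) = m.
Proof.
by case=> h1 h2 h3 [e1 e2] <-; split; [exact: star_triP|exact: smass_tri].
Qed.

Lemma energy_pendant_star p l (u1 g1 u2 g2 u3 g3 : R -> R) :
  energy_pendant p l u1 g1 u2 g2 u3 g3 = senergy p l (tri u1 u2 u3) (tri g1 g2 g3).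
Proof.
rewrite /energy_pendant /senergy !energyE sgrad_tri spow_tri.
move: (grad H g1) (grad H g2) (grad (pendant l) g3) => a b c.
move: (pow p H u1) (pow p H u2) (pow p (pendant l) u3) => a' b' c'; ring.
Qed.

Lemma triE (A : Type) (w : 'I_3 -> A) :
  tri (w ord0) (w (lift ord0 ord0)) (w ord_max) = w.
Proof. by apply/funext; exact: ord3P. Qed.

Lemma star_H1mu_pendant l u g : star l u g ->
  H1mu_pendant l (smass l u) (u ord0) (g ord0) (u (lift ord0 ord0))
    (g (lift ord0 ord0)) (u ord_max) (g ord_max).
Proof.
move=> [ug u0]; split.
- exact: (ug ord0).
- exact: (ug (lift ord0 ord0)).
- exact: (ug ord_max).
- by rewrite !u0.
- by rewrite -smass_tri triE.
Qed.

Lemma star_lincomb l a b u g v h : 0 < l -> star l u g -> star l v h ->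
  star l (fun i x => a * u i x + b * v i x) (fun i x => a * g i x + b * h i x).
Proof.
move=> l0 [ug u0] [vh v0]; split=> i; last by rewrite u0 v0.
exact: H1_lincomb (edge_half i l0) (ug i) (vh i).
Qed.

Lemma star_scale l a u g : 0 < l -> star l u g ->
  star l (fun i x => a * u i x) (fun i x => a * g i x).
Proof.
move=> l0 [ug u0]; split=> i; last by rewrite u0.
exact: H1_scale (edge_half i l0) (ug i).
Qed.

Lemma smass_scale l a u g : 0 < l -> star l u g ->
  smass l (fun i x => a * u i x) = a ^+ 2 * smass l u.
Proof.
move=> l0 [ug _]; rewrite /smass mulr_sumr; apply: eq_bigr => i _.
have [_ u2 _ _] := ug i.
exact: (mass_scale a (measurable_edge i l0) u2).
Qed.

Lemma sgrad_scale l a u g : 0 < l -> star l u g ->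
  sgrad l (fun i x => a * g i x) = a ^+ 2 * sgrad l g.
Proof.
move=> l0 [ug _]; rewrite /sgrad mulr_sumr; apply: eq_bigr => i _.
have [_ _ g2 _] := ug i.
exact: (grad_scale a (measurable_edge i l0) g2).
Qed.

Lemma spow_scale p l a u g : 2 < p -> 0 <= a -> 0 < l -> star l u g ->
  spow p l (fun i x => a * u i x) = a `^ p * spow p l u.
Proof.
move=> p2 a0 l0 [ug _]; rewrite /spow mulr_sumr; apply: eq_bigr => i _.
exact: pow_scale p2 a0 (edge_half i l0) (ug i).
Qed.

Lemma mass_ge0 (I : set R) f : 0 <= mass I f.
Proof. exact: Rintegral_sqr_ge0. Qed.

Lemma grad_ge0 (I : set R) f : 0 <= grad I f.
Proof. exact: Rintegral_sqr_ge0. Qed.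

Lemma smass_ge0 l u : 0 <= smass l u.
Proof. by apply: sumr_ge0 => i _; exact: mass_ge0. Qed.

Lemma sgrad_ge0 l g : 0 <= sgrad l g.
Proof. by apply: sumr_ge0 => i _; exact: grad_ge0. Qed.

Lemma spow_ge0 p l u : 0 <= spow p l u.
Proof. by apply: sumr_ge0 => i _; exact: pow_ge0. Qed.

Lemma mass_le_smass l u i : mass (edge l i) (u i) <= smass l u.
Proof. by rewrite /smass (bigD1 i)//= lerDl sumr_ge0// => j _; exact: mass_ge0. Qed.

Lemma grad_le_sgrad l g i : grad (edge l i) (g i) <= sgrad l g.
Proof. by rewrite /sgrad (bigD1 i)//= lerDl sumr_ge0// => j _; exact: grad_ge0. Qed.

Lemma star_sup l s u g i x : 0 < l -> star l u g -> 0 < s -> s <= l / 2 ->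
  edge l i x -> u i x ^+ 2 <= 2 / s * smass l u + 2 * s * sgrad l g.
Proof.
move=> l0 [ug _] s0 sl ix.
apply: (le_trans (H1_sup (edge_half i l0) (ug i) ix s0 sl)).
apply: lerD; apply: ler_wpM2l.
- by rewrite divr_ge0// ltW.
- exact: mass_le_smass.
- by rewrite mulr_ge0// ltW.
- exact: grad_le_sgrad.
Qed.

Lemma spow_le_smass p l u g S : 2 < p -> 0 < l -> star l u g ->
  (forall i x, edge l i x -> u i x ^+ 2 <= S) ->
  spow p l u <= S `^ (p / 2 - 1) * smass l u.
Proof.
move=> p2 l0 [ug _] uS; rewrite /spow /smass mulr_sumr; apply: ler_sum => i _.
exact: pow_le_mass p2 (edge_half i l0) (ug i) (uS i).
Qed.

(* With [s = K^(-1/2)] in the sup bound, [int |u|^p] is controlled by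
   [K^((p-2)/4)], a power of [K = int |u'|^2] smaller than 1 since [p < 6]. *)
Lemma sgrad_coercive p l m : 2 < p -> p < 6 -> 0 < l -> 0 < m ->
  exists B, 0 <= B /\ forall u g, star l u g -> smass l u = m ->
    senergy p l u g <= 0 -> sgrad l g <= B.
Proof.
move=> p2 p6 l0 m0; pose q := p / 2 - 1.
pose C := 2 * (m / p) * (2 * m + 2) `^ q.
have C0 : 0 <= C by rewrite !mulr_ge0 ?powR_ge0 ?invr_ge0//; lra.
pose d := 1 - q / 2.
have d0 : 0 < d by rewrite /d /q; lra.
(* The first summand covers small [K]. Above [4 / l ^+ 2] the length [K^(-1/2)] is at most [l / 2],
   hence admissible in the sup bound, and one gets [K^d <= C]. *)
exists (4 / l ^+ 2 + C `^ d^-1); split.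
  by rewrite addr_ge0 ?powR_ge0// divr_ge0// sqr_ge0.
move=> u g ug um E0; set K := sgrad l g.
have K0 : 0 <= K by exact: sgrad_ge0.
have [Kl|lK] := leP K (4 / l ^+ 2).
  by rewrite (le_trans Kl)// lerDl powR_ge0.
have l4 : 0 < 4 / l ^+ 2 by rewrite divr_gt0// exprn_gt0.
have Kp : 0 < K by exact: lt_trans lK.
pose k := Num.sqrt K.
have kp : 0 < k by rewrite sqrtr_gt0.
have kK : k ^+ 2 = K by rewrite sqr_sqrtr.
have kl : k^-1 <= l / 2.
  rewrite invf_ple ?posrE//; last by lra.
  rewrite invf_div -(@ler_pXn2r _ 2)//; last by rewrite nnegrE ltW.
    rewrite kK expr_div_n (_ : 2 ^+ 2 = 4); first exact: ltW.
    by clear; ring.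
  by rewrite nnegrE divr_ge0// ltW.
have ki : 0 < k^-1 by rewrite invr_gt0.
have S i x : edge l i x -> u i x ^+ 2 <= (2 * m + 2) * k.
  move=> ix; apply: (le_trans (star_sup l0 ug ki kl ix)); rewrite um -/K -kK.
  rewrite le_eqVlt; apply/orP; left; apply/eqP.
  by clear -kp; field; lra.
have := spow_le_smass p2 l0 ug S; rewrite um -/q => h.
move: E0; rewrite /senergy -/K; set P := spow _ _ _ in h *.
move=> E0; have KP : K <= 2 * (P / p) by clear -E0; lra.
have {}KP : K <= C * K `^ (q / 2).
  apply: (le_trans KP).
  have -> : K `^ (q / 2) = k `^ q.
    rewrite -kK -[k ^+ 2]powR_mulrn ?ltW// -powRrM; congr (_ `^ _).
    by rewrite /q; clear; field.
  have -> : C * k `^ q = 2 * (((2 * m + 2) * k) `^ q * m / p).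
    rewrite powRM ?ltW//; last by lra.
    by rewrite /C; ring.
  by rewrite ler_pM2l// ler_pM2r ?invr_gt0//; lra.
have Kd : K `^ d <= C.
  rewrite -(@ler_pM2r _ (K `^ (q / 2))) ?powR_gt0//.
  rewrite -powRD; last by rewrite (gt_eqF Kp) implybT.
  by rewrite /d subrK powRr1.
apply: (@le_trans _ _ (C `^ d^-1)); last by rewrite lerDr ltW.
have -> : K = (K `^ d) `^ d^-1 by rewrite -powRrM mulfV ?gt_eqF// powRr1.
by apply: ge0_ler_powR; rewrite ?nnegrE ?powR_ge0// invr_ge0 ltW.
Qed.

Lemma star_unit_ramp l T : 0 < l -> 0 < T ->
  star l (tri (ramp 1 T) (ramp 1 T) (fun x => 0 * x + 1))
    (tri (dramp 1 T) (dramp 1 T) (fun=> 0)).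
Proof.
move=> l0 T0; apply: star_triP; try exact: H1_ramp.
- exact/H1_line/ltW.
- by rewrite ramp0// mul0r add0r.
- by rewrite ramp0// mul0r add0r.
Qed.

Lemma mass_cst l a : 0 <= l -> mass (pendant l) (fun x => 0 * x + a) = a ^+ 2 * l.
Proof.
move=> l0; rewrite /mass /pendant.
rewrite (_ : (fun x => (0 * x + a) ^+ 2) = fun=> a ^+ 2); last first.
  by apply/funext => x; rewrite mul0r add0r.
by rewrite Rintegral_cst_itv// subr0.
Qed.

Lemma grad_cst0 (I : set R) : grad I (fun=> 0) = 0.
Proof.
rewrite /grad (_ : (fun _ : R => 0 ^+ 2) = fun=> 0 : R) ?Rintegral_zero//.
by apply/funext => x; rewrite expr0n.
Qed.

(** The test function is 1 on the pendant, with ramps of length [T] on the halflines, rescaled to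
    mass [m]. Up to a common factor its kinetic part is of order [1 / T] and its potential part at
    least of order [T^(1-q)]; as [q < 2], which is [p < 6], the latter wins for large [T]. *)
Lemma exists_negative_energy p l m : 2 < p -> p < 6 -> 0 < l -> 0 < m ->
  exists u g, [/\ star l u g, smass l u = m & senergy p l u g < 0].
Proof.
move=> p2 p6 l0 m0; pose q := p / 2 - 1.
have q0 : 0 < q by rewrite /q; lra.
have q2 : 0 < 2 - q by rewrite /q; lra.
pose C := p * 2 `^ p * (3 / m) `^ q.
have C0 : 0 <= C by rewrite !mulr_ge0 ?powR_ge0//; lra.
(* The summand [l] makes the mass before rescaling at most [3 * T]; the other one makes [T^(2-q)]
   exceed [C]. *)
pose T := l + (C + 1) `^ (2 - q)^-1.
have C1 : 0 < (C + 1) `^ (2 - q)^-1 by rewrite powR_gt0//; lra.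
have lT : l < T by rewrite /T; lra.
have T0 : 0 < T by lra.
have TC : C < T `^ (2 - q).
  have : C + 1 = ((C + 1) `^ (2 - q)^-1) `^ (2 - q).
    by rewrite -powRrM mulVf ?gt_eqF// powRr1//; lra.
  have : ((C + 1) `^ (2 - q)^-1) `^ (2 - q) <= T `^ (2 - q).
    by apply: ge0_ler_powR; rewrite ?nnegrE ?powR_ge0// ?ltW// /T; lra.
  by clear; lra.
have w := star_unit_ramp l0 T0.
set u := tri _ _ _ in w; set g := tri _ _ _ in w.
have mu_le : smass l u <= 3 * T.
  rewrite smass_tri (mass_cst _ (ltW l0)) expr1n mul1r.
  have := mass_ramp 1 T0; rewrite expr1n mul1r => h; clear -h lT; lra.
have mu_ge : l <= smass l u.
  rewrite smass_tri (mass_cst _ (ltW l0)) expr1n mul1r.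
  have := mass_ge0 H (ramp 1 T); clear; lra.
have K : sgrad l g = 2 / T.
  rewrite sgrad_tri grad_cst0 grad_ramp// expr1n; clear -T0; field; lra.
have P : (2 `^ p)^-1 * T <= spow p l u.
  have := pow_ramp p2 ler01 T0.
  have : 0 <= pow p (pendant l) (fun x => 0 * x + 1) by exact: pow_ge0.
  rewrite spow_tri mul1r -powRN.
  rewrite (_ : 2^-1 `^ p = 2 `^ (- p)); last first.
    by rewrite -[2^-1]powR_inv1// -powRrM mulN1r.
  by clear; lra.
pose M := smass l u; have M0 : 0 < M by rewrite /M; clear -mu_ge l0; lra.
pose t := Num.sqrt (m / M).
have t0 : 0 < t by rewrite sqrtr_gt0 divr_gt0.
have t2 : t ^+ 2 = m / M by rewrite sqr_sqrtr// divr_ge0// ltW.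
exists (fun i x => t * u i x), (fun i x => t * g i x); split.
- exact: star_scale.
- by rewrite (smass_scale t l0 w) t2 -/M mulfVK// gt_eqF.
rewrite /senergy (sgrad_scale t l0 w) (spow_scale p2 (ltW t0) l0 w) K.
have tp : t `^ p = t ^+ 2 * (m / M) `^ q.
  have -> : t `^ p = (t ^+ 2) `^ (p / 2).
    rewrite -[t ^+ 2]powR_mulrn ?ltW// -powRrM; congr (_ `^ _).
    by clear; field.
  rewrite -t2 -mulr_powRB1 ?sqr_ge0//; clear -p2; lra.
rewrite tp.
have -> : 2^-1 * (t ^+ 2 * (2 / T)) - p^-1 * (t ^+ 2 * (m / M) `^ q * spow p l u) =
  t ^+ 2 * (T^-1 - (m / M) `^ q * spow p l u / p) by clear -T0 p2; field; lra.
rewrite pmulr_rlt0 ?exprn_gt0// subr_lt0 ltr_pdivlMr; last by clear -p2; lra.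
have m3 : 0 < m / (3 * T) by rewrite divr_gt0//; clear -T0; lra.
apply: (@lt_le_trans _ _ ((m / (3 * T)) `^ q * ((2 `^ p)^-1 * T))); last first.
  apply: ler_pM; rewrite ?powR_ge0//.
    by rewrite mulr_ge0 ?invr_ge0 ?powR_ge0// ltW.
  apply: ge0_ler_powR; rewrite ?nnegrE ?(ltW q0) ?(ltW m3)//.
    by rewrite divr_ge0// ltW.
  by rewrite ler_pM2l// lef_pV2// posrE; clear -T0; lra.
have -> : (m / (3 * T)) `^ q = ((3 / m) `^ q * T `^ q)^-1.
  have z0 : 0 <= 3 / m by rewrite divr_ge0// ltW.
  rewrite -(powRM _ z0 (ltW T0)) -powRN -mulN1r powRrM.
  rewrite powR_inv1; last by rewrite mulr_ge0// ltW.
  by congr (_ `^ _); clear -T0 m0; field; lra.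
have Tq : T `^ (2 - q) = T ^+ 2 / T `^ q.
  rewrite powRB; last by rewrite (gt_eqF T0) implybT.
  by rewrite powR_mulrn// ltW.
move: TC; rewrite Tq /C ltr_pdivlMr ?powR_gt0//.
set a := 2 `^ p; set b := (3 / m) `^ q; set c := T `^ q => hh.
have a0 : 0 < a by rewrite powR_gt0.
have b0 : 0 < b by rewrite powR_gt0// divr_gt0.
have c0 : 0 < c by rewrite powR_gt0.
rewrite -(@ltr_pM2r _ (a * b * c * T)); last by rewrite !mulr_gt0.
rewrite (_ : T^-1 * p * _ = p * a * b * c); last by clear -T0; field; lra.
rewrite (_ : (b * c)^-1 * _ * _ = T ^+ 2); last by clear -a0 b0 c0; field; lra.
exact: hh.
Qed.

End star.

(** * Moving an even function to the graph; quantitative nonvanishing *)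

Section transplant.
Context {R : realType}.
Notation mu := (@lebesgue_measure R).
Notation H := (@halfline R).
Implicit Types (f g : R -> R) (p l : R).

(** Here [f] is one half of an even function on the line. Each halfline receives the part beyond
    [l / 2]; the pendant receives [[0, l / 2]] stretched by 2, with 0 at the tip and [l / 2] at the
    vertex. *)
Definition transplant l f : 'I_3 -> R -> R :=
  tri (hshift (l / 2) f) (hshift (l / 2) f) (f \o affine (- 2^-1) (l / 2)).
Definition dtransplant l g : 'I_3 -> R -> R :=
  tri (hshift (l / 2) g) (hshift (l / 2) g) (fun x => - 2^-1 * g (affine (- 2^-1) (l / 2) x)).

Lemma transplant_tip l f : transplant l f ord_max l = f 0.
Proof. by rewrite /transplant /tri /= /affine; congr f; field. Qed.

(** The middle of the even function has kinetic energy [grad] over [[0, l / 2]], counting both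
    halves and the factor 1/2; the stretch leaves a quarter of it. *)
Lemma transplantP p l f g : 2 < p -> 0 < l -> H1pair H f g ->
  [/\ star l (transplant l f) (dtransplant l g),
      smass l (transplant l f) = 2 * mass H f &
      senergy p l (transplant l f) (dtransplant l g) =
      2 * energy p H f g - 3 / 4 * grad `[0, l / 2] g].
Proof.
move=> p2 l0 fg; have l20 : 0 <= l / 2 by lra.
have r1 : H1pair `[0, l / 2] f g by apply: H1_subset fg => //; exact: itv_sub_halfline.
have w := pow_integrable p2 (@halfline_edge R 1 ltr01) fg.
have sub F : mu.-integrable H (EFin \o F) -> mu.-integrable `[0, l / 2] (EFin \o F).
  by move=> Fi; apply: integrableS Fi => //; exact: itv_sub_halfline.
have [_ f2 g2 _] := fg.
have [_ sm] := Rintegral_shift l20 f2.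
have [_ sg] := Rintegral_shift l20 g2.
have [_ sp] := Rintegral_shift l20 w.
have fm := Rintegral_fold l0 (sub _ f2).
have fG := Rintegral_fold l0 (sub _ g2).
have fp := Rintegral_fold l0 (sub _ w).
have m3 : mass (pendant l) (f \o affine (- 2^-1) (l / 2)) = 2 * mass `[0, l / 2] f by exact: fm.
have p3 : pow p (pendant l) (f \o affine (- 2^-1) (l / 2)) = 2 * pow p `[0, l / 2] f by exact: fp.
have h3 := H1_fold l0 r1.
have g3 : grad (pendant l) (fun x => - 2^-1 * g (affine (- 2^-1) (l / 2) x)) =
    2^-1 * grad `[0, l / 2] g.
  rewrite /grad (_ : (fun x => (_ * _) ^+ 2) =
    (fun x => 4^-1 * (g x ^+ 2)) \o affine (- 2^-1) (l / 2)); last first.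
    by apply/funext => x /=; field.
  have i4 : mu.-integrable `[0, l / 2] (EFin \o (fun x => 4^-1 * g x ^+ 2)).
    have := integrable_lincomb 4^-1 0 (measurable_itv _) (sub _ g2) (sub _ g2).
    by apply: eq_integrable => // x _ /=; rewrite mul0r addr0.
  rewrite (Rintegral_fold l0 i4) RintegralZl//; last exact: (sub _ g2).
  by move: (Rintegral _ _ _) => A; field.
have hs := H1_shift l20 fg.
split.
- apply: star_triP; [exact: hs|exact: hs|exact: h3| |];
    by rewrite /hshift /affine /= mulr0 add0r.
- rewrite smass_tri m3.
  have -> : mass H f = mass `[0, l / 2] f + mass H (hshift (l / 2) f) by exact: sm.
  by move: (mass _ _) (mass _ _) => A B; clear; ring.
rewrite /senergy sgrad_tri spow_tri g3 p3 energyE.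
have -> : grad H g = grad `[0, l / 2] g + grad H (hshift (l / 2) g) by exact: sg.
have -> : pow p H f = pow p `[0, l / 2] f + pow p H (hshift (l / 2) f) by exact: sp.
by move: (pow _ _ _) (pow _ _ _) (grad _ _) (grad _ _) => A B C D; clear -p2; field; lra.
Qed.

(** Turns a value at the tip into potential energy. By Hölder continuity [f ^+ 2] stays above
    [a / 4] on an interval at the tip whose length depends only on [l], [a] and [B]. *)
Lemma pendant_pow_ge p l a B : 2 < p -> 0 < l -> 0 < a -> 0 <= B ->
  exists k, 0 < k /\ forall f g, H1pair (pendant l) f g -> a <= f l ^+ 2 ->
    grad (pendant l) g <= B -> k <= pow p (pendant l) f.
Proof.
move=> p2 l0 a0 B0.
pose d := Num.min l (a / (4 * (B + 1))).
have aB : 0 < a / (4 * (B + 1)) by rewrite divr_gt0//; lra.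
have d0 : 0 < d by rewrite lt_min l0.
have dl : d <= l by rewrite ge_min lexx.
have dB : d * B <= a / 4.
  apply: (@le_trans _ _ (a / (4 * (B + 1)) * B)).
    by rewrite ler_wpM2r// ge_min lexx orbT.
  rewrite -[leRHS]mulr1 (_ : a / _ * B = a / 4 * (B / (B + 1))); last by field; lra.
  rewrite ler_pM2l; last by lra.
  by rewrite ler_pdivrMr; lra.
exists ((a / 4) `^ (p / 2) * d); split; first by rewrite mulr_gt0// powR_gt0//; lra.
move=> f g fg fl gB.
have eP : is_edge (l / 2) (pendant l) by apply: pendant_edge; lra.
have il : pendant l l by rewrite /pendant/= in_itv/= lexx andbT ltW.
have sub : `[l - d, l] `<=` pendant l.
  by move=> x; rewrite /pendant/= !in_itv/=; lra.
have hi := pow_integrable p2 eP fg.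
apply: (@le_trans _ _ (Rintegral mu `[l - d, l] (fun x => `|f x| `^ p))); last first.
  by apply: ge0_Rintegral_subset => //; rewrite /pendant; exact: measurable_itv.
have -> : (a / 4) `^ (p / 2) * d = Rintegral mu `[l - d, l] (fun=> (a / 4) `^ (p / 2)).
  rewrite Rintegral_cst_itv; last by lra.
  by congr (_ * _); lra.
apply: le_Rintegral => //; first exact: integrable_cst_itv.
  by apply: integrableS hi => //; rewrite /pendant; exact: measurable_itv.
move=> x xI; have ix := sub _ xI; move: xI; rewrite /= in_itv/= => xI.
have -> : `|f x| `^ p = (f x ^+ 2) `^ (p / 2).
  by rewrite -powR_sqr_norm; congr (_ `^ _); field.
apply: ge0_ler_powR; rewrite ?nnegrE ?sqr_ge0//; [lra|lra|].
have xl : x <= l by lra.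
have := H1_holder eP fg ix il xl.
have : (l - x) * grad (pendant l) g <= d * B.
  by apply: ler_pM => //; [lra|exact: grad_ge0|lra].
move: (grad _ _) (f l) (f x) fl => G fl fx fl_a h1 h2.
have h3 : (fl - fx) ^+ 2 <= a / 4 by lra.
have := sqr_ge0 (fl - 2 * fx).
have -> : (fl - 2 * fx) ^+ 2 = 2 * (fl - fx) ^+ 2 - (fl ^+ 2 - 2 * fx ^+ 2) by ring.
by lra.
Qed.

(** Otherwise the mass would be at least [a * (m / a + 1) = m + a]. The bound on [T] is uniform over
    all functions of mass at most [m], which gives the cutting points for tightness. *)
Lemma exists_small_value f g (m a : R) : H1pair H f g -> 0 < a -> mass H f <= m ->
  exists T, [/\ 0 <= T, T <= m / a + 1 & f T ^+ 2 <= a].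
Proof.
move=> fg a0 fm; have [_ f2 _ _] := fg.
have m0 : 0 <= m by exact: le_trans (mass_ge0 _ _) fm.
have T0 : 0 <= m / a + 1 by rewrite addr_ge0// divr_ge0// ltW.
apply: contrapT => /forallNP nT.
have fa x : `[0, m / a + 1]%classic x -> a <= f x ^+ 2.
  rewrite /= in_itv/= => /andP[x0 xT]; have := nT x; apply: contra_notT.
  by rewrite -ltNge => /ltW h; split.
have : Rintegral mu `[0, m / a + 1] (fun=> a) <= mass H f.
  apply: (@le_trans _ _ (Rintegral mu `[0, m / a + 1] (fun x => f x ^+ 2))).
    apply: le_Rintegral => //; first exact: integrable_cst_itv.
    by apply: integrableS f2 => //; exact: itv_sub_halfline.
  apply: ge0_Rintegral_subset => //; first exact: itv_sub_halfline.
  by move=> x _; exact: sqr_ge0.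
rewrite Rintegral_cst_itv// subr0 mulrDr mulr1 mulrC mulfVK ?gt_eqF//.
by move: (mass H f) fm => M; lra.
Qed.

Lemma mass_shift_le f g (T T' : R) : H1pair H f g -> 0 <= T -> T <= T' ->
  mass H (hshift T' f) <= mass H (hshift T f).
Proof.
move=> fg T0 TT; have hs := H1_shift T0 fg; have [_ s2 _ _] := hs.
have d0 : 0 <= T' - T by rewrite subr_ge0.
have [_ E] := Rintegral_shift d0 s2; rewrite {2}/mass E.
have -> : hshift T' f = hshift (T' - T) (hshift T f).
  by apply/funext => x; rewrite /hshift; congr f; ring.
by rewrite lerDr; exact: Rintegral_sqr_ge0.
Qed.

End transplant.

(** * Quantitative subadditivity of the minimal energy *)

Section infimum.
Context {R : realType}.
Notation mu := (@lebesgue_measure R).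
Notation H := (@halfline R).
Implicit Types (u g : 'I_3 -> R -> R) (p l m e : R).

(** The number [e] is any negative lower bound at mass [m], not necessarily the infimum: this allows
    it to be the energy of a line function that is assumed unbeaten. *)
Definition energy_bound p l m e := [/\ 2 < p, p < 6, 0 < l, 0 < m &
  e < 0 /\ forall u g, star l u g -> smass l u = m -> e <= senergy p l u g].

Lemma powR_sqrt_split p (z : R) : 2 < p -> 0 < z -> Num.sqrt z `^ p = z * z `^ (p / 2 - 1).
Proof.
move=> p2 z0; have -> : Num.sqrt z `^ p = z `^ (p / 2).
  by rewrite -powR12_sqrt ?ltW// -powRrM; congr (_ `^ _); field.
rewrite mulr_powRB1 ?ltW//; lra.
Qed.

Lemma senergy_normalize p l m u g : 2 < p -> 0 < l -> 0 < m -> star l u g -> 0 < smass l u ->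
  let t := Num.sqrt (m / smass l u) in
  [/\ star l (fun i x => t * u i x) (fun i x => t * g i x),
      smass l (fun i x => t * u i x) = m &
      senergy p l (fun i x => t * u i x) (fun i x => t * g i x) =
      m / smass l u * (2^-1 * sgrad l g - (m / smass l u) `^ (p / 2 - 1) * spow p l u / p)].
Proof.
move=> p2 l0 m0 ug u0 t; pose q := p / 2 - 1; have z0 : 0 < m / smass l u by rewrite divr_gt0.
have t2 : t ^+ 2 = m / smass l u by rewrite sqr_sqrtr// ltW.
split; first exact: star_scale.
  by rewrite (smass_scale t l0 ug) t2 mulfVK// gt_eqF.
rewrite /senergy (sgrad_scale t l0 ug) (spow_scale p2 (sqrtr_ge0 _) l0 ug).
rewrite t2 (powR_sqrt_split p2 z0) -/q.
move: (m / smass l u) (sgrad l g) (spow p l u) (_ `^ q) => A B C D; ring.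
Qed.

(** Rescaling from mass [N] to [m] multiplies the kinetic energy by [m / N] and the potential energy
    by a further [(m / N)^q], which is at least [(m / M)^q]. The surplus over the linear share
    [N / m * e] is the price of missing mass; for [M = m] only the linear share remains. *)
Lemma senergy_lower_bound p l m e u g M : energy_bound p l m e -> star l u g -> smass l u <= M -> 0 < M -> M <= m ->
  smass l u / m * e + ((m / M) `^ (p / 2 - 1) - 1) * spow p l u / p <= senergy p l u g.
Proof.
move=> eb ug uM M0 Mm; have [p2 p6 l0 m0 [e0 e_lb]] := eb; pose q := p / 2 - 1.
have q0 : 0 < q by rewrite /q; lra.
have p0 : 0 < p by lra.
(* Zero mass cannot be rescaled; there the sup bound shows that the potential energy vanishes. *)
have [us0|us0] := eqVneq (smass l u) 0.
  have l2 : 0 < l / 2 by lra.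
  have P0 : spow p l u = 0.
    apply/eqP; rewrite eq_le spow_ge0 andbT.
    have := spow_le_smass p2 l0 ug (fun i x => star_sup l0 ug l2 (lexx _)).
    by rewrite us0 mulr0.
  rewrite us0 P0 /senergy P0 !mul0r !mulr0 mul0r addr0 subr0.
  by rewrite mulr_ge0// sgrad_ge0.
have s0 : 0 < smass l u by rewrite lt_neqAle eq_sym us0 smass_ge0.
have [h1 h2 h3] := senergy_normalize p2 l0 m0 ug s0.
have := e_lb _ _ h1 h2; rewrite h3 => {h1 h2 h3}.
rewrite /senergy -/q; set N := smass l u in uM us0 s0 *.
have P0 : 0 <= spow p l u by exact: spow_ge0.
have Nq : (m / M) `^ q <= (m / N) `^ q.
  apply: ge0_ler_powR; rewrite ?nnegrE; [exact: ltW| | |].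
  - by rewrite divr_ge0// ltW.
  - by rewrite divr_ge0// ltW.
  - by rewrite ler_pM2l// lef_pV2 ?posrE.
move: (sgrad l g) (spow p l u) P0 ((m / M) `^ q) ((m / N) `^ q) Nq => K P P0 A B AB.
have mN : 0 < N / m by rewrite divr_gt0.
rewrite -(ler_pM2l mN) mulrA (_ : N / m * (m / N) = 1) ?mul1r; last first.
  by clear -s0 m0; field; rewrite !gt_eqF.
move=> h; apply: (@le_trans _ _ (2^-1 * K - B * P / p + (A - 1) * P / p)).
  by rewrite lerD2r.
rewrite -subr_ge0.
have -> : 2^-1 * K - p^-1 * P - (2^-1 * K - B * P / p + (A - 1) * P / p) = (B - A) * P / p.
  by ring.
by rewrite !mulr_ge0 ?subr_ge0 ?invr_ge0// ltW.
Qed.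

(** Complete [f] to the graph by the constant [f 0] on the pendant and a unit ramp on the other
    halfline. This adds at most [f 0 ^+ 2 * (1 + l)] of mass and [f 0 ^+ 2 / 2] of kinetic
    energy. *)
Lemma halfline_lower_bound p l m e (f g : R -> R) M : energy_bound p l m e -> H1pair H f g ->
  mass H f + f 0 ^+ 2 * (1 + l) <= M -> 0 < M -> M <= m ->
  (mass H f + f 0 ^+ 2 * (1 + l)) / m * e + ((m / M) `^ (p / 2 - 1) - 1) * pow p H f / p
  <= energy p H f g + f 0 ^+ 2 / 2.
Proof.
move=> eb fg fM M0 Mm; have [p2 p6 l0 m0 [e0 e_lb]] := eb; pose q := p / 2 - 1.
have q0 : 0 < q by rewrite /q; lra.
have p0 : 0 < p by lra.
set a := f 0 in fM *.
have w : star l (tri f (ramp a 1) (fun x => 0 * x + a)) (tri g (dramp a 1) (fun=> 0)).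
  apply: star_triP => //; [exact: H1_ramp|exact/H1_line/ltW| |].
    by rewrite mul0r add0r.
  by rewrite ramp0// mul0r add0r.
have mr := @mass_ramp R a 1 ltr01; rewrite mulr1 in mr.
have wm : smass l (tri f (ramp a 1) (fun x => 0 * x + a)) <= mass H f + a ^+ 2 * (1 + l).
  rewrite smass_tri (mass_cst _ (ltW l0)).
  by move: (mass H f) (mass H (ramp a 1)) (a ^+ 2) mr => A B C BC; clear -BC; lra.
have := senergy_lower_bound eb w (le_trans wm fM) M0 Mm.
rewrite /senergy sgrad_tri spow_tri grad_cst0 grad_ramp// divr1 addr0 energyE.
have r0 : 0 <= pow p H (ramp a 1) by exact: pow_ge0.
have c0 : 0 <= pow p (pendant l) (fun x => 0 * x + a) by exact: pow_ge0.
have Mq : 1 <= (m / M) `^ q.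
  rewrite -(powRr0 (m / M)); apply: ler_powR; last exact: ltW.
  by rewrite ler_pdivlMr// mul1r.
have wm' : (mass H f + a ^+ 2 * (1 + l)) / m * e <= smass l (tri f (ramp a 1) (fun x => 0 * x + a)) / m * e.
  apply: ler_wnM2r; first exact: ltW.
  by rewrite ler_pM2r ?invr_gt0.
move: wm'; set X := (_ + _) / m * e; set Y := smass _ _ / m * e.
move: X Y r0 c0 Mq.
move: (pow p H f) (pow p H (ramp a 1)) (pow p (pendant l) _) => P P1 P2.
move: (grad H g) (_ `^ q) (a ^+ 2) => G Q A X Y P10 P20 Q1 XY h.
have : 0 <= Q * (P1 + P2) / p.
  by rewrite !mulr_ge0 ?addr_ge0 ?invr_ge0//; [exact: le_trans Q1|exact: ltW].
rewrite (_ : (Q - 1) * (P + P1 + P2) / p = (Q - 1) * P / p + Q * (P1 + P2) / p - p^-1 * (P1 + P2)) in h; last by ring.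
rewrite (_ : p^-1 * (P + P1 + P2) = p^-1 * P + p^-1 * (P1 + P2)) in h; last by ring.
move: (Q * _ / p) ((Q - 1) * P / p) (p^-1 * (P1 + P2)) (p^-1 * P) h XY => *; lra.
Qed.

(* A halfline profile carrying half the mass cannot nearly vanish at the origin:
   otherwise it would be a competitor on its own, and doubling its mass would
   beat two copies of it. *)
Lemma halfline_center_value p l m e : energy_bound p l m e -> exists a e1 : R, [/\ 0 < a, 0 < e1, e1 <= - e / 2 &
  forall f g : R -> R, H1pair H f g -> mass H f <= m / 2 -> 2 * energy p H f g <= e + e1 ->
  a <= f 0 ^+ 2].
Proof.
move=> eb; have [p2 p6 l0 m0 [e0 e_lb]] := eb; pose q := p / 2 - 1.
have q0 : 0 < q by rewrite /q; lra.
have p0 : 0 < p by lra.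
(* The ratio is [m / M] for [M = 3 * m / 4]: half the mass, plus at most [m / 4] for the completion
   to the graph. *)
pose c := (4 / 3) `^ q - 1 : R.
have c0 : 0 < c.
  rewrite /c subr_gt0 -[ltLHS](congr1 (@^~ q) (@powR1 R)); apply: gt0_ltr_powR; rewrite ?nnegrE//; lra.
(* Loss per unit of [f 0 ^+ 2]: kinetic energy of the ramp, and the share of [e] for the added
   mass. *)
pose D := 2^-1 + (1 + l) * - e / m.
have D0 : 0 < D by rewrite addr_gt0// divr_gt0// mulr_gt0//; lra.
exists (Num.min (m / (4 * (1 + l))) (c * - e / (8 * D))), (Num.min (c * - e / 4) (- e / 2)).
have ce : 0 < c * - e by rewrite mulr_gt0// oppr_gt0.
split.
- by rewrite lt_min !divr_gt0//; lra.
- by rewrite lt_min; apply/andP; split; lra.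
- by rewrite ge_min lexx orbT.
move=> f g fg fm fE; rewrite leNgt lt_min; apply/negP => /andP[h1 h2].
have {}h1 : f 0 ^+ 2 * (1 + l) <= m / 4.
  apply: ltW; move: h1; rewrite ltr_pdivlMr; last by lra.
  by move: (f 0 ^+ 2) => z; lra.
have {}h2 : f 0 ^+ 2 * D < c * - e / 8.
  by move: h2; rewrite ltr_pdivlMr; [move: (f 0 ^+ 2) (c * - e) => z y; lra|lra].
have M0 : 0 < 3 * m / 4 by lra.
have Mm : 3 * m / 4 <= m by lra.
have fM : mass H f + f 0 ^+ 2 * (1 + l) <= 3 * m / 4.
  by move: (mass H f) (f 0 ^+ 2 * _) fm h1 => x y; lra.
have := halfline_lower_bound eb fg fM M0 Mm.
rewrite (_ : m / (3 * m / 4) = 4 / 3); last by field; lra.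
rewrite -/c => hh.
have fE1 : 2 * energy p H f g <= e + c * - e / 4.
  by apply: (le_trans fE); rewrite lerD2l ge_min lexx.
have fE2 : 2 * energy p H f g <= e / 2.
  apply: (le_trans fE); apply: (@le_trans _ _ (e + - e / 2)); last by lra.
  by rewrite lerD2l ge_min lexx orbT.
have {fE fE2} : - e / 4 <= pow p H f / p.
  move: fE2; rewrite energyE; have := grad_ge0 H g.
  rewrite [pow p H f / p]mulrC.
  by move: (grad H g) (p^-1 * _) => *; lra.
move=> fp.
have {}fp : c * - e / 4 <= c * pow p H f / p.
  by rewrite -!mulrA ler_pM2l// mulrA.
have h3 : m / 2 / m * e + f 0 ^+ 2 * (1 + l) / m * e <= (mass H f + f 0 ^+ 2 * (1 + l)) / m * e.
  rewrite -mulrDl -mulrDl; apply: ler_wnM2r; first exact: ltW.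
  by rewrite ler_pM2r ?invr_gt0// lerD2r.
have h4 : m / 2 / m * e = e / 2 by field; lra.
have h5 : f 0 ^+ 2 * D = f 0 ^+ 2 / 2 - f 0 ^+ 2 * (1 + l) / m * e by rewrite /D; ring.
move: hh fE1 fp h2 h3; rewrite h4 h5.
move: (c * pow p H f / p) (energy p H f g) (_ / m * e) (_ / m * e) (f 0 ^+ 2 / 2) (c * - e) ce.
by clear; move=> *; lra.
Qed.

(** Tops a competitor up to mass [m]: since its energy is at most 0, the factor [t ^+ 2 >= 1] can
    only lower it. The transplanted function has too little mass once the mass in the pendant is
    discarded. *)
Lemma senergy_scale_up p l m u g : 2 < p -> 0 < l -> 0 < m -> star l u g -> 0 < smass l u -> smass l u <= m ->
  senergy p l u g <= 0 ->
  exists t : R, [/\ 1 <= t, star l (fun i x => t * u i x) (fun i x => t * g i x),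
    smass l (fun i x => t * u i x) = m &
    senergy p l (fun i x => t * u i x) (fun i x => t * g i x) <= senergy p l u g].
Proof.
move=> p2 l0 m0 ug u0 um uE; pose q := p / 2 - 1; have q0 : 0 < q by rewrite /q; lra.
have p0 : 0 < p by lra.
have [h1 h2 h3] := senergy_normalize p2 l0 m0 ug u0.
exists (Num.sqrt (m / smass l u)); split => //.
  by rewrite -sqrtr1 ler_wsqrtr// ler_pdivlMr// mul1r.
rewrite h3; have z1 : 1 <= m / smass l u by rewrite ler_pdivlMr// mul1r.
have zq : 1 <= (m / smass l u) `^ q.
  by rewrite -(powRr0 (m / smass l u)); apply: ler_powR => //; exact: ltW.
have P0 := spow_ge0 p l u.
apply: (@le_trans _ _ (m / smass l u * senergy p l u g)); last by rewrite ler_neMl.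
rewrite ler_pM2l; last by clear -z1; lra.
rewrite /senergy lerD2l lerN2 -mulrA [spow p l u / p]mulrC ler_peMl//.
by rewrite mulr_ge0// invr_ge0 ltW.
Qed.

End infimum.

(** * Nonvanishing and tightness of minimizing sequences *)

Section compactness.
Context {R : realType}.
Notation mu := (@lebesgue_measure R).
Notation H := (@halfline R).
Implicit Types (u g : 'I_3 -> R -> R) (p l m e a s : R).

Notation o0 := (ord0 : 'I_3).
Notation o1 := (lift ord0 ord0 : 'I_3).
Notation o2 := (ord_max : 'I_3).

Lemma smass3 l u : smass l u = mass H (u o0) + mass H (u o1) + mass (pendant l) (u o2).
Proof. by rewrite -{1}(triE u) smass_tri. Qed.

Lemma senergy3 p l u g : senergy p l u g =
  energy p H (u o0) (g o0) + energy p H (u o1) (g o1) + energy p (pendant l) (u o2) (g o2).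
Proof. by rewrite -{1}(triE u) -{1}(triE g) -energy_pendant_star. Qed.

Lemma energy_ge_pow p (I : set R) (f g : R -> R) : - (pow p I f / p) <= energy p I f g.
Proof.
rewrite energyE [pow p I f / p]mulrC; have := grad_ge0 I g.
by move: (grad I g) (p^-1 * _) => *; lra.
Qed.

Lemma energy_ge0_mass0 p (f g : R -> R) : 2 < p -> H1pair H f g -> mass H f = 0 ->
  0 <= energy p H f g.
Proof.
move=> p2 fg f0; have eH := @halfline_edge R 1 ltr01.
have := pow_le_mass p2 eH fg (fun x Hx => H1_sup eH fg Hx ltr01 (lexx 1)).
rewrite f0 mulr0 => P0; have {}P0 : pow p H f = 0.
  by apply/eqP; rewrite eq_le P0 pow_ge0.
by have := energy_ge_pow p H f g; rewrite P0 mul0r oppr0.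
Qed.

Lemma nonvanishing_minimizers p l m e : energy_bound p l m e ->
  (forall s, 0 < s -> exists u g, [/\ star l u g, smass l u = m & senergy p l u g < e + s]) ->
  exists k, 0 < k /\ forall s, 0 < s -> exists u g, [/\ star l u g, smass l u = m,
    senergy p l u g < e + s & k <= pow p (pendant l) (u o2)].
Proof.
move=> eb approx; have [p2 p6 l0 m0 [e0 _]] := eb.
have p0 : 0 < p by lra.
have [a [e1 [a0 e10 e1e center]]] := halfline_center_value eb.
have [B [B0 coer]] := sgrad_coercive p2 p6 l0 m0.
have [k [k0 tip]] := pendant_pow_ge p2 l0 a0 B0.
apply: contrapT => /forallNP contra.
have nb j : 0 < j -> exists s, 0 < s /\ forall u g, star l u g -> smass l u = m ->
    senergy p l u g < e + s -> pow p (pendant l) (u o2) < j.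
  move=> j0; have := contra j => /not_andP[//|/existsNP[s /not_implyP[s0 hs]]].
  exists s; split => // u g ug um us; rewrite ltNge; apply/negP => ju.
  by apply: hs; exists u, g.
have [s1 [s10 h1]] := nb _ k0.
(* Two thresholds: within [s1] of [e] the pendant term stays below [k], and within [s2] below
   [p * d / 4], so discarding the pendant costs less than [d / 4]. The transplanted competitor is
   within [d <= s1] of [e], yet reaches [k]. *)
pose d := Num.min s1 e1.
have d0 : 0 < d by rewrite lt_min s10.
have ds : d <= s1 by rewrite ge_min lexx.
have de : d <= e1 by rewrite ge_min lexx orbT.
have pd : 0 < p * d / 4 by rewrite divr_gt0// mulr_gt0.
have [s2 [s20 h2]] := nb _ pd.
have [u [g [ug um uE]]] : exists u g, [/\ star l u g, smass l u = m &
    senergy p l u g < e + Num.min s2 (d / 2)].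
  by apply: approx; rewrite lt_min s20/=; lra.
have u3 : pow p (pendant l) (u o2) < p * d / 4.
  by apply: h2 ug um _; rewrite (lt_le_trans uE)// lerD2l ge_min lexx.
have E12 : energy p H (u o0) (g o0) + energy p H (u o1) (g o1) < e + 3 / 4 * d.
  have : senergy p l u g < e + d / 2.
    by rewrite (lt_le_trans uE)// lerD2l ge_min lexx orbT.
  have := energy_ge_pow p (pendant l) (u o2) (g o2).
  have : pow p (pendant l) (u o2) / p < d / 4.
    by rewrite ltr_pdivrMr//; move: u3; rewrite (_ : p * d / 4 = d / 4 * p)//; ring.
  rewrite senergy3.
  move: (energy p H (u o0) _) (energy p H (u o1) _) (energy p _ _ _) (_ / p).
  by clear; move=> *; lra.
have [gu g0] := ug.
have hu0 : H1pair H (u o0) (g o0) by exact: (gu o0).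
have hu1 : H1pair H (u o1) (g o1) by exact: (gu o1).
have E0 : e + 3 / 4 * d < 0 by clear -de e1e e0 d0; lra.
have M0 : 0 <= mass H (u o0) by exact: mass_ge0.
have M1 : 0 <= mass H (u o1) by exact: mass_ge0.
have M3 : 0 <= mass (pendant l) (u o2) by exact: mass_ge0.
have M01 : 0 < mass H (u o0) + mass H (u o1).
  rewrite lt_neqAle addr_ge0// andbT eq_sym paddr_eq0//; apply/negP => /andP[/eqP z0 /eqP z1].
  have := energy_ge0_mass0 p2 hu0 z0; have := energy_ge0_mass0 p2 hu1 z1.
  move: (energy p H (u o0) _) (energy p H (u o1) _) E12 E0.
  by clear; move=> *; lra.
have u01 : u o0 0 = u o1 0 by rewrite [RHS]g0.
have [f [h [fh fm fE]]] := median_reflection p2 hu0 hu1 u01 M01.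
have fm2 : mass H f <= m / 2.
  move: um; rewrite smass3 fm.
  by move: (mass H (u o0)) (mass H (u o1)) (mass _ _) M3; clear; move=> *; lra.
have fE1 : 2 * energy p H f h <= e + e1.
  move: (energy p H (u o0) _) (energy p H (u o1) _) (energy p H f h) E12 fE.
  by clear -de d0; move=> *; lra.
have fa := center _ _ fh fm2 fE1.
have [w wm wE] := transplantP p2 l0 fh.
have wE' : senergy p l (transplant l f) (dtransplant l h) < e + 3 / 4 * d.
  have := grad_ge0 `[0, l / 2] h; rewrite wE.
  move: (energy p H (u o0) _) (energy p H (u o1) _) (energy p H f h) (grad _ _) E12 fE.
  by clear; move=> *; lra.
have wm0 : 0 < smass l (transplant l f).
  by rewrite wm fm; move: (mass _ _ + mass _ _) M01 => z; clear; lra.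
have wmm : smass l (transplant l f) <= m.
  by rewrite wm; move: (mass _ _) fm2 => z; clear; lra.
have [t [t1 tw tm tE]] := senergy_scale_up p2 l0 m0 w wm0 wmm (ltW (lt_trans wE' E0)).
have tE0 := le_lt_trans tE (lt_trans wE' E0).
have : pow p (pendant l) ((fun i x => t * transplant l f i x) o2) < k.
  apply: (h1 _ _ tw tm); apply: (le_lt_trans tE); apply: (lt_trans wE').
  by clear -ds d0; lra.
rewrite ltNge => /negP; apply.
apply: (tip _ ((fun i x => t * dtransplant l h i x) o2)).
- by have [tw1 _] := tw; exact: (tw1 o2).
- rewrite transplant_tip; apply: (le_trans fa); rewrite exprMn ler_peMl ?sqr_ge0//.
  exact: exprn_ege1.
- apply: le_trans (coer _ _ tw tm (ltW tE0)).
  exact: (grad_le_sgrad l (fun i x => t * dtransplant l h i x) o2).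
Qed.

(** Tails beyond [T0] and [T1] are replaced by unit ramps, each adding at most [a] of mass and
    [a / 2] of energy. *)
Lemma cut_energy p l u g (T0 T1 a : R) : 2 < p -> 0 < l -> star l u g -> 0 <= T0 -> 0 <= T1 ->
  u o0 T0 ^+ 2 <= a -> u o1 T1 ^+ 2 <= a ->
  exists v h, [/\ star l v h,
   smass l v <= mass `[0, T0] (u o0) + mass `[0, T1] (u o1) + mass (pendant l) (u o2) + 2 * a,
   pow p (pendant l) (u o2) <= spow p l v &
   senergy p l v h <= energy p `[0, T0] (u o0) (g o0) + energy p `[0, T1] (u o1) (g o1) +
     energy p (pendant l) (u o2) (g o2) + a].
Proof.
move=> p2 l0 [ug u0] t0 t1 a0 a1.
have hu0 : H1pair H (u o0) (g o0) by exact: (ug o0).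
have hu1 : H1pair H (u o1) (g o1) by exact: (ug o1).
have hu2 : H1pair (pendant l) (u o2) (g o2) by exact: (ug o2).
have eH := @halfline_edge R 1 ltr01.
have step f f' T : H1pair H f f' -> 0 <= T -> f T ^+ 2 <= a ->
    [/\ H1pair H (hglue T f (ramp (f T) 1)) (hglue T f' (dramp (f T) 1)),
     mass H (hglue T f (ramp (f T) 1)) <= mass `[0, T] f + a,
     hglue T f (ramp (f T) 1) 0 = f 0 &
     energy p H (hglue T f (ramp (f T) 1)) (hglue T f' (dramp (f T) 1)) <=
     energy p `[0, T] f f' + a / 2].
  move=> ff T0' fa.
  have r1 : H1pair `[0, T] f f' by apply: H1_subset ff => //; exact: itv_sub_halfline.
  have hr := @H1_ramp R (f T) 1 ltr01.
  have sub F : mu.-integrable H (EFin \o F) -> mu.-integrable `[0, T] (EFin \o F).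
    by move=> Fi; apply: integrableS Fi => //; exact: itv_sub_halfline.
  have [_ f2 d2 _] := ff; have [_ r2 rd2 _] := hr.
  have w1 := pow_integrable p2 eH ff; have w2 := pow_integrable p2 eH hr.
  split.
  - apply: H1_hglue => //; rewrite ramp0//.
  - rewrite /mass [leLHS](@Rintegral_hglue _ T (fun x => x ^+ 2) _ _ T0' (sub _ f2) r2).
    apply: lerD => //; have := @mass_ramp R (f T) 1 ltr01; rewrite mulr1.
    by move=> /le_trans; apply.
  - by rewrite /hglue T0'.
  - rewrite !energyE.
    have -> : grad H (hglue T f' (dramp (f T) 1)) = grad `[0, T] f' + f T ^+ 2.
      rewrite -[f T ^+ 2]divr1 -grad_ramp// /grad.
      exact: (@Rintegral_hglue _ T (fun x => x ^+ 2) _ _ T0' (sub _ d2) rd2).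
    have -> : pow p H (hglue T f (ramp (f T) 1)) = pow p `[0, T] f + pow p H (ramp (f T) 1).
      exact: (@Rintegral_hglue _ T (fun x => `|x| `^ p) _ _ T0' (sub _ w1) w2).
    have : 0 <= p^-1 * pow p H (ramp (f T) 1).
      by rewrite mulr_ge0 ?pow_ge0// invr_ge0; clear -p2; lra.
    rewrite !mulrDr; move: (p^-1 * _) (p^-1 * _) (grad _ _) (f T ^+ 2) fa.
    by clear; move=> *; lra.
have [k0 k1 k2 k3] := step _ _ _ hu0 t0 a0.
have [j0 j1 j2 j3] := step _ _ _ hu1 t1 a1.
set v0 := hglue T0 _ _ in k0 k1 k2 k3; set h0 := hglue T0 _ _ in k0 k3.
set v1 := hglue T1 _ _ in j0 j1 j2 j3; set h1 := hglue T1 _ _ in j0 j3.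
exists (tri v0 v1 (u o2)), (tri h0 h1 (g o2)); split.
- apply: star_triP => //; first by rewrite k2 [RHS]u0.
  by rewrite j2 [RHS]u0 [LHS]u0.
- rewrite smass_tri; move: (mass H v0) (mass H v1) (mass _ _) (mass _ _) (mass _ _) k1 j1.
  by clear; move=> *; lra.
- by rewrite spow_tri lerDr addr_ge0// pow_ge0.
- rewrite -energy_pendant_star /energy_pendant.
  move: k3 j3; move: (energy _ _ _ _) (energy _ _ _ _) (energy _ _ _ _) (energy _ _ _ _) (energy _ _ _ _).
  by clear; move=> *; lra.
Qed.

Lemma energy_shift p (f g : R -> R) T : 2 < p -> H1pair H f g -> 0 <= T ->
  mass H f = mass `[0, T] f + mass H (hshift T f) /\
  energy p H f g = energy p `[0, T] f g + energy p H (hshift T f) (hshift T g).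
Proof.
move=> p2 fg T0; have [_ f2 g2 _] := fg.
have w := pow_integrable p2 (@halfline_edge R 1 ltr01) fg.
have [_ sm] := Rintegral_shift T0 f2.
have [_ sg] := Rintegral_shift T0 g2.
have [_ sp] := Rintegral_shift T0 w.
split; first exact: sm.
rewrite !energyE.
have -> : grad H g = grad `[0, T] g + grad H (hshift T g) by exact: sg.
have -> : pow p H f = pow p `[0, T] f + pow p H (hshift T f) by exact: sp.
by move: (pow _ _ _) (pow _ _ _) (grad _ _) (grad _ _); clear; move=> *; ring.
Qed.

(** If the tails carry more than [n], the cut function misses at least [n / 2] of the mass while
    keeping potential [k] in the pendant, so its surplus is at least [c * k / p]. The tails
    contribute their linear shares of [e], and the total exceeds [e + a]. *)
Lemma tight_minimizers p l m e k n : energy_bound p l m e -> 0 < k -> 0 < n ->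
  exists T s, [/\ 0 <= T, 0 < s & forall u g, star l u g -> smass l u = m ->
    senergy p l u g < e + s -> k <= pow p (pendant l) (u o2) ->
    mass H (hshift T (u o0)) + mass H (hshift T (u o1)) <= n].
Proof.
move=> eb k0 n0'; have [p2 p6 l0 m0 [e0 _]] := eb.
have p0 : 0 < p by lra.
(* This keeps [M = m - n / 2] positive below. *)
wlog n_m : n n0' / n <= m.
  move=> hw; have mn0 : 0 < Num.min n m by rewrite lt_min n0'.
  have [|T [s [T0 s0 hT]]] := hw _ mn0; first by rewrite ge_min lexx orbT.
  exists T, s; split => // u g ug um uE uk; apply: (le_trans (hT u g ug um uE uk)).
  by rewrite ge_min lexx.
have [B [B0 coer]] := sgrad_coercive p2 p6 l0 m0.
pose q := p / 2 - 1; have q0 : 0 < q by rewrite /q; lra.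
pose S := 2 / (l / 2) * m + 2 * (l / 2) * B.
(* A lower bound for the mass in the pendant. It leaves room to complete a tail to the graph without
   exceeding mass [m]. *)
pose k' := k / (S `^ q + 1).
have S1 : 0 < S `^ q + 1 by rewrite ltr_wpDl ?powR_ge0.
have k'0 : 0 < k' by rewrite divr_gt0.
pose M := m - n / 2.
have M0 : 0 < M by rewrite /M; clear -n_m m0; lra.
have Mm : M <= m by rewrite /M; clear -n0'; lra.
pose c := (m / M) `^ q - 1.
have c0 : 0 < c.
  rewrite /c subr_gt0 -[ltLHS](congr1 (@^~ q) (@powR1 R)).
  apply: gt0_ltr_powR; rewrite ?nnegrE ?divr_ge0//; [exact: ltW|exact: ltW|].
  by rewrite ltr_pdivlMr// mul1r /M; clear -n0'; lra.
(* All losses in units of [a]: 1 for the two cuts, 1/2 for each tail, 1 for the distance to [e]; and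
   the share of [e] for the excess mass [2 * a + 2 * a * (1 + l)]. *)
pose C := 3 + (4 + 2 * l) * - e / m.
have C3 : 3 <= C.
  rewrite /C lerDl divr_ge0//; last exact: ltW.
  by rewrite mulr_ge0//; clear -l0 e0; lra.
have C0 : 0 < C by clear -C3; lra.
have ck : 0 < c * k / p by rewrite divr_gt0// mulr_gt0.
pose a := Num.min (Num.min (c * k / p / (2 * C)) (n / 4)) (Num.min (k' / (1 + l)) (- e)).
have a0 : 0 < a.
  rewrite !lt_min !divr_gt0 ?mulr_gt0//=; [|clear -l0; lra].
  by clear -e0; lra.
have aC : a * C < c * k / p.
  apply: (@le_lt_trans _ _ (c * k / p / (2 * C) * C)).
    by rewrite ler_pM2r// !ge_min lexx.
  rewrite (_ : _ * C = c * k / p / 2); last by field; rewrite !gt_eqF.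
  by clear -ck; lra.
have an : a <= n / 4 by rewrite !ge_min lexx !orbT.
have ak : a * (1 + l) <= k'.
  rewrite -ler_pdivlMr; last by clear -l0; lra.
  by rewrite !ge_min lexx !orbT.
have ae : a <= - e by rewrite !ge_min lexx !orbT.
have T0 : 0 <= m / a + 1 by rewrite addr_ge0// divr_ge0// ltW.
exists (m / a + 1), a; split => // u g ug um uE uk.
have uE0 : senergy p l u g <= 0 by apply: (le_trans (ltW uE)); clear -ae; lra.
have uB := coer _ _ ug um uE0.
have [gu g0] := ug.
have hu0 : H1pair H (u o0) (g o0) by exact: (gu o0).
have hu1 : H1pair H (u o1) (g o1) by exact: (gu o1).
have hu2 : H1pair (pendant l) (u o2) (g o2) by exact: (gu o2).
have um0 : mass H (u o0) <= m by rewrite -um; exact: (mass_le_smass l u o0).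
have um1 : mass H (u o1) <= m by rewrite -um; exact: (mass_le_smass l u o1).
have l2 : 0 < l / 2 by clear -l0; lra.
have m3 : k' <= mass (pendant l) (u o2).
  have eP : is_edge (l / 2) (pendant l) by apply: pendant_edge.
  have uS x : pendant l x -> u o2 x ^+ 2 <= S.
    move=> ix; apply: (le_trans (star_sup (i := o2) l0 ug l2 (lexx _) ix)).
    by rewrite um lerD2l ler_wpM2l// mulr_ge0// ltW.
  have := pow_le_mass p2 eP hu2 uS; rewrite -/q => h.
  rewrite /k' ler_pdivrMr// (le_trans uk)// (le_trans h)// mulrC mulrDr mulr1.
  by rewrite lerDl mass_ge0.
have [A0 [A00 A0T A0a]] := exists_small_value hu0 a0 um0.
have [A1 [A10 A1T A1a]] := exists_small_value hu1 a0 um1.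
apply: (@le_trans _ _ (mass H (hshift A0 (u o0)) + mass H (hshift A1 (u o1)))).
  by apply: lerD; [exact: mass_shift_le hu0 A00 A0T|exact: mass_shift_le hu1 A10 A1T].
have [v [h [vh vm vp vE]]] := cut_energy p2 l0 ug A00 A10 A0a A1a.
have [sm0 sE0] := energy_shift p2 hu0 A00.
have [sm1 sE1] := energy_shift p2 hu1 A10.
have hs0 := H1_shift A00 hu0; have hs1 := H1_shift A10 hu1.
have z0 : hshift A0 (u o0) 0 ^+ 2 <= a by rewrite /hshift add0r.
have z1 : hshift A1 (u o1) 0 ^+ 2 <= a by rewrite /hshift add0r.
rewrite leNgt; apply/negP => big.
move: um; rewrite smass3 sm0 sm1 => um.
have L0 : (mass H (hshift A0 (u o0)) + a * (1 + l)) / m * e <=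
    energy p H (hshift A0 (u o0)) (hshift A0 (g o0)) + a / 2.
  have hM : mass H (hshift A0 (u o0)) + a * (1 + l) <= m.
    move: um ak m3 (mass_ge0 `[0, A0] (u o0)) (mass_ge0 `[0, A1] (u o1)) (mass_ge0 H (hshift A1 (u o1))).
    move: (mass _ _) (mass _ _) (mass _ _) (mass _ _) (mass _ _) (a * (1 + l)).
    by clear; move=> *; lra.
  have zl : hshift A0 (u o0) 0 ^+ 2 * (1 + l) <= a * (1 + l).
    by rewrite ler_wpM2r//; clear -l0; lra.
  have hM' : mass H (hshift A0 (u o0)) + hshift A0 (u o0) 0 ^+ 2 * (1 + l) <= m.
    by apply: le_trans hM; rewrite lerD2l.
  have := halfline_lower_bound eb hs0 hM' m0 (lexx m).
  rewrite (divff (lt0r_neq0 m0)) powR1 subrr !mul0r addr0 => hh.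
  apply: (@le_trans _ _ _ _ _ (le_trans _ hh)).
    apply: ler_wnM2r; first exact: ltW.
    by rewrite ler_pM2r ?invr_gt0// lerD2l.
  by rewrite lerD2l ler_pM2r.
have L1 : (mass H (hshift A1 (u o1)) + a * (1 + l)) / m * e <=
    energy p H (hshift A1 (u o1)) (hshift A1 (g o1)) + a / 2.
  have hM : mass H (hshift A1 (u o1)) + a * (1 + l) <= m.
    move: um ak m3 (mass_ge0 `[0, A0] (u o0)) (mass_ge0 `[0, A1] (u o1)) (mass_ge0 H (hshift A0 (u o0))).
    move: (mass _ _) (mass _ _) (mass _ _) (mass _ _) (mass _ _) (a * (1 + l)).
    by clear; move=> *; lra.
  have zl : hshift A1 (u o1) 0 ^+ 2 * (1 + l) <= a * (1 + l).
    by rewrite ler_wpM2r//; clear -l0; lra.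
  have hM' : mass H (hshift A1 (u o1)) + hshift A1 (u o1) 0 ^+ 2 * (1 + l) <= m.
    by apply: le_trans hM; rewrite lerD2l.
  have := halfline_lower_bound eb hs1 hM' m0 (lexx m).
  rewrite (divff (lt0r_neq0 m0)) powR1 subrr !mul0r addr0 => hh.
  apply: (@le_trans _ _ _ _ _ (le_trans _ hh)).
    apply: ler_wnM2r; first exact: ltW.
    by rewrite ler_pM2r ?invr_gt0// lerD2l.
  by rewrite lerD2l ler_pM2r.
pose O := mass H (hshift A0 (u o0)) + mass H (hshift A1 (u o1)).
have vm' : smass l v <= m - O + 2 * a.
  move: vm um; rewrite /O; move: (smass l v).
  move: (mass _ _) (mass _ _) (mass _ _) (mass _ _) (mass _ _).
  by clear; move=> *; lra.
have vM : smass l v <= M.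
  apply: (le_trans vm'); rewrite /M; move: big; rewrite -/O.
  by generalize O; clear -an => O' hO; lra.
have := senergy_lower_bound eb vh vM M0 Mm; rewrite -/q -/c => L2.
have cv : c * k / p <= c * spow p l v / p.
  by rewrite ler_pM2r ?invr_gt0// ler_pM2l// (le_trans uk).
have L3 : (m - O + 2 * a) / m * e <= smass l v / m * e.
  apply: ler_wnM2r; first exact: ltW.
  by rewrite ler_pM2r ?invr_gt0.
have tot : (m - O + 2 * a) / m * e + (mass H (hshift A0 (u o0)) + a * (1 + l)) / m * e +
    (mass H (hshift A1 (u o1)) + a * (1 + l)) / m * e = e - a * ((4 + 2 * l) * - e / m).
  rewrite /O; move: (mass _ _) (mass _ _) => x y; clear -m0; field; lra.
move: uE; rewrite senergy3 sE0 sE1.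
have aC' : a * C = 3 * a + a * ((4 + 2 * l) * - e / m) by rewrite /C; ring.
move: aC vE L2 L3 L0 L1 tot cv; rewrite aC'.
move: (a * (_ * - e / m)) (c * spow p l v / p) (c * k / p) (_ / m * e) (_ / m * e) (_ / m * e) (_ / m * e).
move: (senergy p l v h) (energy _ _ _ _) (energy _ _ _ _) (energy _ _ _ _) (energy _ _ _ _) (energy _ _ _ _).
by clear; move=> *; lra.
Qed.

End compactness.

(** * Fatou's lemma and completeness for square-integrable functions *)

Section L2_completeness.
Context {R : realType}.
Notation mu := (@lebesgue_measure R).
Implicit Types (I : set R) (f g : R -> R) (c : R).

Lemma L2_fatou I (h : nat -> R -> R) f c : measurable I ->
  (forall k, measurable_fun I (h k)) -> (forall k, L2 I (h k)) ->
  (forall x, I x -> h k x @[k --> \oo] --> f x) ->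
  (forall k, Rintegral mu I (fun x => h k x ^+ 2) <= c) ->
  L2 I f /\ Rintegral mu I (fun x => f x ^+ 2) <= c.
Proof.
move=> mI mh h2 hf hc.
have mf : measurable_fun I f by exact: measurable_fun_cvg mh hf.
have mf2 : measurable_fun I (fun x => (f x ^+ 2)%:E).
  by apply/measurable_EFinP; exact: measurable_funX.
have mh2 k : measurable_fun I (fun x => (h k x ^+ 2)%:E).
  by apply/measurable_EFinP; exact: measurable_funX.
have le : (\int[mu]_(x in I) (f x ^+ 2)%:E <= c%:E)%E.
  have -> : (\int[mu]_(x in I) (f x ^+ 2)%:E =
      \int[mu]_(x in I) limn_einf (fun k => (h k x ^+ 2)%:E))%E.
    apply: eq_integral => x /[!inE] Ix.
    have cv : (h k x ^+ 2)%:E @[k --> \oo] --> (f x ^+ 2)%:E.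
      apply: cvg_EFin; first exact: nearW.
      rewrite (_ : fine \o _ = fun k => h k x * h k x)//.
      by rewrite expr2; apply: cvgM; exact: hf.
    by rewrite is_cvg_limn_einfE; [rewrite (cvg_lim _ cv)|exact: cvgP cv].
  apply: (@le_trans _ _ (limn_einf (fun k => \int[mu]_(x in I) (h k x ^+ 2)%:E))%E).
    by apply: fatou => // k x _; rewrite lee_fin sqr_ge0.
  rewrite limn_einf_lim; apply: lime_le; first exact: is_cvg_einfs.
  apply: nearW => k; apply: (@le_trans _ _ (\int[mu]_(x in I) (h k x ^+ 2)%:E)%E).
    by apply: ereal_inf_lbound; exists k => /=.
  by have := hc k; rewrite -lee_fin /Rintegral fineK//; exact: integrable_fin_num (h2 k).
have f2 : L2 I f.
  apply/integrableP; split => //.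
  under eq_integral => x _ do rewrite gee0_abs ?lee_fin ?sqr_ge0//.
  by rewrite (le_lt_trans le)// ltry.
split=> //; rewrite -lee_fin /Rintegral fineK//; exact: integrable_fin_num f2.
Qed.

Lemma geometric_cauchy_cvg (a : nat -> R) c :
  (forall j k, (j <= k)%N -> `|a j - a k| <= c * 2^-1 ^+ j) -> cvgn a.
Proof.
move=> ac; apply/cauchy_cvgP/cauchy_ballP => e /= e0.
have c0 : 0 <= c.
  by have := ac 0%N 0%N (leqnn _); rewrite expr0 mulr1; exact: le_trans.
have := @cvg_geometric R (2 * c) 2^-1; rewrite /geometric/=.
have -> : `|2^-1 : R| < 1 by rewrite ger0_norm//; lra.
move=> /(_ erefl)/cvgrPdist_lt/(_ e e0)[N _ hN].
have := hN N (leqnn N); rewrite sub0r normrN => {}hN.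
exists ((fun n => a n) @` [set n | (N <= n)%N], (fun n => a n) @` [set n | (N <= n)%N]).
  by split; exists N => // n /= Nn; exists n.
move=> [_ _] /= [[j /= Nj <-] [k /= Nk <-]]; rewrite /ball/=.
have h1 := ac _ _ Nj; have h2 := ac _ _ Nk.
apply: le_lt_trans hN; rewrite [leRHS]ger0_norm; last by apply: mulr_ge0; [lra|rewrite exprn_ge0//; lra].
have -> : a j - a k = (a N - a k) - (a N - a j) by ring.
by apply: (le_trans (ler_normB _ _)); lra.
Qed.

(* The weights [4^j] make the pointwise series converge off a null set. *)
Lemma L2_complete I (g : nat -> R -> R) : measurable I ->
  (forall k, measurable_fun I (g k)) -> (forall k, L2 I (g k)) ->
  (forall j k, (j <= k)%N -> Rintegral mu I (fun x => (g j x - g k x) ^+ 2) <= 8^-1 ^+ j) ->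
  exists f, [/\ measurable_fun I f, L2 I f &
    forall j, Rintegral mu I (fun x => (g j x - f x) ^+ 2) <= 8^-1 ^+ j].
Proof.
move=> mI mg g2 gc.
have d2 j k : L2 I (fun x => g j x - g k x).
  rewrite (_ : (fun x => _) = (fun x => 1 * g j x + (-1) * g k x)); last first.
    by apply/funext => x; rewrite mul1r mulN1r.
  exact: L2_lincomb.
have md j k : measurable_fun I (fun x => g j x - g k x) by exact: measurable_funB.
pose w j x : \bar R := (4 ^+ j * (g j x - g j.+1 x) ^+ 2)%:E.
have mw j : measurable_fun I (w j).
  apply/measurable_EFinP; apply: measurable_funM; first exact: measurable_cst.
  exact: measurable_funX.
have w0 j x : (0 <= w j x)%E by rewrite lee_fin mulr_ge0 ?sqr_ge0// exprn_ge0.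
pose W x : \bar R := (\sum_(j <oo) w j x)%E.
have mW : measurable_fun I W by apply: ge0_emeasurable_sum.
have W0 x : (0 <= W x)%E by apply: nneseries_ge0.
have Wi : mu.-integrable I W.
  apply/integrableP; split => //.
  under eq_integral => x _ do rewrite gee0_abs//.
  rewrite /W integral_nneseries//.
  apply: (@le_lt_trans _ _ (\sum_(j <oo) (2^-1 ^+ j)%:E)%E).
    apply: lee_nneseries => [j _ _|j _]; first exact: integral_ge0.
    have := gc j j.+1 (leqnSn j).
    have -> : (\int[mu]_(x in I) w j x = (4 ^+ j * Rintegral mu I (fun x => (g j x - g j.+1 x) ^+ 2))%:E)%E.
      rewrite EFinM /Rintegral fineK; last exact: integrable_fin_num (d2 _ _).
      by rewrite -integralZl//; apply: d2.
    move=> h; rewrite lee_fin.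
    apply: (@le_trans _ _ (4 ^+ j * 8^-1 ^+ j)); first by rewrite ler_wpM2l// exprn_ge0.
    by rewrite -exprMn (_ : 4 / 8 = 2^-1 :> R)//; field.
  have := @cvg_geometric_series R 1 2^-1.
  have -> : `|2^-1 : R| < 1 by rewrite ger0_norm//; lra.
  move=> /(_ erefl) cv.
  have -> : (\sum_(j <oo) (2^-1 ^+ j)%:E = (1 / (1 - 2^-1))%:E :> \bar R)%E.
    apply/cvg_lim => //.
    have : (EFin \o series (geometric 1 2^-1)) n @[n --> \oo] --> (1 / (1 - 2^-1) : R)%:E.
      by apply: cvg_EFin; [exact: nearW|exact: cv].
    apply: cvg_trans; apply: near_eq_cvg; apply: nearW => n /=.
    by rewrite /series/= -sumEFin; apply: eq_bigr => i _; rewrite /geometric/= mul1r.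
  exact: ltry.
have [N [mN N0 NW]] := @integrable_ae _ _ _ mu I mI _ Wi.
pose D := ~` N.
have mD : measurable D by exact: measurableC.
(* Replacing the functions by 0 on the exceptional null set makes them converge at every point of
   [I]. *)
pose gt k : R -> R := g k \_ D.
have mgt k : measurable_fun I (gt k).
  by apply/measurable_restrict => //; apply: measurable_funS (mg k).
have gtE k x : gt k x = if x \in D then g k x else 0 by rewrite /gt patchE.
have cv x : I x -> cvgn (gt ^~ x).
  move=> Ix; have [xD|xD] := boolP (x \in D); last first.
    rewrite (_ : gt ^~ x = fun=> 0); first exact: is_cvg_cst.
    by apply/funext => k; rewrite gtE (negbTE xD).
  have Wx : W x \is a fin_num.
    apply: contrapT => nW; move: xD; rewrite inE; apply; apply: NW => /= h.
    exact/nW/h.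
  pose c := fine (W x).
  have c0 : 0 <= c by rewrite fine_ge0.
  have st j : `|g j x - g j.+1 x| <= (c + 1) * 2^-1 ^+ j.
    have : (w j x <= W x)%E.
      apply: le_trans (nneseries_lim_ge j.+1 _); last by move=> *; exact: w0.
      by rewrite big_nat_recr//= leeDr// sume_ge0.
    rewrite -(fineK Wx) -/c lee_fin => h.
    have c1 : 0 <= (c + 1) * 2^-1 ^+ j by rewrite mulr_ge0 ?exprn_ge0//; lra.
    rewrite -(@ler_pXn2r _ 2) ?nnegrE// real_normK ?num_real//.
    have p4 : 0 < 4 ^+ j :> R by rewrite exprn_gt0.
    rewrite -(ler_pM2l p4) (le_trans h)//.
    have -> : 4 ^+ j * ((c + 1) * 2^-1 ^+ j) ^+ 2 = (c + 1) ^+ 2.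
      have -> : 4 = 2 ^+ 2 :> R by ring.
      rewrite -exprM mulnC exprM exprVn.
      have : 2 ^+ j != 0 :> R by rewrite expf_neq0.
      by move: (2 ^+ j) => z z0; field.
    by clear -c0; nra.
  apply: (@geometric_cauchy_cvg _ (2 * (c + 1))) => j k jk.
  rewrite !gtE xD -(subnKC jk); elim: (k - j)%N => [|d IH].
    by rewrite addn0 subrr normr0 !mulr_ge0 ?exprn_ge0//; lra.
  (* The sharper bound by a difference of powers telescopes, so it survives the induction. *)
  suff : `|g j x - g (j + d.+1)%N x| <= 2 * (c + 1) * (2^-1 ^+ j - 2^-1 ^+ (j + d.+1)).
    move=> /le_trans; apply; rewrite ler_wpM2l//; first by lra.
    by rewrite gerBl exprn_ge0.
  move=> {IH}; elim: d.+1 => [|d' IH].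
    by rewrite addn0 subrr normr0 subrr mulr0 lexx.
  have := st (j + d')%N; rewrite addnS exprS => h.
  have -> : g j x - g (j + d').+1 x =
    (g j x - g (j + d')%N x) + (g (j + d')%N x - g (j + d').+1 x) by ring.
  apply: (le_trans (ler_normD _ _)).
  by move: h IH; move: (`|_|) (`|_|) (2^-1 ^+ j) (2^-1 ^+ (j + d')) (c + 1); clear; move=> *; lra.
pose f x := limn (gt ^~ x).
have cvf x : I x -> gt k x @[k --> \oo] --> f x by move=> /cv.
have mf : measurable_fun I f by exact: measurable_fun_cvg mgt cvf.
have L2gt k : L2 I (gt k).
  apply: le_integrable (g2 k) => //.
    apply/measurable_EFinP; apply: (@measurable_funX _ _ _ I (gt k) 2); exact: mgt.
  move=> x _ /=; rewrite lee_fin gtE; case: ifP => // _.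
  by rewrite expr0n/= normr0.
have key j : L2 I (fun x => gt j x - f x) /\
    Rintegral mu I (fun x => (gt j x - f x) ^+ 2) <= 8^-1 ^+ j.
  apply: (@L2_fatou I (fun k x => gt j x - gt (k + j)%N x)) => //.
  - by move=> k; exact: measurable_funB.
  - move=> k; rewrite (_ : (fun x => _) = (fun x => 1 * gt j x + (-1) * gt (k + j)%N x)); last first.
      by apply/funext => x; rewrite mul1r mulN1r.
    exact: L2_lincomb.
  - move=> x Ix; apply: cvgB; first exact: cvg_cst.
    by have := cvf x Ix; rewrite -(cvg_shiftn j).
  - move=> k; apply: le_trans (gc j (k + j)%N (leq_addl _ _)).
    apply: le_Rintegral => //; [|exact: d2|].
      have := L2_lincomb 1 (-1) mI (mgt j) (mgt (k + j)%N) (L2gt _) (L2gt _).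
      by apply: eq_integrable => // x _ /=; rewrite mul1r mulN1r.
    move=> x _; rewrite !gtE; case: ifP => // _.
    by rewrite subrr expr0n/= sqr_ge0.
exists f; split => //.
  have [k0 _] := key 0%N.
  have := L2_lincomb 1 (-1) mI (mgt 0%N) (measurable_funB (mgt 0%N) mf) (L2gt 0%N) k0.
  by apply: eq_integrable => // x _ /=; congr (_ ^+ 2)%:E; ring.
move=> j; have [k2 kj] := key j; apply: le_trans kj; rewrite le_eqVlt; apply/orP; left.
apply/eqP; congr fine; apply: ge0_ae_eq_integral => //.
- apply/measurable_EFinP; apply: (@measurable_funX _ _ _ I (fun x => g j x - f x) 2).
  exact: (measurable_funB (mg j) mf).
- apply/measurable_EFinP; apply: (@measurable_funX _ _ _ I (fun x => gt j x - f x) 2).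
  exact: (measurable_funB (mgt j) mf).
- by move=> x _; rewrite lee_fin sqr_ge0.
- by move=> x _; rewrite lee_fin sqr_ge0.
exists N; split => // x /= /not_implyP[Ix ne]; apply: contrapT => xN; apply: ne.
by rewrite gtE ifT// inE.
Qed.

End L2_completeness.

(** * Squared distances on the graph and continuity of mass and energy *)

Section star_distance.
Context {R : realType}.
Notation mu := (@lebesgue_measure R).
Notation H := (@halfline R).
Implicit Types (u g v h : 'I_3 -> R -> R) (I : set R) (p l m e t S : R).

Definition dist2 I (f k : R -> R) := Rintegral mu I (fun x => (f x - k x) ^+ 2).
Definition sdist l u v := \sum_(i < 3) dist2 (edge l i) (u i) (v i).

Lemma dist2_ge0 I f k : 0 <= dist2 I f k.
Proof. exact: Rintegral_sqr_ge0. Qed.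

Lemma sdist_ge0 l u v : 0 <= sdist l u v.
Proof. by apply: sumr_ge0 => i _; exact: dist2_ge0. Qed.

Lemma dist2_le_sdist l u v i : dist2 (edge l i) (u i) (v i) <= sdist l u v.
Proof. by rewrite /sdist (bigD1 i)//= lerDl sumr_ge0// => j _; exact: dist2_ge0. Qed.

Lemma dist2C I f k : dist2 I f k = dist2 I k f.
Proof. by apply: eq_Rintegral => x _; rewrite -sqrrN opprB. Qed.

Lemma L2_sub I f k : measurable I -> measurable_fun I f -> measurable_fun I k ->
  L2 I f -> L2 I k -> L2 I (fun x => f x - k x).
Proof.
move=> mI mf mk f2 k2; have := L2_lincomb 1 (-1) mI mf mk f2 k2.
by apply: eq_integrable => // x _ /=; rewrite mul1r mulN1r.
Qed.

Lemma dist2_parallelogram I f k : measurable I -> measurable_fun I f ->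
  measurable_fun I k -> L2 I f -> L2 I k ->
  Rintegral mu I (fun x => (2^-1 * f x + 2^-1 * k x) ^+ 2) =
  (Rintegral mu I (fun x => f x ^+ 2) + Rintegral mu I (fun x => k x ^+ 2)) / 2
  - dist2 I f k / 4.
Proof.
move=> mI mf mk f2 k2; rewrite (Rintegral_sqr_lincomb _ _ mI mf mk f2 k2).
have -> : dist2 I f k = Rintegral mu I (fun x => (1 * f x + (-1) * k x) ^+ 2).
  by apply: eq_Rintegral => x _; rewrite mul1r mulN1r.
rewrite (Rintegral_sqr_lincomb _ _ mI mf mk f2 k2).
by move: (Rintegral _ _ _) (Rintegral _ _ _) (Rintegral _ _ _) => A B C; clear; field.
Qed.

(** The triangle inequality for squared norms, with a weight [t] that is sent to 0 at the end. *)
Lemma dist2_triangle I f k t : measurable I -> measurable_fun I f ->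
  measurable_fun I k -> L2 I f -> L2 I k -> 0 < t ->
  Rintegral mu I (fun x => f x ^+ 2) <=
  (1 + t) * Rintegral mu I (fun x => k x ^+ 2) + (1 + t^-1) * dist2 I f k.
Proof.
move=> mI mf mk f2 k2 t0; have d2 := L2_sub mI mf mk f2 k2.
rewrite -(Rintegral_lincomb _ _ mI k2 d2); apply: le_Rintegral => //.
  exact: integrable_lincomb.
move=> x _; rewrite -subr_ge0.
have -> : (1 + t) * k x ^+ 2 + (1 + t^-1) * (f x - k x) ^+ 2 - f x ^+ 2 =
  (t * k x - (f x - k x)) ^+ 2 / t by clear -t0; field; lra.
by rewrite divr_ge0 ?sqr_ge0// ltW.
Qed.

(** By convexity of the power [p / 2], the integrand grows by at most [p / 2 * S^(p/2-1)] times
    [f ^+ 2 - k ^+ 2], and this is [(f - k) * (f + k)], split by a weighted Young inequality. *)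
Lemma pow_dist2 r p I f f' k k' S t : 2 < p -> is_edge r I -> H1pair I f f' -> H1pair I k k' ->
  (forall x, I x -> f x ^+ 2 <= S) -> (forall x, I x -> k x ^+ 2 <= S) -> 0 < t ->
  pow p I f <= pow p I k +
    p / 2 * S `^ (p / 2 - 1) * (2 * t * (mass I f + mass I k) + dist2 I f k / (4 * t)).
Proof.
move=> p2 eI ff kk fS kS t0; have [mI _ _ _] := eI.
have mf := H1_measurable eI ff; have mk := H1_measurable eI kk.
have [_ f2 _ _] := ff; have [_ k2 _ _] := kk.
have d2 := L2_sub mI mf mk f2 k2.
have wf := pow_integrable p2 eI ff; have wk := pow_integrable p2 eI kk.
pose C := p / 2 * S `^ (p / 2 - 1).
have C0 : 0 <= C by rewrite mulr_ge0 ?powR_ge0//; clear -p2; lra.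
have i1 := integrable_lincomb 1 1 mI f2 k2.
have i2 := integrable_lincomb (C * (2 * t)) (C / (4 * t)) mI i1 d2.
have := integrable_lincomb 1 1 mI wk i2 => i3.
have -> : pow p I k + C * (2 * t * (mass I f + mass I k) + dist2 I f k / (4 * t)) =
    Rintegral mu I (fun x => 1 * `|k x| `^ p + 1 * (C * (2 * t) * (1 * f x ^+ 2 + 1 * k x ^+ 2) +
      C / (4 * t) * (f x - k x) ^+ 2)).
  rewrite (Rintegral_lincomb 1 1 mI wk i2) (Rintegral_lincomb _ _ mI i1 d2).
  rewrite (Rintegral_lincomb 1 1 mI f2 k2) /pow /mass /dist2.
  move: (Rintegral _ _ _) (Rintegral _ _ _) (Rintegral _ _ _) (Rintegral _ _ _).
  by generalize C; clear -t0; move=> *; field; lra.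
apply: le_Rintegral => // x Ix; rewrite !mul1r.
have rhs0 : 0 <= C * (2 * t) * (f x ^+ 2 + k x ^+ 2) + C / (4 * t) * (f x - k x) ^+ 2.
  have t4 : 0 <= 4 * t by rewrite mulr_ge0// ltW.
  apply: addr_ge0; apply: mulr_ge0.
  - by rewrite mulr_ge0// mulr_ge0// ltW.
  - exact: addr_ge0 (sqr_ge0 _) (sqr_ge0 _).
  - exact: divr_ge0.
  - exact: sqr_ge0.
have ph : p = 2 * (p / 2) by field.
have pE z : `|z| `^ p = (z ^+ 2) `^ (p / 2) by rewrite {1}ph powR_sqr_norm.
rewrite !pE; have [fk|/ltW kf] := leP (f x ^+ 2) (k x ^+ 2).
  apply: (@le_trans _ _ ((k x ^+ 2) `^ (p / 2))); last by rewrite lerDl.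
  by apply: ge0_ler_powR; rewrite ?nnegrE ?sqr_ge0//; clear -p2; lra.
rewrite -lerBlDl.
have p1 : 1 < p / 2 by clear -p2; lra.
apply: (le_trans (powR_sub_le (sqr_ge0 _) kf p1)).
apply: (@le_trans _ _ (C * (f x ^+ 2 - k x ^+ 2))).
  rewrite ler_wpM2r ?subr_ge0// /C ler_pM2l; last by clear -p2; lra.
  by apply: ge0_ler_powR; rewrite ?nnegrE ?sqr_ge0 ?(le_trans (sqr_ge0 _) (fS x Ix))// ?fS//; clear -p1; lra.
rewrite [leRHS](_ : _ = C * (2 * t * (f x ^+ 2 + k x ^+ 2) + (f x - k x) ^+ 2 / (4 * t))); last first.
  by clear -t0; field; lra.
rewrite ler_wpM2l// -subr_ge0.
rewrite [leRHS](_ : _ = t * (f x - k x) ^+ 2 + (2 * t * (f x + k x) - (f x - k x)) ^+ 2 / (4 * t)); last first.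
  by clear -t0; field; lra.
by apply: addr_ge0; [rewrite mulr_ge0 ?sqr_ge0// ltW|rewrite divr_ge0 ?sqr_ge0// mulr_ge0// ltW].
Qed.

Lemma star_sub l u g v h : 0 < l -> star l u g -> star l v h ->
  star l (fun i x => u i x - v i x) (fun i x => g i x - h i x).
Proof.
move=> l0 ug vh; have := star_lincomb 1 (-1) l0 ug vh.
by congr star; apply/funext => i; apply/funext => x; rewrite mul1r mulN1r.
Qed.

Lemma star_fun l u g i : 0 < l -> star l u g ->
  [/\ measurable_fun (edge l i) (u i), L2 (edge l i) (u i),
      measurable_fun (edge l i) (g i) & L2 (edge l i) (g i)].
Proof.
move=> l0 [ug _]; have mu_ := H1_measurable (edge_half i l0) (ug i).
by have [] := ug i.
Qed.

Lemma smass_avg l u g v h : 0 < l -> star l u g -> star l v h ->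
  smass l (fun i x => 2^-1 * u i x + 2^-1 * v i x) =
  (smass l u + smass l v) / 2 - sdist l u v / 4.
Proof.
move=> l0 ug vh.
rewrite /smass /sdist -big_split/= !mulr_suml -sumrB; apply: eq_bigr => i _.
have [mu_ u2 _ _] := star_fun i l0 ug; have [mv v2 _ _] := star_fun i l0 vh.
by rewrite /mass (dist2_parallelogram (measurable_edge i l0) mu_ mv u2 v2).
Qed.

Lemma sgrad_avg l u g v h : 0 < l -> star l u g -> star l v h ->
  sgrad l (fun i x => 2^-1 * g i x + 2^-1 * h i x) =
  (sgrad l g + sgrad l h) / 2 - sdist l g h / 4.
Proof.
move=> l0 ug vh.
rewrite /sgrad /sdist -big_split/= !mulr_suml -sumrB; apply: eq_bigr => i _.
have [_ _ mu_ u2] := star_fun i l0 ug; have [_ _ mv v2] := star_fun i l0 vh.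
by rewrite /grad (dist2_parallelogram (measurable_edge i l0) mu_ mv u2 v2).
Qed.

Lemma smass_triangle l u g v h t : 0 < l -> star l u g -> star l v h -> 0 < t ->
  smass l u <= (1 + t) * smass l v + (1 + t^-1) * sdist l u v.
Proof.
move=> l0 ug vh t0; rewrite /smass /sdist !mulr_sumr -big_split/=; apply: ler_sum => i _.
have [mu_ u2 _ _] := star_fun i l0 ug; have [mv v2 _ _] := star_fun i l0 vh.
exact: dist2_triangle (measurable_edge i l0) mu_ mv u2 v2 t0.
Qed.

Lemma sgrad_triangle l u g v h t : 0 < l -> star l u g -> star l v h -> 0 < t ->
  sgrad l g <= (1 + t) * sgrad l h + (1 + t^-1) * sdist l g h.
Proof.
move=> l0 ug vh t0; rewrite /sgrad /sdist !mulr_sumr -big_split/=; apply: ler_sum => i _.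
have [_ _ mu_ u2] := star_fun i l0 ug; have [_ _ mv v2] := star_fun i l0 vh.
exact: dist2_triangle (measurable_edge i l0) mu_ mv u2 v2 t0.
Qed.

Lemma spow_sdist p l u g v h S t : 2 < p -> 0 < l -> star l u g -> star l v h ->
  (forall i x, edge l i x -> u i x ^+ 2 <= S) ->
  (forall i x, edge l i x -> v i x ^+ 2 <= S) -> 0 < t ->
  spow p l u <= spow p l v +
    p / 2 * S `^ (p / 2 - 1) * (2 * t * (smass l u + smass l v) + sdist l u v / (4 * t)).
Proof.
move=> p2 l0 [ug _] [vh _] uS vS t0.
rewrite /spow /smass /sdist -big_split/= !mulr_suml !mulr_sumr -big_split/= mulr_sumr -big_split/=.
apply: ler_sum => i _.
exact: pow_dist2 p2 (edge_half i l0) (ug i) (vh i) (uS i) (vS i) t0.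
Qed.

Lemma sdist_avg l u g v h : 0 < l -> star l u g -> star l v h ->
  sdist l u (fun i x => 2^-1 * u i x + 2^-1 * v i x) = sdist l u v / 4 /\
  sdist l v (fun i x => 2^-1 * u i x + 2^-1 * v i x) = sdist l u v / 4.
Proof.
have hD (A : R) : A / 4 = 2^-1 ^+ 2 * A by field.
move=> l0 ug vh; split; rewrite /sdist mulr_suml; apply: eq_bigr => i _;
  have [mu_ u2 _ _] := star_fun i l0 ug; have [mv v2 _ _] := star_fun i l0 vh;
  have d2 := L2_sub (measurable_edge i l0) mu_ mv u2 v2;
  have E := grad_scale 2^-1 (measurable_edge i l0) d2.
- by rewrite hD -[RHS]E; apply: eq_Rintegral => x _; congr (_ ^+ 2); field.
- rewrite hD -[RHS]E; apply: eq_Rintegral => x _; rewrite -sqrrN.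
  by congr (_ ^+ 2); field.
Qed.

Lemma star_sup_coercive p l m : 2 < p -> p < 6 -> 0 < l -> 0 < m ->
  exists B S, 0 <= B /\ forall u g, star l u g -> smass l u = m -> senergy p l u g <= 0 ->
    sgrad l g <= B /\ forall i x, edge l i x -> u i x ^+ 2 <= S.
Proof.
move=> p2 p6 l0 m0; have [B [B0 coer]] := sgrad_coercive p2 p6 l0 m0.
have l2 : 0 < l / 2 by clear -l0; lra.
exists B, (2 / (l / 2) * m + 2 * (l / 2) * B); split => // u g ug um uE.
have uB := coer _ _ ug um uE; split => // i x ix.
apply: (le_trans (star_sup l0 ug l2 (lexx _) ix)).
by rewrite um lerD2l ler_wpM2l// mulr_ge0// ltW.
Qed.

(* By the parallelogram law a near-minimizing pair that is close in [L2] has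
   close derivatives: otherwise the midpoint would beat the infimum. *)
Lemma near_minimizers_close p l m e n : energy_bound p l m e -> 0 < n ->
  exists d, 0 < d /\ forall u g v h, star l u g -> star l v h ->
    smass l u = m -> smass l v = m -> senergy p l u g < e + d -> senergy p l v h < e + d ->
    sdist l u v <= d -> sdist l g h <= n.
Proof.
move=> eb n0; have [p2 p6 l0 m0 [e0 _]] := eb.
have p0 : 0 < p by lra.
have [B [S [B0 coer]]] := star_sup_coercive p2 p6 l0 m0.
pose W := S `^ (p / 2 - 1) / 2.
have W0 : 0 <= W by rewrite divr_ge0 ?powR_ge0.
(* The midpoint saves an eighth of [sdist l g h] in energy, so errors come multiplied by 8. The
   terms [8 * d], [32 * m * W * t] and [W * d / (2 * t)] get [n / 3] each: first [t] is fixed, then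
   [d]. *)
pose t := n / (96 * m * (W + 1)).
have t0 : 0 < t by rewrite divr_gt0 ?mulr_gt0//; clear -W0; lra.
have tW : 32 * m * W * t <= n / 3.
  rewrite /t [leLHS](_ : _ = n / 3 * (W / (W + 1))); last first.
    by generalize W W0; clear -m0 => w w0; field; lra.
  rewrite ler_piMr ?divr_ge0 ?(ltW n0)// ler_pdivrMr; clear -W0; lra.
pose d := Num.min (Num.min (n / 24) (2 * t * n / (3 * (W + 1)))) (- e).
have d0 : 0 < d.
  rewrite !lt_min; apply/andP; split; last by clear -e0; lra.
  apply/andP; split; first by clear -n0; lra.
  apply: divr_gt0; first by rewrite mulr_gt0// mulr_gt0.
  by clear -W0; lra.
have dn : 8 * d <= n / 3.
  have : d <= n / 24 by rewrite !ge_min lexx.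
  by generalize d; clear; move=> *; lra.
have dt : W * d / (2 * t) <= n / 3.
  have : d <= 2 * t * n / (3 * (W + 1)) by rewrite !ge_min lexx !orbT.
  rewrite ler_pdivlMr; last by clear -W0; lra.
  move=> h; rewrite ler_pdivrMr; last by rewrite mulr_gt0.
  by move: h d0; generalize d t; clear; move=> *; lra.
have de : d <= - e by rewrite !ge_min lexx !orbT.
exists d; split => // u g v h ug vh um vm uE vE uv.
have uE0 : senergy p l u g <= 0 by apply: (le_trans (ltW uE)); clear -de; lra.
have vE0 : senergy p l v h <= 0 by apply: (le_trans (ltW vE)); clear -de; lra.
have [_ uS] := coer _ _ ug um uE0; have [_ vS] := coer _ _ vh vm vE0.
have av := star_lincomb 2^-1 2^-1 l0 ug vh.
set a := (fun i x => _) in av; set b := (fun i x => _) in av.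
have aS i x : edge l i x -> a i x ^+ 2 <= S.
  move=> ix; have := uS i x ix; have := vS i x ix; rewrite /a.
  move: (u i x) (v i x) => y z h1 h2.
  have := sqr_ge0 (y - z).
  rewrite (_ : (2^-1 * y + 2^-1 * z) ^+ 2 = (y ^+ 2 + z ^+ 2) / 2 - (y - z) ^+ 2 / 4).
    by move: (y ^+ 2) (z ^+ 2) ((y - z) ^+ 2) h1 h2; generalize S; clear; move=> *; lra.
  by clear; field.
have am := smass_avg l0 ug vh; rewrite um vm -/a in am.
have ag := sgrad_avg l0 ug vh; rewrite -/b in ag.
have [ua va] := sdist_avg l0 ug vh; rewrite -/a in ua va.
have D0 := sdist_ge0 l u v.
have amm : smass l a <= m by rewrite am; move: (sdist l u v) D0; clear; move=> *; lra.
have := senergy_lower_bound eb av amm m0 (lexx m).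
rewrite (divff (lt0r_neq0 m0)) powR1 subrr !mul0r addr0 => aE.
(* The midpoint may have mass below [m], but its share of the negative [e] is still at least [e]. *)
have {}aE : e <= senergy p l a b.
  apply: le_trans aE; rewrite -[leLHS]mul1r; apply: ler_wnM2r; first exact: ltW.
  by rewrite ler_pdivrMr// mul1r.
have Pu := spow_sdist p2 l0 ug av uS aS t0.
have Pv := spow_sdist p2 l0 vh av vS aS t0.
rewrite um ua -/(W) in Pu; rewrite vm va -/(W) in Pv.
have WE : p / 2 * S `^ (p / 2 - 1) = p * W by rewrite /W; clear; field.
rewrite WE in Pu Pv.
have Q0 : p * W * (2 * t * (m + smass l a) + sdist l u v / 4 / (4 * t)) <=
    p * (W * t * 4 * m + W * d / (16 * t)).
  rewrite -mulrA ler_pM2l// mulrDr; apply: lerD.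
    have : 0 <= W * t by rewrite mulr_ge0// ltW.
    move: amm; move: (smass l a) => M hM hz.
    have -> : W * (2 * t * (m + M)) = (W * t) * (2 * (m + M)) by ring.
    by rewrite -[leRHS]mulrA; apply: ler_wpM2l => //; clear -hM; lra.
  have t16 : 0 < 16 * t by rewrite mulr_gt0.
  have -> : W * (sdist l u v / 4 / (4 * t)) = W * sdist l u v / (16 * t).
    by move: (sdist l u v); generalize W; clear -t0; move=> *; field; lra.
  by rewrite ler_pM2r ?invr_gt0// ler_wpM2l.
move: aE uE vE; rewrite /senergy ag.
have := le_trans Pu (lerD (lexx _) Q0); have := le_trans Pv (lerD (lexx _) Q0).
rewrite -(@ler_pM2l _ p^-1) ?invr_gt0// mulrDr mulKf ?gt_eqF// => H1.
rewrite -(@ler_pM2l _ p^-1) ?invr_gt0// mulrDr mulKf ?gt_eqF// => H2.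
move: dt tW; rewrite (_ : W * d / (2 * t) = 8 * (W * d / (16 * t))); last by clear -t0; field; lra.
rewrite (_ : 32 * m * W * t = 8 * (W * t * 4 * m)); last by clear; ring.
move: H1 H2; generalize (W * d / (16 * t)) (W * t * 4 * m).
move: (p^-1 * spow p l u) (p^-1 * spow p l v) (p^-1 * spow p l a).
move: (sdist l g h) (sgrad l g) (sgrad l h) dn; generalize d.
by clear; move=> *; lra.
Qed.


(** The finite-net step of a Rellich argument: under a common bound on the derivatives, Hölder
    continuity lets finitely many values control the distance on [[0, T]]. *)
Lemma grid_close (B T n : R) : 0 <= B -> 0 < T -> 0 < n -> exists (N : nat) d, 0 < d /\
  forall f f' k k' : R -> R, H1pair `[0, T] f f' -> H1pair `[0, T] k k' ->
  grad `[0, T] f' <= B -> grad `[0, T] k' <= B ->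
  (forall j : nat, (j <= N)%N -> (f (j%:R * (T / N%:R)) - k (j%:R * (T / N%:R))) ^+ 2 <= d) ->
  dist2 `[0, T] f k <= n.
Proof.
move=> B0 T0 n0.
(* With more than [b] cells, each function moves by at most [n / (12 * T)] in square within a cell.
   Together with [n / (6 * T)] at the grid point and the factor 3 for a sum of three squares, this
   gives [n / T]. *)
pose b := 12 * T ^+ 2 * B / n.
have b0 : 0 <= b by rewrite divr_ge0 ?mulr_ge0 ?sqr_ge0// ltW.
pose N := (Num.truncn b).+1.
have bN : b < N%:R by exact: truncnS_gt.
have N0 : 0 < N%:R :> R by rewrite ltr0n.
pose w := T / N%:R; have w0 : 0 < w by rewrite divr_gt0.
have wB : w * B <= n / (12 * T).
  rewrite ler_pdivlMr; last by clear -T0; lra.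
  rewrite /w (_ : T / N%:R * B * (12 * T) = (b * n) / N%:R); last first.
    by rewrite /b; clear -N0 n0; field; rewrite !gt_eqF.
  by rewrite ler_pdivrMr// mulrC ler_pM2l// ltW.
exists N, (n / (6 * T)); split; first by rewrite divr_gt0//; clear -T0; lra.
move=> f f' k k' ff kk fB kB fk.
have eP : is_edge (T / 2) `[0, T] by apply: (@pendant_edge R (T / 2) T); clear -T0; lra.
have mf := H1_measurable eP ff; have mk := H1_measurable eP kk.
have [_ f2 _ _] := ff; have [_ k2 _ _] := kk.
have -> : n = Rintegral mu `[0, T] (fun=> n / T).
  by rewrite Rintegral_cst_itv ?ltW// subr0 mulfVK// gt_eqF.
apply: le_Rintegral => //; [exact: L2_sub|exact: integrable_cst_itv|].
move=> x xI; have := xI; rewrite /= in_itv/= => /andP[x0 xT].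
pose j := Num.truncn (x / w).
have xw : 0 <= x / w by rewrite divr_ge0// ltW.
have jx : j%:R * w <= x by rewrite -ler_pdivlMr// truncn_le.
have xj : x < j.+1%:R * w by rewrite -ltr_pdivrMr// truncnS_gt.
have jN : (j <= N)%N.
  rewrite -(ler_nat R) -(ler_pM2r w0) (le_trans jx)// (le_trans xT)//.
  by rewrite /w mulrC mulfVK// gt_eqF.
pose y := j%:R * w.
have y0 : 0 <= y by rewrite mulr_ge0// ltW.
have yI : `[0, T]%classic y by rewrite /= in_itv/= y0 (le_trans jx).
have yx : x - y <= w.
  by move: xj; rewrite -natr1 mulrDl mul1r -/y => /ltW; clear; lra.
have h1 := H1_holder eP ff yI xI jx.
have h2 := H1_holder eP kk yI xI jx.
have h3 := fk j jN; rewrite -/w -/y in h3.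
have g1 : (x - y) * grad `[0, T] f' <= n / (12 * T).
  by apply: le_trans wB; apply: ler_pM => //; [rewrite subr_ge0|exact: grad_ge0].
have g2 : (x - y) * grad `[0, T] k' <= n / (12 * T).
  by apply: le_trans wB; apply: ler_pM => //; [rewrite subr_ge0|exact: grad_ge0].
have nT : n / T = 3 * (2 * (n / (12 * T)) + n / (6 * T)) by clear -T0; field; lra.
rewrite nT; move: (le_trans h1 g1) (le_trans h2 g2) h3.
move: (n / (12 * T)) (n / (6 * T)) (f x) (f y) (k x) (k y); clear => A D fx fy kx ky a1 a2 a3.
have := sqr_ge0 ((fx - fy) - (fy - ky)); have := sqr_ge0 ((fx - fy) + (kx - ky)).
have := sqr_ge0 ((fy - ky) + (kx - ky)).
by nra.
Qed.

End star_distance.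

(** * The graph beats every function on the line *)

Section strict_inequality.
Context {R : realType}.
Notation mu := (@lebesgue_measure R).
Notation H := (@halfline R).
Implicit Types (f g : R -> R) (p l m e c d h s : R).

Lemma line_halves p m (f g : R -> R) : 2 < p -> H1mu_line m f g ->
  exists f1 g1 f2 g2, [/\ H1pair H f1 g1, H1pair H f2 g2, f1 0 = f2 0,
    mass H f1 + mass H f2 = m &
    energy p H f1 g1 + energy p H f2 g2 = energy p [set: R] f g].
Proof.
move=> p2 [fg fm].
have n1 : -1 != 0 :> R by rewrite oppr_eq0 oner_neq0.
have pre : affine (-1) 0 @^-1` `]-oo, 0]%classic = H.
  by apply/seteqP; split => x; rewrite /halfline/= !in_itv/= ?andbT /affine; lra.
have mN : measurable (`]-oo, 0]%classic : set R) by exact: measurable_itv.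
have split F : mu.-integrable [set: R] (EFin \o F) ->
    Rintegral mu [set: R] F = Rintegral mu H F + Rintegral mu H (F \o affine (-1) 0).
  move=> Fi; have FN : mu.-integrable `]-oo, 0]%classic (EFin \o F).
    exact: integrableS Fi.
  have := Rintegral_affine 0 n1 mN FN; rewrite pre normrN normr1 invr1 mul1r => ->.
  rewrite -set_itvNyy in Fi *.
  by rewrite (Rintegral_split (c := 0) Fi)// addrC.
have [_ f2 g2 _] := fg.
have w := pow_integrable p2 (@setT_edge R 1 ltr01) fg.
have h2 := H1_affine 0 n1 mN (H1_subset measurableT mN (@subsetT _ _) fg).
rewrite pre in h2.
exists f, g, (f \o affine (-1) 0), (fun x => -1 * g (affine (-1) 0 x)); split => //.
- exact: H1_subset measurableT _ (@subsetT _ _) fg.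
- by rewrite /= /affine mulr0 addr0.
- by rewrite -fm /mass (split _ f2).
- rewrite !energyE.
  have -> : grad [set: R] g = grad H g + grad H (fun x => -1 * g (affine (-1) 0 x)).
    rewrite /grad (split _ g2); congr (_ + _); apply: eq_Rintegral => x _ /=.
    by rewrite mulN1r sqrrN.
  have -> : pow p [set: R] f = pow p H f + pow p H (f \o affine (-1) 0) by exact: split.
  by move: (pow _ _ _) (pow _ _ _) (grad _ _) (grad _ _); clear; move=> *; ring.
Qed.

(* Shorten the plateau and use the freed mass for a small bump on it. To first
   order the mass [d c^2] saved costs [d c^p / p] but yields [d c^p / 2]. *)
Lemma plateau_improvement p f g c h : 2 < p -> 0 < c -> 0 < h -> H1pair H f g ->
  (forall x, 0 <= x <= h + h -> f x = c) -> grad `[0, h + h] g = 0 ->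
  exists f' g', [/\ H1pair H f' g', mass H f' = mass H f &
    energy p H f' g' < energy p H f g].
Proof.
move=> p2 c0 h0 fg fc g0.
have p0 : 0 < p by lra.
pose D := c `^ p; have D0 : 0 < D by rewrite powR_gt0.
have hh : 0 <= h by exact: ltW.
have mline a b : measurable_fun `[0, h] (fun x : R => a * x + b) by exact: measurable_affine.
have L2line a b : L2 `[0, h] (fun x : R => a * x + b) by have [] := H1_line a b hh.
have L2c : L2 `[0, h] (fun=> c : R) by exact: (integrable_cst_itv 0 h (c ^+ 2)).
have mc : measurable_fun `[0, h] (fun=> c : R) by exact: measurable_cst.
pose y x := (-1) * x + h.
have iJ := integrable_sqr_mul (measurable_itv _) mc (mline (-1) h) L2c (L2line (-1) h).
pose J := Rintegral mu `[0, h] (fun x => c * y x).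
pose Q := Rintegral mu `[0, h] (fun x => y x ^+ 2).
have Q0 : 0 <= Q by exact: Rintegral_sqr_ge0.
have J0 : 0 < J.
  apply: (@lt_le_trans _ _ (Rintegral mu `[0, h / 2] (fun=> c * (h / 2)))).
    by rewrite Rintegral_cst_itv; [rewrite subr0 !mulr_gt0//; lra|lra].
  have sub : `[0, h / 2] `<=` `[0, h] by move=> x /=; rewrite !in_itv/=; lra.
  apply: (@le_trans _ _ (Rintegral mu `[0, h / 2] (fun x => c * y x))).
    apply: le_Rintegral => //; first exact: integrable_cst_itv.
      exact: integrableS iJ.
    by move=> x /=; rewrite in_itv/= => xh; rewrite ler_pM2l// /y; lra.
  apply: ge0_Rintegral_subset => // x /=; rewrite in_itv/= => xh.
  by rewrite mulr_ge0 ?(ltW c0)// /y; clear -xh; lra.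
pose z := 2 * J + Q.
have z0 : 0 < z by rewrite /z; clear -J0 Q0; lra.
have B0 : 0 < h / 2 + D * Q / (p * c ^+ 2).
  apply: ltr_wpDr; last by clear -h0; lra.
  by rewrite divr_ge0 ?mulr_ge0 ?(ltW p0) ?(ltW D0) ?(ltW c0)// sqr_ge0.
(* A bump of slope [s] will gain at least [s * (A0 - s * (h / 2 + D * Q / (p * c ^+ 2)))]; the
   linear coefficient is positive because [p > 2]. *)
pose A0 := D / c ^+ 2 * J * (1 - 2 / p).
have A00 : 0 < A0.
  have q1 : 0 < 1 - 2 / p by rewrite subr_gt0 ltr_pdivrMr// mul1r.
  have c20 : 0 < c ^+ 2 by rewrite exprn_gt0.
  by rewrite /A0 mulr_gt0// mulr_gt0// divr_gt0.
(* The first two bounds ensure [d <= h], the third keeps the quadratic cost below [A0]. *)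
pose s := Num.min 1 (Num.min (h * c ^+ 2 / z) (A0 / (2 * (h / 2 + D * Q / (p * c ^+ 2))))).
have s0 : 0 < s.
  rewrite !lt_min ltr01/=; apply/andP; split.
    by rewrite divr_gt0// mulr_gt0// exprn_gt0.
  by rewrite divr_gt0// mulr_gt0.
have s1 : s <= 1 by rewrite ge_min lexx.
have sz : s * z <= h * c ^+ 2.
  by rewrite -ler_pdivlMr// !ge_min lexx !orbT.
have sA : s * (h / 2 + D * Q / (p * c ^+ 2)) < A0.
  apply: (@le_lt_trans _ _ (A0 / 2)); last by clear -A00; lra.
  have : s <= A0 / (2 * (h / 2 + D * Q / (p * c ^+ 2))) by rewrite !ge_min lexx !orbT.
  rewrite ler_pdivlMr; last by rewrite mulr_gt0.
  by move: (h / 2 + _) => Z; generalize A0 s; clear; move=> *; lra.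
(* The length of plateau whose mass equals what the bump adds. *)
pose d := (2 * s * J + s ^+ 2 * Q) / c ^+ 2.
have c20 : 0 < c ^+ 2 by rewrite exprn_gt0.
have d0 : 0 <= d.
  apply: divr_ge0; last exact: ltW.
  apply: addr_ge0; first by rewrite mulr_ge0 ?(ltW J0)// mulr_ge0// ltW.
  by rewrite mulr_ge0// sqr_ge0.
have dh : d <= h.
  rewrite ler_pdivrMr// (le_trans _ sz)// /z -subr_ge0.
  rewrite (_ : _ - _ = s * ((1 - s) * Q)); last by ring.
  by rewrite mulr_ge0 ?(ltW s0)// mulr_ge0// subr_ge0.
have T0 : 0 <= h + d by rewrite addr_ge0.
have hs := H1_shift T0 fg.
have hl := H1_line (- s) (c + s * h) hh.
(* The plateau piece [[0, h + d]] is replaced by one of length [h] descending from [c + s * h] to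
   [c]; beyond it [f] continues, still at height [c]. *)
pose f' := hglue h (fun x => - s * x + (c + s * h)) (hshift (h + d) f).
pose g' := hglue h (fun=> - s) (hshift (h + d) g).
have hf' : H1pair H f' g'.
  apply: H1_hglue => //; rewrite /hshift add0r fc; first by ring.
  by apply/andP; split; [exact: T0|rewrite lerD2l].
have [_ f2 gg2 _] := fg; have [_ l2 lg2 _] := hl; have [_ s2 sg2 _] := hs.
have eH := @halfline_edge R 1 ltr01.
have w := pow_integrable p2 eH fg; have ws := pow_integrable p2 eH hs.
have [_ sm] := Rintegral_shift T0 f2.
have [_ sg] := Rintegral_shift T0 gg2.
have [_ sp] := Rintegral_shift T0 w.
have eP : is_edge (h / 2) `[0, h].
  by apply: (@pendant_edge R (h / 2) h); clear -h0; lra.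
have wl := pow_integrable p2 eP hl.
have lmE : Rintegral mu `[0, h] (fun x => (- s * x + (c + s * h)) ^+ 2) =
    c ^+ 2 * h + 2 * s * J + s ^+ 2 * Q.
  rewrite (_ : (fun x => _) = (fun x => (1 * c + s * y x) ^+ 2)); last first.
    by apply/funext => x; congr (_ ^+ 2); rewrite /y; ring.
  rewrite (Rintegral_sqr_lincomb 1 s (measurable_itv _) mc (mline (-1) h) L2c (L2line (-1) h)).
  by rewrite Rintegral_cst_itv// subr0 -/J -/Q; ring.
have fin : {in `[0, h + d]%classic, f =1 fun=> c}.
  move=> x; rewrite inE/= in_itv/= => /andP[x0 xd]; apply: fc.
  by rewrite x0 (le_trans xd)// lerD2l.
have fmE : Rintegral mu `[0, h + d] (fun x => f x ^+ 2) = c ^+ 2 * (h + d).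
  rewrite (@eq_Rintegral _ _ _ mu _ (fun=> c ^+ 2)) ?Rintegral_cst_itv ?subr0//.
  by move=> x xI; rewrite /= fin.
have fpE : Rintegral mu `[0, h + d] (fun x => `|f x| `^ p) = D * (h + d).
  rewrite (@eq_Rintegral _ _ _ mu _ (fun=> D)) ?Rintegral_cst_itv ?subr0//.
  by move=> x xI; rewrite /= fin// ger0_norm// ltW.
have fgE : Rintegral mu `[0, h + d] (fun x => g x ^+ 2) = 0.
  apply/eqP; rewrite eq_le Rintegral_sqr_ge0 andbT -[leRHS]g0.
  apply: ge0_Rintegral_subset => //.
  - by move=> x /=; rewrite !in_itv/= => /andP[-> xd]; rewrite (le_trans xd)// lerD2l.
  - by apply: integrableS gg2 => //; exact: itv_sub_halfline.
  - by move=> x _; exact: sqr_ge0.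
have lpE : D * h + p * D / c ^+ 2 * s * J <= pow p `[0, h] (fun x => - s * x + (c + s * h)).
  have iD : mu.-integrable `[0, h] (EFin \o (fun=> D : R)) by exact: integrable_cst_itv.
  have -> : D * h + p * D / c ^+ 2 * s * J =
      Rintegral mu `[0, h] (fun x => 1 * D + (p * D / c ^+ 2 * s) * (c * y x)).
    rewrite (Rintegral_lincomb 1 (p * D / c ^+ 2 * s) (measurable_itv _) iD iJ).
    by rewrite Rintegral_cst_itv// subr0 mul1r.
  apply: le_Rintegral => //; first exact: integrable_lincomb.
  move=> x /=; rewrite in_itv/= => /andP[x0 xh].
  have yx : 0 <= y x by rewrite /y; clear -xh; lra.
  have syc : 0 <= s * y x / c.
    by apply: divr_ge0; [apply: mulr_ge0 => //; exact: ltW|exact: ltW].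
  have -> : - s * x + (c + s * h) = c * (1 + s * y x / c).
    by rewrite /y; clear -c0; field; lra.
  have c1 : 0 <= 1 + s * y x / c by rewrite addr_ge0.
  rewrite ger0_norm; last by rewrite mulr_ge0// ltW.
  rewrite (powRM _ (ltW c0) c1) -/D.
  have p1 : 1 < p by clear -p2; lra.
  have := bernoulli_powR c1 p1; rewrite -(ler_pM2l D0) => /(le_trans _); apply.
  rewrite le_eqVlt; apply/orP; left; apply/eqP.
  by clear -c0; field; lra.
exists f', g'; split => //.
- rewrite /mass [LHS](@Rintegral_hglue _ h (fun x => x ^+ 2) _ _ hh l2 s2) sm.
  have -> : Rintegral mu `[0, h] ((fun x => x ^+ 2) \o (fun x => - s * x + (c + s * h))) =
    c ^+ 2 * h + 2 * s * J + s ^+ 2 * Q by exact: lmE.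
  rewrite fmE; congr (_ + _).
  by rewrite /d; clear -c0; field; lra.
rewrite !energyE.
have -> : grad H g' = s ^+ 2 * h + grad H (hshift (h + d) g).
  rewrite /grad [LHS](@Rintegral_hglue _ h (fun x => x ^+ 2) _ _ hh lg2 sg2); congr (_ + _).
  by rewrite [LHS](@Rintegral_cst_itv _ 0 h ((- s) ^+ 2) hh) subr0 sqrrN.
have -> : pow p H f' = pow p `[0, h] (fun x => - s * x + (c + s * h)) + pow p H (hshift (h + d) f).
  exact: (@Rintegral_hglue _ h (fun x => `|x| `^ p) _ _ hh wl ws).
have -> : grad H g = grad H (hshift (h + d) g) by rewrite {1}/grad sg fgE add0r.
have -> : pow p H f = D * (h + d) + pow p H (hshift (h + d) f) by rewrite {1}/pow sp fpE.
move: lpE; move: (pow p `[0, h] _) (pow p H _) (grad H _) => A P G lpE.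
apply: (@le_lt_trans _ _ (2^-1 * (s ^+ 2 * h + G) - p^-1 * (D * h + p * D / c ^+ 2 * s * J + P))).
  by rewrite lerD2l lerN2 ler_pM2l ?invr_gt0// lerD2r.
rewrite -subr_gt0.
have -> : 2^-1 * G - p^-1 * (D * (h + d) + P) -
  (2^-1 * (s ^+ 2 * h + G) - p^-1 * (D * h + p * D / c ^+ 2 * s * J + P)) =
  s * (A0 - s * (h / 2 + D * Q / (p * c ^+ 2))).
  by rewrite /A0 /d; clear -p2 c0; field; lra.
by rewrite mulr_gt0// subr_gt0.
Qed.

Lemma line_energy_gt p l m (f g : R -> R) : 2 < p -> p < 6 -> 0 < m -> 0 < l ->
  H1mu_line m f g ->
  exists v w, [/\ star l v w, smass l v = m & senergy p l v w < energy p [set: R] f g].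
Proof.
move=> p2 p6 m0 l0 fgm; apply: contrapT => nex.
set e := energy p [set: R] f g in nex *.
have lb v w : star l v w -> smass l v = m -> e <= senergy p l v w.
  by move=> vw vm; rewrite leNgt; apply/negP => lt; apply: nex; exists v, w.
have [v0 [h0 [vh0 vm0 vE0]]] := exists_negative_energy p2 p6 l0 m0.
have e0 : e < 0 by exact: le_lt_trans (lb _ _ vh0 vm0) vE0.
have eb : energy_bound p l m e by [].
have [f1 [g1 [f2 [g2 [h1 h2 e12 m12 E12]]]]] := line_halves p2 fgm.
have m12' : 0 < mass H f1 + mass H f2 by rewrite m12.
have {f1 g1 f2 g2 h1 h2 e12 E12 m12 m12' } [F [G [FG Fm FE]]] : exists F G, [/\ H1pair H F G,
    mass H F = m / 2 & 2 * energy p H F G <= e].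
  have [F [G [FG Fm FE]]] := median_reflection p2 h1 h2 e12 m12'.
  exists F, G; split; [exact: FG|by rewrite Fm m12|].
  by rewrite /e -E12; exact: FE.
(* Every profile of half the mass can be transplanted, so [F] is optimal among them and has no
   kinetic energy on [[0, l / 2]]. *)
have best F' G' : H1pair H F' G' -> mass H F' = m / 2 ->
    e + 3 / 4 * grad `[0, l / 2] G' <= 2 * energy p H F' G'.
  move=> FG' Fm'; have [w wm wE] := transplantP p2 l0 FG'.
  have := lb _ _ w; rewrite wm Fm' wE (_ : 2 * (m / 2) = m); last by field.
  by move=> /(_ erefl); move: (energy _ _ _ _) (grad _ _); clear; move=> *; lra.
have G0 : grad `[0, l / 2] G = 0.
  have := best _ _ FG Fm; have := grad_ge0 `[0, l / 2] G.
  by move: (grad _ _) (energy _ _ _ _) FE; clear; move=> *; lra.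
have FE' : 2 * energy p H F G = e.
  have := best _ _ FG Fm; rewrite G0.
  by move: (energy _ _ _ _) FE; clear; move=> *; lra.
have Fc x : 0 <= x <= l / 2 -> F x = F 0.
  move=> /andP[x0 xl].
  have eP : is_edge (l / 4) `[0, l / 2] by apply: (@pendant_edge R (l / 4) (l / 2)); lra.
  have FG' : H1pair `[0, l / 2] F G by apply: H1_subset FG => //; exact: itv_sub_halfline.
  have := H1_holder (x := 0) (y := x) eP FG'; rewrite G0 mulr0 /= !in_itv/= lexx x0 xl.
  have -> : 0 <= l / 2 by lra.
  move=> /(_ erefl erefl erefl) h; apply/eqP; rewrite -subr_eq0 -sqrf_eq0.
  by rewrite eq_le h sqr_ge0.
(* If [F] vanishes at 0, completing it to the graph is free, and mass [m / 2] has a surplus with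
   factor [2^(p/2-1) - 1]. This contradicts [2 * energy p H F G = e]. *)
have [F0|F0] := eqVneq (F 0) 0.
  have M0 : 0 < m / 2 by lra.
  have Mm : m / 2 <= m by lra.
  have := halfline_lower_bound eb FG (M := m / 2).
  rewrite F0 expr0n/= mul0r addr0 Fm => /(_ (lexx _) M0 Mm).
  rewrite (_ : m / (m / 2) = 2); last by field; lra.
  have q1 : 0 < 2 `^ (p / 2 - 1) - 1 :> R.
    rewrite subr_gt0 -[ltLHS](congr1 (@^~ (p / 2 - 1)) (@powR1 R)).
    by apply: gt0_ltr_powR; rewrite ?nnegrE//; lra.
  have Pp : 0 < pow p H F / p.
    have := energy_ge_pow p H F G.
    by move: (energy _ _ _ _) (_ / p) FE' e0; clear; move=> *; lra.
  have := mulr_gt0 q1 Pp; rewrite mulrA.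
  rewrite (_ : m / 2 / m * e = e / 2); last by field; lra.
  by move: (energy _ _ _ _) (_ / p) FE'; clear; move=> *; lra.
(* Up to a change of sign the plateau is positive. *)
have [F' [G' [FG' Fm' FE'' Fc' Fp]]] : exists F' G', [/\ H1pair H F' G', mass H F' = m / 2,
    2 * energy p H F' G' = e /\ grad `[0, l / 2] G' = 0,
    (forall x, 0 <= x <= l / 2 -> F' x = F' 0) & 0 < F' 0].
  have [Fp|Fn] := ltP 0 (F 0); first by exists F, G; split.
  have {}Fn : F 0 < 0 by rewrite lt_neqAle F0.
  have eH := @halfline_edge R 1 ltr01.
  have [_ F2 G2 _] := FG.
  have [mH _ _ _] := eH.
  exists (fun x => -1 * F x), (fun x => -1 * G x); split.
  - exact: H1_scale eH FG.
  - by rewrite mass_scale// sqrrN expr1n mul1r.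
  - split.
      rewrite -FE' !energyE (grad_scale (-1) mH G2) sqrrN expr1n mul1r; congr (_ * (_ - _ * _)).
      by apply: eq_Rintegral => x _; rewrite mulN1r normrN.
    by rewrite -[RHS]G0; apply: eq_Rintegral => x _; rewrite mulN1r sqrrN.
  - by move=> x xl; rewrite Fc.
  - by rewrite mulN1r oppr_gt0.
have [FE3 G0'] := FE''.
have l4 : 0 < l / 4 by clear -l0; lra.
have ll : l / 4 + l / 4 = l / 2 by field.
rewrite -ll in Fc' G0'.
have [K [L [KL Km KE]]] := plateau_improvement p2 Fp l4 FG' Fc' G0'.
have := best _ _ KL; rewrite Km => /(_ Fm'); have := grad_ge0 `[0, l / 2] L.
by move: (energy p H F' _) (energy _ _ _ _) (grad _ _) KE FE3; clear; move=> *; lra.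
Qed.

End strict_inequality.

(** * Compactness along an ultrafilter *)

Section existence.
Context {R : realType}.
Notation mu := (@lebesgue_measure R).
Notation H := (@halfline R).
Notation o0 := (ord0 : 'I_3).
Notation o1 := (lift ord0 ord0 : 'I_3).
Notation o2 := (ord_max : 'I_3).

(** Of finitely many intervals of length [w] that cover the values, an ultrafilter selects one; the
    induction peels off the first. *)
Lemma ultra_pigeonhole (U : set_system nat) (a : nat -> R) (lo w : R) (N : nat) :
  UltraFilter U -> 0 <= w -> U [set n | lo <= a n <= lo + w *+ N] ->
  exists c, U [set n | c <= a n <= c + w].
Proof.
move=> UU w0; elim: N lo => [|N IH] lo hU.
  exists lo; apply: filterS hU => n /= /andP[-> h] /=.
  by rewrite (le_trans h)// mulr0n lerD2l.
have [h|h] := in_ultra_setVsetC [set n | a n <= lo + w] UU.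
  by exists lo; apply: filterS (filterI hU h) => n /= [/andP[-> _] ->].
apply: (IH (lo + w)); apply: filterS (filterI hU h) => n /= [/andP[_ h1] /negP].
by rewrite -ltNge => /ltW -> /=; rewrite -addrA -mulrS.
Qed.

(** Bolzano-Weierstrass with one ultrafilter for all points and edges, which takes the place of a
    diagonal extraction. *)
Lemma ultra_close (U : set_system nat) (a : nat -> R) (S d : R) : UltraFilter U ->
  (forall n, a n ^+ 2 <= S) -> 0 < d ->
  exists A, U A /\ forall n k, A n -> A k -> (a n - a k) ^+ 2 <= d.
Proof.
move=> UU aS d0; have S0 : 0 <= S by exact: le_trans (sqr_ge0 _) (aS 0%N).
pose w := Num.sqrt d; have w0 : 0 < w by rewrite sqrtr_gt0.
pose N := (Num.truncn (2 * (S + 1) / w)).+1.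
have hN : 2 * (S + 1) <= w *+ N.
  by rewrite -[w *+ N]mulr_natl -ler_pdivrMr//; apply: ltW; exact: truncnS_gt.
have b n : - (S + 1) <= a n <= - (S + 1) + w *+ N.
  have an : `|a n| <= S + 1.
    rewrite -(@ler_pXn2r _ 2) ?nnegrE//; last by clear -S0; lra.
    rewrite real_normK ?num_real// (le_trans (aS n))//.
    by clear -S0; nra.
  move: an; rewrite ler_norml => /andP[-> h] /=; rewrite (le_trans h)//.
  by clear -hN; lra.
have [c hc] : exists c, U [set n | c <= a n <= c + w].
  apply: (@ultra_pigeonhole U a (- (S + 1)) w N UU (ltW w0)).
  by apply: filterS filterT => n _; exact: b.
exists [set n | c <= a n <= c + w]; split => // n k /= /andP[n1 n2] /andP[k1 k2].
rewrite -(sqr_sqrtr (ltW d0)) -/w -[leLHS]real_normK ?num_real//.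
rewrite lerXn2r ?nnegrE ?(ltW w0)// ler_norml.
by apply/andP; split; [clear -n1 k2|clear -n2 k1]; lra.
Qed.

Lemma ultra_forall_le (U : set_system nat) (Q : nat -> nat -> nat -> Prop) : UltraFilter U ->
  (forall j, exists A, U A /\ forall n k, A n -> A k -> Q j n k) ->
  forall N, exists A, U A /\ forall n k, A n -> A k -> forall j, (j <= N)%N -> Q j n k.
Proof.
move=> UU hQ; elim=> [|N [A [UA hA]]].
  have [A [UA hA]] := hQ 0%N; exists A; split => // n k An Ak j.
  by rewrite leqn0 => /eqP ->; exact: hA.
have [B [UB hB]] := hQ N.+1; exists (A `&` B); split; first exact: filterI.
move=> n k [An Bn] [Ak Bk] j; rewrite leq_eqVlt => /predU1P[->|]; first exact: hB.
by rewrite ltnS; exact: hA.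
Qed.

Lemma geometric_cvg (a : nat -> R) (b c : R) :
  (forall k, `|a k - b| <= c * 2^-1 ^+ k) -> a k @[k --> \oo] --> b.
Proof.
move=> ac; apply/cvgrPdist_lt => e e0.
have := @cvg_geometric R c 2^-1; rewrite /geometric/=.
have -> : `|2^-1 : R| < 1 by rewrite ger0_norm//; lra.
move=> /(_ erefl)/cvgrPdist_lt/(_ e e0)[N _ hN]; exists N => // k /= Nk.
have := hN k Nk; rewrite sub0r normrN; apply: le_lt_trans.
by rewrite distrC (le_trans (ac k))// ler_norm.
Qed.

Lemma le_of_le_addM (x y C : R) : 0 <= C ->
  (forall t, 0 < t -> t <= 1 -> x <= y + t * C) -> x <= y.
Proof.
move=> C0 h; apply/ler_addgt0Pr => e e0.
pose t := Num.min 1 (e / (C + 1)).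
have C1 : 0 < C + 1 by clear -C0; lra.
have t0 : 0 < t by rewrite lt_min ltr01 divr_gt0.
have t1 : t <= 1 by rewrite ge_min lexx.
apply: (le_trans (h t t0 t1)); rewrite lerD2l.
apply: (@le_trans _ _ (e / (C + 1) * C)).
  by rewrite ler_wpM2r// ge_min lexx orbT.
by rewrite mulrAC ler_pdivrMr// ler_pM2l// lerDl.
Qed.

Lemma dist2_shift (f f' k k' : R -> R) (T : R) : 0 <= T -> H1pair H f f' -> H1pair H k k' ->
  dist2 H f k <= dist2 `[0, T] f k + 2 * (mass H (hshift T f) + mass H (hshift T k)).
Proof.
move=> T0 ff kk; have eH := @halfline_edge R 1 ltr01.
have mf := H1_measurable eH ff; have mk := H1_measurable eH kk.
have [_ f2 _ _] := ff; have [_ k2 _ _] := kk.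
have mH : measurable H by [].
have d2 := L2_sub mH mf mk f2 k2.
have [i E] := Rintegral_shift T0 d2.
rewrite /dist2 E lerD2l.
have [_ sf _ _] := H1_shift T0 ff; have [_ sk _ _] := H1_shift T0 kk.
rewrite mulrDr -(Rintegral_lincomb 2 2 mH sf sk); apply: le_Rintegral => //.
  exact: integrable_lincomb.
move=> x _; rewrite /hshift; move: (f _) (k _) => y z.
by have := sqr_ge0 (y + z); clear; nra.
Qed.

Lemma ultra_L2_close (U : set_system nat) (p l m e K : R) (u g : nat -> 'I_3 -> R -> R) (n : R) :
  UltraFilter U -> \oo `<=` U -> energy_bound p l m e -> 0 < K ->
  (forall j, star l (u j) (g j)) -> (forall j, smass l (u j) = m) ->
  (forall j, senergy p l (u j) (g j) < e + j.+1%:R^-1) ->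
  (forall j, senergy p l (u j) (g j) <= 0) ->
  (forall j, K <= pow p (pendant l) (u j o2)) -> 0 < n ->
  exists A, U A /\ forall j k, A j -> A k -> sdist l (u j) (u k) <= n.
Proof.
move=> UU oU eb K0 ug um uE uE0 uK n0; have [p2 p6 l0 m0 [e0 _]] := eb.
have [B [S [B0 coer]]] := star_sup_coercive p2 p6 l0 m0.
(* Budget: [n / 6] for each of three bounded pieces, and twice [n / 12] for the tails of each of the
   two functions. *)
have n12 : 0 < n / 12 by clear -n0; lra.
have n6 : 0 < n / 6 by clear -n0; lra.
have [T [s [T0 s0 tight]]] := tight_minimizers eb K0 n12.
(* [T] may be 0, whereas the grid needs an interval of positive length. *)
have T1 : 0 < T + 1 by clear -T0; lra.
have T1' := ltW T1.
have [N [d [d0 grid]]] := grid_close B0 T1 n6.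
have [N' [d' [d0' grid']]] := grid_close B0 l0 n6.
have uS j i x : edge l i x -> u j i x ^+ 2 <= S.
  by have [_ h] := coer _ _ (ug j) (um j) (uE0 j); exact: h.
have uB j : sgrad l (g j) <= B by have [] := coer _ _ (ug j) (um j) (uE0 j).
have close i x (z : R) : edge l i x -> 0 < z ->
    exists A, U A /\ forall j k, A j -> A k -> (u j i x - u k i x) ^+ 2 <= z.
  by move=> ix z0; apply: (ultra_close UU _ z0) => j; exact: uS ix.
have hx (j : nat) (M : nat) (t : R) : 0 <= t -> 0 <= j%:R * (t / M%:R).
  by move=> t0; rewrite mulr_ge0// divr_ge0.
have c0 : forall j : nat, exists A, U A /\ forall a b, A a -> A b ->
    (u a o0 (j%:R * ((T + 1) / N%:R)) - u b o0 (j%:R * ((T + 1) / N%:R))) ^+ 2 <= d.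
  by move=> j; apply: close => //; rewrite /edge/= /halfline/= in_itv/= hx.
have c1 : forall j : nat, exists A, U A /\ forall a b, A a -> A b ->
    (u a o1 (j%:R * ((T + 1) / N%:R)) - u b o1 (j%:R * ((T + 1) / N%:R))) ^+ 2 <= d.
  by move=> j; apply: close => //; rewrite /edge/= /halfline/= in_itv/= hx.
(* Grid points with index above [N'] would leave the pendant, so the condition on [j] is part of the
   property. *)
have c2 : forall j : nat, exists A, U A /\ forall a b, A a -> A b -> (j <= N')%N ->
    (u a o2 (j%:R * (l / N'%:R)) - u b o2 (j%:R * (l / N'%:R))) ^+ 2 <= d'.
  move=> j; have [jN|jN] := leqP j N'; last first.
    by exists setT; split; [exact: filterT|].
  have [|A [UA hA]] := @close o2 (j%:R * (l / N'%:R)) d' _ d0'.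
    rewrite /edge/= /pendant/= in_itv/= (hx _ _ _ (ltW l0))/=.
    (* For [N' = 0] the spacing [l / 0] is 0, and the point is the vertex. *)
    have [N0|N0] := posnP N'; first by rewrite N0 invr0 mulr0 mulr0; exact: ltW.
    by rewrite mulrCA ler_piMr ?(ltW l0)// ler_pdivrMr ?ltr0n// mul1r ler_nat.
  by exists A; split => // a b Aa Ab _; exact: hA.
have [A0 [UA0 hA0]] := ultra_forall_le UU c0 N.
have [A1 [UA1 hA1]] := ultra_forall_le UU c1 N.
have [A2 [UA2 hA2]] := ultra_forall_le UU c2 N'.
pose M := Num.truncn s^-1.
have UM : U [set j | (M <= j)%N] by apply: oU; exists M.
exists (A0 `&` A1 `&` A2 `&` [set j | (M <= j)%N]); split.
  by do 3 apply: filterI => //.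
have tail j : (M <= j)%N ->
    mass H (hshift (T + 1) (u j o0)) + mass H (hshift (T + 1) (u j o1)) <= n / 12.
  move=> Mj; have [gu _] := ug j.
  have TT : T <= T + 1 by clear; lra.
  apply: (@le_trans _ _ (mass H (hshift T (u j o0)) + mass H (hshift T (u j o1)))).
    by apply: lerD; [exact: mass_shift_le (gu o0) T0 TT|exact: mass_shift_le (gu o1) T0 TT].
  apply: (tight _ _ (ug j) (um j) _ (uK j)); apply: (lt_le_trans (uE j)).
  rewrite lerD2l invf_ple ?posrE//; apply: ltW; apply: (lt_le_trans (truncnS_gt _)).
  by rewrite ler_nat ltnS.
move=> j k [[[j0 j1] j2] jM] [[[k0 k1] k2] kM].
have [gj _] := ug j; have [gk _] := ug k.
have sub (f f' : R -> R) : H1pair H f f' -> H1pair `[0, T + 1] f f'.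
  by move=> h; apply: H1_subset h => //; exact: itv_sub_halfline.
have gradsub i f' : grad (edge l i) f' <= B -> (i < 2)%N -> L2 H f' -> grad `[0, T + 1] f' <= B.
  rewrite /edge => + i2; rewrite i2 => h L; apply: le_trans h.
  apply: ge0_Rintegral_subset => //; first exact: itv_sub_halfline.
  by move=> x _; exact: sqr_ge0.
have gB a i : grad (edge l i) (g a i) <= B.
  exact: le_trans (grad_le_sgrad _ _ _) (uB a).
have hL a i : L2 (edge l i) (g a i) by have [_ _ _ ] := star_fun i l0 (ug a).
have e0' : dist2 H (u j o0) (u k o0) <= n / 6 + 2 * (mass H (hshift (T + 1) (u j o0)) + mass H (hshift (T + 1) (u k o0))).
  apply: (le_trans (dist2_shift T1' (gj o0) (gk o0))); rewrite lerD2r.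
  apply: (grid _ _ _ _ (sub _ _ (gj o0)) (sub _ _ (gk o0))).
  - exact: (@gradsub o0 _ (gB j o0) isT (hL j o0)).
  - exact: (@gradsub o0 _ (gB k o0) isT (hL k o0)).
  - exact: hA0.
have e1' : dist2 H (u j o1) (u k o1) <= n / 6 + 2 * (mass H (hshift (T + 1) (u j o1)) + mass H (hshift (T + 1) (u k o1))).
  apply: (le_trans (dist2_shift T1' (gj o1) (gk o1))); rewrite lerD2r.
  apply: (grid _ _ _ _ (sub _ _ (gj o1)) (sub _ _ (gk o1))).
  - exact: (@gradsub o1 _ (gB j o1) isT (hL j o1)).
  - exact: (@gradsub o1 _ (gB k o1) isT (hL k o1)).
  - exact: hA1.
have e2' : dist2 (pendant l) (u j o2) (u k o2) <= n / 6.
  apply: (grid' _ _ _ _ (gj o2) (gk o2) (gB j o2) (gB k o2)).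
  by move=> i iN; apply: hA2 (iN) => //.
have tj := tail j jM; have tk := tail k kM.
rewrite /sdist sum3.
have -> : dist2 (edge l o0) (u j o0) (u k o0) = dist2 H (u j o0) (u k o0) by [].
have -> : dist2 (edge l o1) (u j o1) (u k o1) = dist2 H (u j o1) (u k o1) by [].
have -> : dist2 (edge l o2) (u j o2) (u k o2) = dist2 (pendant l) (u j o2) (u k o2) by [].
move: e0' e1' e2' tj tk; move: (dist2 _ _ _) (dist2 _ _ _) (dist2 _ _ _).
move: (mass _ _) (mass _ _) (mass _ _) (mass _ _).
by clear -n0; move=> *; lra.
Qed.

End existence.

(** * The limit of a minimizing sequence is a ground state *)

Section limit.
Context {R : realType}.
Notation mu := (@lebesgue_measure R).
Notation H := (@halfline R).
Notation o2 := (ord_max : 'I_3).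
Implicit Types (p l m e : R).

(** For each [j] the ultrafilter contains a set on which all pairs are close to order [8^-j], in the
    functions and hence in their derivatives. The index [s j] is taken in the first [j + 1] of these
    sets; [j <= s j] suffices for the energies. *)
Lemma ultra_subsequence p l m e K (u g : nat -> 'I_3 -> R -> R) :
  energy_bound p l m e -> 0 < K ->
  (forall j, star l (u j) (g j)) -> (forall j, smass l (u j) = m) ->
  (forall j, senergy p l (u j) (g j) < e + j.+1%:R^-1) ->
  (forall j, senergy p l (u j) (g j) <= 0) ->
  (forall j, K <= pow p (pendant l) (u j o2)) ->
  exists s : nat -> nat, forall j k, (j <= k)%N ->
    [/\ (j <= s j)%N, sdist l (u (s j)) (u (s k)) <= 8^-1 ^+ j &
        sdist l (g (s j)) (g (s k)) <= 8^-1 ^+ j].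
Proof.
move=> eb K0 ug um uE uE0 uK.
have [U [UU oU]] := ultraFilterLemma (eventually_filter : ProperFilter \oo).
have e80 j : 0 < 8^-1 ^+ j :> R by rewrite exprn_gt0.
have hA j : exists A : set nat, U A /\ forall a b, A a -> A b ->
    sdist l (u a) (u b) <= 8^-1 ^+ j /\ sdist l (g a) (g b) <= 8^-1 ^+ j.
  have [d [d0 hd]] := near_minimizers_close eb (e80 j).
  have dj : 0 < Num.min d (8^-1 ^+ j) by rewrite lt_min d0 e80.
  have [A [UA hA]] := ultra_L2_close UU oU eb K0 ug um uE uE0 uK dj.
  pose M := Num.truncn d^-1.
  have UM : U [set j | (M <= j)%N] by apply: oU; exists M.
  have Ed a : (M <= a)%N -> senergy p l (u a) (g a) < e + d.
    move=> Ma; apply: (lt_le_trans (uE a)).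
    rewrite lerD2l invf_ple ?posrE//; apply: ltW; apply: (lt_le_trans (truncnS_gt _)).
    by rewrite ler_nat ltnS.
  exists (A `&` [set j | (M <= j)%N]); split; first exact: filterI.
  move=> a b [Aa Ma] [Ab Mb]; have := hA a b Aa Ab; rewrite le_min => /andP[h1 h2].
  split => //; exact: (hd _ _ _ _ (ug a) (ug b) (um a) (um b) (Ed a Ma) (Ed b Mb) h1).
have [A hA'] := choice hA.
have UA j : U [set n | forall i, (i <= j)%N -> A i n].
  elim: j => [|j IH].
    have [h _] := hA' 0%N; apply: filterS h => n An i.
    by rewrite leqn0 => /eqP ->.
  have [h _] := hA' j.+1; apply: filterS (filterI IH h) => n [h1 h2] i.
  rewrite leq_eqVlt => /predU1P[->//|]; rewrite ltnS; exact: h1.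
have ex j : exists n, (j <= n)%N /\ forall i, (i <= j)%N -> A i n.
  have Uj : U [set n | (j <= n)%N] by apply: oU; exists j.
  by have [n [h1 h2]] := filter_ex (filterI Uj (UA j)); exists n.
have [s hs] := choice ex; exists s => j k jk.
have [js jA] := hs j; have [_ kA] := hs k; have [_ h] := hA' j.
by have [h1 h2] := h _ _ (jA j (leqnn j)) (kA j jk).
Qed.

Lemma sqrt_geometric (x c : R) j : 0 <= c -> x ^+ 2 <= c * 8^-1 ^+ j ->
  `|x| <= (c + 1) * 2^-1 ^+ j.
Proof.
move=> c0 h.
have z0 : 0 <= 2^-1 ^+ j :> R by rewrite exprn_ge0.
rewrite -(@ler_pXn2r _ 2) ?nnegrE// ?mulr_ge0//; last by clear -c0; lra.
rewrite real_normK ?num_real// (le_trans h)// exprMn.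
apply: ler_pM; [exact: c0|by rewrite exprn_ge0|by clear -c0; nra|].
rewrite -exprM mulnC exprM lerXn2r ?nnegrE//; first by clear; lra.
Qed.

Lemma L2_integrable_itv (x y : R) (f : R -> R) : measurable_fun `[x, y] f -> L2 `[x, y] f ->
  mu.-integrable `[x, y] (EFin \o f).
Proof.
move=> mf f2; have c2 : L2 `[x, y] (fun=> 1 : R) by exact: (integrable_cst_itv x y (1 ^+ 2)).
have := integrable_sqr_mul (measurable_itv _) mf (measurable_cst _) f2 c2.
by apply: eq_integrable => // z _ /=; rewrite mulr1.
Qed.

(** In the identity between increments and integrals, the left side converges pointwise and the
    right side by Cauchy-Schwarz on [[x, y]]. *)
Lemma H1_limit r (I : set R) (u g : nat -> R -> R) (v h : R -> R) (m : R) :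
  is_edge r I -> (forall k, H1pair I (u k) (g k)) -> (forall k, mass I (u k) <= m) ->
  (forall x, I x -> u k x @[k --> \oo] --> v x) ->
  measurable_fun I h -> L2 I h -> (forall k, dist2 I (g k) h <= 8^-1 ^+ k) ->
  H1pair I v h.
Proof.
move=> eI ug um uv mh h2 gh; have [mI _ _ _] := eI.
have mu_ k := H1_measurable eI (ug k).
have u2 k : L2 I (u k) by have [] := ug k.
have [v2 _] := L2_fatou mI mu_ u2 uv um.
split => // x y Ix Iy xy; have sub := edge_itv_sub eI Ix Iy.
have mh' : measurable_fun `[x, y] h by exact: measurable_funS mh.
have hi : mu.-integrable `[x, y] (EFin \o h).
  by apply: L2_integrable_itv => //; apply: integrableS h2.
split => //.
have lim1 : u k y - u k x @[k --> \oo] --> v y - v x by apply: cvgB; exact: uv.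
have lim2 : u k y - u k x @[k --> \oo] --> Rintegral mu `[x, y] h.
  apply: (@geometric_cvg _ _ _ (y - x + 1)) => k.
  apply: sqrt_geometric; first by rewrite subr_ge0.
  have [mg _ g2 FT] := ug k; have [gi ->] := FT x y Ix Iy xy.
  have mg' : measurable_fun `[x, y] (g k) by exact: measurable_funS mg.
  rewrite -RintegralB//.
  have d2 := L2_sub mI mg mh g2 h2.
  have d2' : L2 `[x, y] (fun z => g k z - h z) by apply: integrableS d2.
  have md' : measurable_fun `[x, y] (fun z => g k z - h z) by exact: measurable_funB.
  apply: (le_trans (Rintegral_cauchy_itv xy md' (L2_integrable_itv md' d2') d2')).
  rewrite ler_wpM2l ?subr_ge0//; apply: le_trans (gh k).
  by apply: ge0_Rintegral_subset => // z _; exact: sqr_ge0.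
exact: (cvg_unique _ lim1 lim2).
Qed.

(** Only the derivatives use completeness. The functions converge at every point, by the sup bound
    applied to differences, so continuity at the vertex passes to the limit. *)
Lemma star_limit l m (u g : nat -> 'I_3 -> R -> R) : 0 < l ->
  (forall j, star l (u j) (g j)) -> (forall j, smass l (u j) = m) ->
  (forall j k, (j <= k)%N -> sdist l (u j) (u k) <= 8^-1 ^+ j /\ sdist l (g j) (g k) <= 8^-1 ^+ j) ->
  exists v h, [/\ star l v h, forall i x, edge l i x -> u j i x @[j --> \oo] --> v i x,
    forall j, sdist l (u j) v <= 3 * 8^-1 ^+ j & forall j, sdist l (g j) h <= 3 * 8^-1 ^+ j].
Proof.
move=> l0 ug um hd.
have mE i := measurable_edge i l0.
have hh i : exists f, [/\ measurable_fun (edge l i) f, L2 (edge l i) f &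
    forall j, dist2 (edge l i) (g j i) f <= 8^-1 ^+ j].
  apply: L2_complete => //.
  - by move=> k; have [] := star_fun i l0 (ug k).
  - by move=> k; have [] := star_fun i l0 (ug k).
  - move=> j k jk; apply: (le_trans (dist2_le_sdist l (g j) (g k) i)).
    by have [] := hd j k jk.
have [h hP] := choice hh.
pose v i x := limn (fun j => u j i x).
have l2 : 0 < l / 2 by clear -l0; lra.
pose c := 2 / (l / 2) + 2 * (l / 2).
have c0 : 0 <= c by rewrite addr_ge0 ?divr_ge0 ?mulr_ge0// ltW.
have cv i x : edge l i x -> u j i x @[j --> \oo] --> v i x.
  move=> ix; apply: (@geometric_cauchy_cvg R _ (c + 1)) => j k jk.
  apply: sqrt_geometric => //.
  have := star_sup (x := x) l0 (star_sub l0 (ug j) (ug k)) l2 (lexx _) ix.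
  move=> /le_trans; apply; have [d1 d2] := hd j k jk.
  rewrite /c [leRHS]mulrDl; apply: lerD; apply: ler_wpM2l => //.
  - by rewrite divr_ge0// ltW.
  - by rewrite mulr_ge0// ltW.
have vh i : H1pair (edge l i) (v i) (h i).
  have [m1 m2 m3] := hP i.
  apply: (@H1_limit _ _ (fun j => u j i) (fun j => g j i) _ _ m (edge_half i l0)) => //.
  - by move=> k; have [uu _] := ug k; exact: uu.
  - by move=> k; rewrite -(um k); exact: mass_le_smass.
  - by move=> x ix; exact: cv.
have sum8 (F : 'I_3 -> R) j : (forall i, F i <= 8^-1 ^+ j) -> \sum_(i < 3) F i <= 3 * 8^-1 ^+ j.
  by move=> hF; rewrite sum3; have := hF ord0; have := hF (lift ord0 ord0); have := hF ord_max;
    move: (F _) (F _) (F _) (8^-1 ^+ j); clear; move=> *; lra.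
exists v, h; split => //.
- split => // i; rewrite /v (_ : (fun j => u j i 0) = (fun j => u j ord0 0))//.
  by apply/funext => j; have [_ ->] := ug j.
- move=> j; apply: sum8 => i.
  have [mu_ u2 _ _] := star_fun i l0 (ug j).
  suff [_ hle] : L2 (edge l i) (fun x => u j i x - v i x) /\
      dist2 (edge l i) (u j i) (v i) <= 8^-1 ^+ j by exact: hle.
  apply: (@L2_fatou R (edge l i) (fun k x => u j i x - u (k + j)%N i x)).
  + exact: mE.
  + move=> k; have [mk k2 _ _] := star_fun i l0 (ug (k + j)%N); exact: measurable_funB.
  + move=> k; have [mk k2 _ _] := star_fun i l0 (ug (k + j)%N); exact: L2_sub.
  + move=> x ix; apply: cvgB; first exact: cvg_cst.
    by have := cv i x ix; rewrite -(cvg_shiftn j).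
  + move=> k; apply: (le_trans (dist2_le_sdist l (u j) (u (k + j)%N) i)).
    by have [] := hd j (k + j)%N (leq_addl _ _).
- by move=> j; apply: sum8 => i; have [_ _ h3] := hP i.
Qed.

Lemma sdistC l (u v : 'I_3 -> R -> R) : sdist l u v = sdist l v u.
Proof. by apply: eq_bigr => i _; exact: dist2C. Qed.

Lemma ground_state_exists p l m e : energy_bound p l m e ->
  (forall s, 0 < s -> exists u g, [/\ star l u g, smass l u = m & senergy p l u g < e + s]) ->
  exists v h, [/\ star l v h, smass l v = m & senergy p l v h <= e].
Proof.
move=> eb approx; have [p2 p6 l0 m0 [e0 _]] := eb.
have p0 : 0 < p by lra.
have [K [K0 nv]] := nonvanishing_minimizers eb approx.
have ex (j : nat) : exists w : ('I_3 -> R -> R) * ('I_3 -> R -> R), [/\ star l w.1 w.2,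
    smass l w.1 = m, senergy p l w.1 w.2 < e + j.+1%:R^-1, senergy p l w.1 w.2 <= 0 &
    K <= pow p (pendant l) (w.1 o2)].
  have s0 : 0 < Num.min (j.+1%:R^-1) (- e) by rewrite lt_min invr_gt0 ltr0n oppr_gt0.
  have [u [g [h1 h2 h3 h4]]] := nv _ s0; exists (u, g); split => //=.
    by apply: (lt_le_trans h3); rewrite lerD2l ge_min lexx.
  apply: ltW; apply: (lt_le_trans h3).
  by rewrite -lerBrDl sub0r ge_min lexx orbT.
have [w hw] := choice ex.
have ug j : star l (w j).1 (w j).2 by have [] := hw j.
have um j : smass l (w j).1 = m by have [] := hw j.
have uE j : senergy p l (w j).1 (w j).2 < e + j.+1%:R^-1 by have [] := hw j.
have uE0 j : senergy p l (w j).1 (w j).2 <= 0 by have [] := hw j.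
have uK j : K <= pow p (pendant l) ((w j).1 o2) by have [] := hw j.
have [s hs] := @ultra_subsequence p l m e K (fun j => (w j).1) (fun j => (w j).2) eb K0 ug um uE uE0 uK.
pose u j := (w (s j)).1; pose g j := (w (s j)).2.
have [|v [h [vh cv du dg]]] := @star_limit l m u g l0 (fun j => ug (s j)) (fun j => um (s j)).
  by move=> j k jk; have [_ ? ?] := hs j k jk.
have [B [S [B0 coer]]] := star_sup_coercive p2 p6 l0 m0.
have uS j i x : edge l i x -> u j i x ^+ 2 <= S.
  by have [_ hS] := coer _ _ (ug (s j)) (um (s j)) (uE0 (s j)); exact: hS.
have uB j : sgrad l (g j) <= B by have [] := coer _ _ (ug (s j)) (um (s j)) (uE0 (s j)).
have vS i x : edge l i x -> v i x ^+ 2 <= S.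
  move=> ix; have c2 : u j i x ^+ 2 @[j --> \oo] --> v i x ^+ 2.
    by rewrite expr2; apply: cvgM; exact: cv.
  by rewrite -(cvg_lim _ c2)//; apply: limr_le; [exact: cvgP c2|apply: nearW => j; exact: uS].
have small (t : R) : 0 < t -> exists j, 3 * 8^-1 ^+ j <= t ^+ 2 /\ j.+1%:R^-1 <= t.
  move=> t0; have t20 : 0 < t ^+ 2 by rewrite exprn_gt0.
  have := @cvg_geometric R 3 8^-1; rewrite /geometric/=.
  have -> : `|8^-1 : R| < 1 by rewrite ger0_norm//; lra.
  move=> /(_ erefl)/cvgrPdist_lt/(_ _ t20)[N _ hN].
  exists (maxn N (Num.truncn t^-1)); split.
    have := hN (maxn N (Num.truncn t^-1)) (leq_maxl _ _); rewrite sub0r normrN => /ltW.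
    by apply: le_trans; exact: ler_norm.
  rewrite invf_ple ?posrE//; apply: ltW; apply: (lt_le_trans (truncnS_gt _)).
  by rewrite ler_nat ltnS leq_maxr.
(* With squared distance at most [t ^+ 2], the weighted triangle inequality has error
   [(1 + t^-1) * t ^+ 2 = t ^+ 2 + t]. Used in both directions, it shows that no mass is lost. *)
have vm : smass l v = m.
  apply/eqP; rewrite eq_le; apply/andP; split.
    apply: (@le_of_le_addM _ _ _ (m + 2)); first by clear -m0; lra.
    move=> t t0 t1; have [j [j1 _]] := small t t0.
    have := smass_triangle l0 vh (ug (s j)) t0; rewrite um sdistC -/(u j).
    have dj := le_trans (du j) j1.
    have : (1 + t^-1) * sdist l (u j) v <= (1 + t^-1) * t ^+ 2.
      by rewrite ler_wpM2l// addr_ge0// invr_ge0 ltW.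
    rewrite (_ : (1 + t^-1) * t ^+ 2 = t ^+ 2 + t); last by clear -t0; field; lra.
    have : t ^+ 2 <= t by rewrite expr2 ler_piMr// ltW.
    by move: (t ^+ 2) (_ * sdist _ _ _) (smass l v); clear; move=> *; lra.
  apply: (@le_of_le_addM _ _ _ (smass l v + 2)); first by rewrite addr_ge0// smass_ge0.
  move=> t t0 t1; have [j [j1 _]] := small t t0.
  have := smass_triangle l0 (ug (s j)) vh t0; rewrite um -/(u j).
  have dj := le_trans (du j) j1.
  have : (1 + t^-1) * sdist l (u j) v <= (1 + t^-1) * t ^+ 2.
    by rewrite ler_wpM2l// addr_ge0// invr_ge0 ltW.
  rewrite (_ : (1 + t^-1) * t ^+ 2 = t ^+ 2 + t); last by clear -t0; field; lra.
  have : t ^+ 2 <= t by rewrite expr2 ler_piMr// ltW.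
  by move: (t ^+ 2) (_ * sdist _ _ _) (smass l v); clear; move=> *; lra.
exists v, h; split => //.
pose W := S `^ (p / 2 - 1) / 2.
have W0 : 0 <= W by rewrite divr_ge0 ?powR_ge0.
have WE : p / 2 * S `^ (p / 2 - 1) = p * W by rewrite /W; clear; field.
(* Errors of order [t]: 1 for the near minimizer, [(B + 2) / 2] for the kinetic part,
   [W * (4 * m + 1)] for the potential part. *)
apply: (@le_of_le_addM _ _ _ (1 + (B + 2) / 2 + W * (4 * m + 1))).
  apply: addr_ge0; first by clear -B0; lra.
  by apply: mulr_ge0 => //; clear -m0; lra.
move=> t t0 t1; have [j [j1 j2]] := small t t0.
have tt : t ^+ 2 <= t by rewrite expr2 ler_piMr// ltW.
have dj := le_trans (du j) j1; have gj := le_trans (dg j) j1.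
have Ej : senergy p l (u j) (g j) < e + t.
  apply: (lt_le_trans (uE (s j))); rewrite lerD2l (le_trans _ j2)//.
  by rewrite lef_pV2 ?posrE ?ltr0n// ler_nat ltnS; have [] := hs j j (leqnn j).
have G : sgrad l h <= sgrad l (g j) + t * (B + 2).
  have := sgrad_triangle l0 vh (ug (s j)) t0; rewrite sdistC -/(g j).
  have : (1 + t^-1) * sdist l (g j) h <= (1 + t^-1) * t ^+ 2.
    by rewrite ler_wpM2l// addr_ge0// invr_ge0 ltW.
  rewrite (_ : (1 + t^-1) * t ^+ 2 = t ^+ 2 + t); last by clear -t0; field; lra.
  have : t * sgrad l (g j) <= t * B by rewrite ler_pM2l.
  move: tt; move: (t ^+ 2) (_ * sdist _ _ _) (sgrad l (g j)) (sgrad l h).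
  by clear; move=> *; lra.
have P := spow_sdist p2 l0 (ug (s j)) vh (uS j) vS t0.
rewrite um vm WE -/(u j) in P.
have {}P : spow p l (u j) <= spow p l v + p * (W * (t * (4 * m + 1))).
  apply: (le_trans P); rewrite lerD2l -mulrA ler_pM2l// ler_wpM2l//.
  rewrite [t * (4 * m + 1)]mulrDr mulr1; apply: lerD; first by clear; lra.
  rewrite ler_pdivrMr; last by clear -t0; lra.
  by apply: (le_trans dj); rewrite expr2; clear -t0; nra.
have pV : 0 < p^-1 by rewrite invr_gt0.
move: P; rewrite -(ler_pM2l pV) mulrDr mulKf ?gt_eqF// => P.
move: Ej; rewrite /senergy; move: P G.
move: (p^-1 * spow p l (u j)) (p^-1 * spow p l v) (sgrad l (g j)) (sgrad l h).
by generalize W; clear; move=> *; lra.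
Qed.

(** The infimum is finite because an energy at most 0 forces a uniform sup bound, which limits the
    potential energy; the test function makes it negative. *)
Lemma exists_energy_bound p l m : 2 < p -> p < 6 -> 0 < l -> 0 < m ->
  exists e, energy_bound p l m e /\
  forall s, 0 < s -> exists u g, [/\ star l u g, smass l u = m & senergy p l u g < e + s].
Proof.
move=> p2 p6 l0 m0.
pose E := [set x : R | exists u g, [/\ star l u g, smass l u = m & x = senergy p l u g]].
have [u0 [g0 [ug0 um0 uE0]]] := exists_negative_energy p2 p6 l0 m0.
have [B [S [B0 coer]]] := star_sup_coercive p2 p6 l0 m0.
have Ei : has_inf E.
  split; first by exists (senergy p l u0 g0), u0, g0.
  exists (- (S `^ (p / 2 - 1) * m / p)) => _ [u [g [ug um ->]]].
  have c0 : 0 <= S `^ (p / 2 - 1) * m / p.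
    by rewrite divr_ge0 ?mulr_ge0 ?powR_ge0//; [exact: ltW|clear -p2; lra].
  have [E0|/ltW E0] := leP (senergy p l u g) 0; last by apply: le_trans E0; rewrite oppr_le0.
  have [_ uS] := coer _ _ ug um E0.
  have := spow_le_smass p2 l0 ug uS; rewrite um => h.
  have : spow p l u / p <= S `^ (p / 2 - 1) * m / p.
    by rewrite ler_pM2r// invr_gt0; clear -p2; lra.
  have := sgrad_ge0 l g; rewrite /senergy [p^-1 * _]mulrC.
  by move: (spow p l u / p) (_ * m / p) (sgrad l g); clear; move=> *; lra.
exists (inf E); split.
  split => //; split.
    apply: le_lt_trans uE0; apply: ge_inf; first by case: Ei.
    by exists u0, g0.
  by move=> u g ug um; apply: ge_inf; [case: Ei|exists u, g].
move=> s s0; have [_ [u [g [ug um ->]]] h] := inf_adherent s0 Ei.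
by exists u, g.
Qed.

End limit.

Theorem theorem6p3 (R : realType) (p m l : R) :
  2 < p -> p < 6 -> 0 < m -> 0 < l ->
  (* for the soliton phi_m (any minimizer of E(., R) on H^1_m(R), with
     derivative dphi):  inf_{H^1_m(G)} E(., G) < E(phi_m, R) *)
  (forall phi dphi : R -> R,
     H1mu_line m phi dphi ->
     (forall u g, H1mu_line m u g -> energy p [set: R] phi dphi <= energy p [set: R] u g) ->
     (inf_energy_pendant p l m < (energy p [set: R] phi dphi)%:E)%E)
  /\
  (* hence G admits a ground state of mass m *)
  (exists u1 g1 u2 g2 u3 g3 : R -> R,
     H1mu_pendant l m u1 g1 u2 g2 u3 g3 /\
     forall v1 h1 v2 h2 v3 h3, H1mu_pendant l m v1 h1 v2 h2 v3 h3 ->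
       energy_pendant p l u1 g1 u2 g2 u3 g3 <= energy_pendant p l v1 h1 v2 h2 v3 h3).
Proof.
move=> p2 p6 m0 l0; split.
  move=> phi dphi hphi _.
  have [v [h [vh vm vE]]] := line_energy_gt p2 p6 m0 l0 hphi.
  apply: (@le_lt_trans _ _ (senergy p l v h)%:E); last by rewrite lte_fin.
  apply: ereal_inf_lbound.
  have hv := star_H1mu_pendant vh; rewrite vm in hv.
  do 6 eexists; split; first exact: hv.
  by rewrite energy_pendant_star !triE.
have [e [eb approx]] := exists_energy_bound p2 p6 l0 m0.
have [v [h [vh vm vE]]] := ground_state_exists eb approx.
have hv := star_H1mu_pendant vh; rewrite vm in hv.
do 6 eexists; split; first exact: hv.
move=> v1 h1 v2 h2 v3 h3 hv'; have [w wm] := H1mu_pendant_star hv'.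
rewrite !energy_pendant_star !triE (le_trans vE)//.
by have [_ _ _ _ [_ lb]] := eb; exact: lb.
Qed.
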